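(* Let $b_0,b_1,b_2,\dots$ be an infinite sequence of independent, identically distributed real random variables with mean $0$, variance $1$, and finite moments of all higher orders. For each $N\ge1$ let $A$ be the $N\times N$ circulant Toeplitz matrix populated by $b_0,\dots,b_{N-1}$, let $J$ be the $N\times N$ exchange matrix, and let $G_{2N}=\operatorname{swirl}(A,J)$. Then, almost surely, as $N\to\infty$ the empirical spectral measures $\mu_{G_{2N}}$ converge (weakly) to the symmetrized Rayleigh distribution, i.e. the probability measure on $\mathbb{R}$ with density $|x|e^{-x^2}$.
   Context: For $N\times N$ matrices $A,X$, $\operatorname{swirl}(A,X)$ is the $2N\times 2N$ block matrix $$\operatorname{swirl}(A,X)=\begin{pmatrix} AX & A\\ XAX & XA\end{pmatrix}.$$ The $N\times N$ circulant Toeplitz matrix populated by $b_0,\dots,b_{N-1}$ is $A=(a_{ij})_{0\le i,j\le N-1}$ with $a_{ij}=b_{(j-i)\bmod N}$ (not necessarily symmetric). The exchange matrix $J$ has $1$'s on the antidiagonal and $0$'s elsewhere. The matrix $G_{2N}=\operatorname{swirl}(A,J)$ is real symmetric and half of its rows are repetitions of the other half, so among its $2N$ eigenvalues (with multiplicity) at least $N$ are trivially zero. Let $\lambda_1(G_{2N}),\dots,\lambda_N(G_{2N})$ be the $N$ eigenvalues (with multiplicity) that remain after removing $N$ zeros. The empirical spectral measure is $$\mu_{G_{2N}}=\frac1N\sum_{i=1}^N\delta_{\lambda_i(G_{2N})/(2\sqrt N)},$$ where $\delta_y$ is the unit point mass at $y$. *)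

(* Defs.v *)
From HB Require Import structures.
From mathcomp Require Import all_boot all_order all_algebra.
From mathcomp Require Import polyrcf.
From mathcomp Require Import all_classical all_reals all_analysis.
From mathcomp Require Import measurable_realfun.

Set Implicit Arguments.
Unset Strict Implicit.
Unset Printing Implicit Defensive.

Import Order.TTheory GRing.Theory Num.Theory.
Import numFieldNormedType.Exports.

Local Open Scope classical_set_scope.
Local Open Scope ring_scope.

(* 0-based indices. For i, j < N the natural number (j + N - i) %% N is
   (j - i) mod N, without any truncation of the subtraction. *)
Definition circulant (R : Type) (N : nat) (b : nat -> R) : 'M[R]_N :=
  \matrix_(i < N, j < N) b ((j + N - i) %% N)%N.

Definition exchange_mx (R : pzSemiRingType) (N : nat) : 'M[R]_N :=
  \matrix_(i < N, j < N) ((i + j).+1 == N)%:R.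

Definition swirl (R : pzSemiRingType) (N : nat) (A X : 'M[R]_N) :
    'M[R]_(N + N) :=
  block_mx (A *m X) A (X *m A *m X) (X *m A).

(* The real eigenvalues, each repeated according to its multiplicity as a root
   of the characteristic polynomial. For a real symmetric matrix this is the
   whole spectrum, so the list has length n. *)
Definition eigenvalues (R : rcfType) (n : nat) (M : 'M[R]_n) : seq R :=
  flatten [seq nseq (mup x (char_poly M)) x | x <- rootsR (char_poly M)].

Definition remove_zeros (R : nzRingType) (k : nat) (s : seq R) : seq R :=
  iter k (fun t => rem 0 t) s.

Section empirical_spectral_measure.
Context {R : realType}.

Definition swirl_circulant (N : nat) (b : nat -> R) : 'M[R]_(N + N) :=
  swirl (circulant N b) (exchange_mx R N).

Definition nontrivial_eigenvalue (N : nat) (b : nat -> R) (i : nat) : R :=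
  nth 0 (remove_zeros N (eigenvalues (swirl_circulant N b))) i.

(* For N = 0 this is the zero measure. *)
Definition empirical_spectral_measure (N : nat) (b : nat -> R) :
    {measure set (measurableTypeR R) -> \bar R} :=
  mscale (N%:R^-1)%:nng
    (msum (fun i => dirac (nontrivial_eigenvalue N b i / (2 * Num.sqrt N%:R)
                           : measurableTypeR R)) N).

End empirical_spectral_measure.

Definition symmetrized_rayleigh_pdf {R : realType} (x : R) : R :=
  `|x| * expR (- x ^+ 2).

Definition symmetrized_rayleigh {R : realType} :
    set (measurableTypeR R) -> \bar R :=
  fun V => (\int[lebesgue_measure]_(x in V) (symmetrized_rayleigh_pdf x)%:E)%E.

Section symmetrized_rayleigh_probability.
Context {R : realType}.
Local Notation mu := (@lebesgue_measure R).
Local Notation pdf := (@symmetrized_rayleigh_pdf R).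

Lemma symmetrized_rayleigh_pdf_ge0 (x : R) : 0 <= pdf x.
Proof. by rewrite mulr_ge0 ?expR_ge0. Qed.

Lemma continuous_symmetrized_rayleigh_pdf : continuous pdf.
Proof.
move=> x; apply: (@continuousM _ R^o (fun x => `|x|) gauss_fun).
  exact: norm_continuous.
exact: continuous_gauss_fun.
Qed.

Lemma measurable_symmetrized_rayleigh_pdf : measurable_fun setT pdf.
Proof.
exact: continuous_measurable_fun continuous_symmetrized_rayleigh_pdf.
Qed.

Let F (x : R) : R := - (2^-1 * gauss_fun x).

Let is_deriveF (x : R) : is_derive x 1 F (x * gauss_fun x).
Proof.
have d1 : is_derive x 1 (fun y : R => - y ^+ 2) (- (2 * x)).
  apply: is_derive_eq; congr (- _).
  by rewrite /GRing.scale/= mulr1 mulr_natl.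
have d2 : is_derive x 1 (gauss_fun : R -> R) (gauss_fun x * - (2 * x)).
  exact: is_derive1_comp.
apply: is_derive_eq.
by rewrite mulrN scalerN opprK /GRing.scale/= mulrCA mulKf// mulrC.
Qed.

Lemma integral_symmetrized_rayleigh_pdf : (\int[mu]_x (pdf x)%:E = 1)%E.
Proof.
rewrite ge0_symfun_integralT.
- rewrite (_ : [set x : R | _] = `[0, +oo[%classic); last first.
    by apply/seteqP; split => x /=; rewrite in_itv/= andbT.
  rewrite (@ge0_continuous_FTC2y _ pdf F 0 0).
  + rewrite /F /gauss_fun expr0n/= oppr0 expR0 mulr1 -EFinB sub0r.
    by rewrite opprK -EFinM divff.
  + by move=> x _; exact: symmetrized_rayleigh_pdf_ge0.
  + apply: continuous_subspaceT; exact: continuous_symmetrized_rayleigh_pdf.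
  + rewrite -oppr0; apply: cvgN; rewrite -(mulr0 2^-1).
    by apply: cvgMr; exact: cvg_gauss_fun.
  + by move=> x _; exact: ex_derive.
  + apply: cvg_at_right_filter; apply: differentiable_continuous.
    by apply/derivable1_diffP; exact: ex_derive.
  + move=> x; rewrite in_itv/= andbT => x0.
    by rewrite derive1E (@derive_val _ _ _ _ _ _ _ (is_deriveF x)) /symmetrized_rayleigh_pdf gtr0_norm.
- exact: symmetrized_rayleigh_pdf_ge0.
- exact: continuous_symmetrized_rayleigh_pdf.
- by move=> x; rewrite /symmetrized_rayleigh_pdf/= normrN sqrrN.
Qed.

Local Notation nu := (@symmetrized_rayleigh R).

Let nu0 : nu set0 = 0%E.
Proof. by rewrite /symmetrized_rayleigh integral_set0. Qed.

Let nu_ge0 A : (0 <= nu A)%E.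
Proof.
by apply: integral_ge0 => x _; rewrite lee_fin symmetrized_rayleigh_pdf_ge0.
Qed.

Let nu_sigma_additive : semi_sigma_additive nu.
Proof.
move=> /= A mA tA mUA; rewrite /symmetrized_rayleigh; apply: cvg_toP.
  apply: ereal_nondecreasing_is_cvgn => m n mn.
  apply: lee_sum_nneg_natr => // k _ _; apply: integral_ge0 => /= x _.
  by rewrite lee_fin symmetrized_rayleigh_pdf_ge0.
rewrite ge0_integral_bigcup//=.
- apply/measurable_funTS/measurable_EFinP.
  exact: measurable_symmetrized_rayleigh_pdf.
- by move=> x _; rewrite lee_fin symmetrized_rayleigh_pdf_ge0.
Qed.

HB.instance Definition _ :=
  isMeasure.Build _ _ _ nu nu0 nu_ge0 nu_sigma_additive.

Let nu_setT : nu [set: _] = 1%E.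
Proof. exact: integral_symmetrized_rayleigh_pdf. Qed.

HB.instance Definition _ := @Measure_isProbability.Build _ _ R nu nu_setT.

End symmetrized_rayleigh_probability.

Definition weakly_converges {R : realType}
    (mu : nat -> {measure set (measurableTypeR R) -> \bar R})
    (nu : {measure set (measurableTypeR R) -> \bar R}) : Prop :=
  forall f : R -> R, continuous f -> (exists M, forall x, `|f x| <= M) ->
    (\int[mu n]_x (f x)%:E)%E @[n --> \oo] --> (\int[nu]_x (f x)%:E)%E.

Definition mutually_independent {d : measure_display} {T : measurableType d}
    {R : realType} (P : probability T R) (X : nat -> {RV P >-> R}) : Prop :=
  forall (s : seq nat) (B : nat -> set (measurableTypeR R)),
    uniq s -> (forall i, measurable (B i)) ->
    P (\bigcap_(i in [set` s]) (X i @^-1` B i)) =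
      (\prod_(i <- s) P (X i @^-1` B i))%E.

Definition identically_distributed {d : measure_display}
    {T : measurableType d} {R : realType} (P : probability T R)
    (X : nat -> {RV P >-> R}) : Prop :=
  forall (i j : nat) (B : set (measurableTypeR R)), measurable B ->
    distribution P (X i) B = distribution P (X j) B.

(* Main.v *)
(* Multiplying the circulant matrix by J gives a Hankel circulant matrix. Its
   eigenvalues are, up to sign, the moduli of the discrete Fourier coefficients
   x_k + i y_k of the b_j, with signs balanced except for at most two of them,
   and the nontrivial eigenvalues of the swirl are twice these numbers.

   Almost surely, the mean over k of cos ((a x_k + c y_k) / sqrt N) tends to
   exp (- (a^2 + c^2) / 4). Following McLeish, cos (\sum_j t_j b_j) is compared
   with the real part of \prod_j (1 + i t_j b_j), up to the factor
   exp (- \sum_j (t_j b_j)^2 / 2), which concentrates. The mean over k of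
   these real parts, minus 1, is a multilinear polynomial in independent
   centered variables. Hypercontractivity bounds its fourth moment by the square
   of a weighted second moment, which is O(1/N) by the orthogonality of the
   characters, so these fourth moments are summable. Equicontinuity in (a, c)
   reduces the claim for all (a, c) to rational pairs.

   Averaging over Gaussian a and c, the mean over k of exp (- s r_k^2), where
   r_k^2 = (x_k^2 + y_k^2) / N, tends to 1 / (1 + s), which is the integral of
   exp (- s x^2) against |x| exp (- x^2). Since an even bounded continuous
   function is a function of exp (- x^2), the Weierstrass approximation theorem
   turns this into weak convergence. *)

Require Import Defs.
From HB Require Import structures.
From mathcomp Require Import all_boot all_order all_algebra.
From mathcomp Require Import polyrcf.
From mathcomp Require Import all_classical all_reals all_analysis.
From mathcomp Require Import measurable_realfun.
From mathcomp Require Import ring lra zify.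

Set Implicit Arguments.
Unset Strict Implicit.
Unset Printing Implicit Defensive.

Import Order.TTheory GRing.Theory Num.Theory.
Import numFieldNormedType.Exports.

Local Open Scope classical_set_scope.
Local Open Scope ring_scope.

(** * Trigonometric sums *)

Section trigonometric_sums.
Context {R : realType}.
Implicit Types (N m n s : nat) (t u : R).

(** The moduli are not linear in the [b j], whereas independence acts on linear forms. This is why
    exp (- s r_k^2) is the test function: it is a Gaussian mixture of cosines of the forms a x_k + c
    y_k. A variance of order 1/N is not summable over N, hence fourth moments. The price of
    hypercontractivity is a weight C^degree, which merely rescales the exponents in products of 1 +
    C t_kj t_lj / N. Their sum over j still vanishes by orthogonality unless l = k or l = - k modulo
    N, so about 2N of the N^2 pairs matter. The exponent in the comparison with the cosine is not
    concentrated uniformly in k. Besides a constant multiple of the empirical second moment, it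
    carries the Fourier coefficient of the b_j^2 at frequency 2k. This is small only in mean over k,
    which is enough because doubling modulo N is at most two-to-one. As a function of u = exp (-
    x^2), a bounded even function may have no limit at u = 0, the image of infinity. The factor 1 -
    (1 - u)^n repairs this, and its cost M (1 - u)^n is again a polynomial in u, hence measured by
    the same convergence. *)

Definition ang N m : R := pi *+ 2 * m%:R / N%:R.

Lemma angD N m n : ang N (m + n) = ang N m + ang N n.
Proof. by rewrite /ang natrD mulrDr mulrDl. Qed.

Lemma ang0 N : ang N 0 = 0.
Proof. by rewrite /ang mulr0 mul0r. Qed.

Lemma ang_dvd N q : (0 < N)%N -> ang N (q * N) = pi *+ 2 *+ q.
Proof.
move=> N0; rewrite /ang natrM mulrA mulfK ?mulr_natr//.
by rewrite pnatr_eq0 -lt0n.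
Qed.

Lemma cos_ang_dvd N q t : (0 < N)%N -> cos (t + ang N (q * N)) = cos t.
Proof. by move=> N0; rewrite ang_dvd// (periodicn (@cosD2pi R)). Qed.

Lemma sin_ang_dvd N q t : (0 < N)%N -> sin (t + ang N (q * N)) = sin t.
Proof. by move=> N0; rewrite ang_dvd// (periodicn (@sinD2pi R)). Qed.

(** Multiplied by 2 sin h, with h half the angular step, each cosine becomes a difference of two
    sines, and the sum telescopes over full periods. Reducing [m] modulo [N] beforehand puts h
    strictly between 0 and pi, so sin h is nonzero. *)
Lemma sum_cos_ang N m t : (0 < N)%N ->
  \sum_(j < N) cos (ang N (m * j) + t) = if (N %| m)%N then N%:R * cos t else 0.
Proof.
move=> N0; case: ifPn => [/dvdnP[q ->]|Nm].
  rewrite (eq_bigr (fun=> cos t)) => [|j _]; last first.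
    by rewrite addrC mulnAC cos_ang_dvd.
  by rewrite sumr_const card_ord mulr_natl.
set r := (m %% N)%N.
have r0 : (0 < r)%N by rewrite lt0n.
have rN : (r < N)%N by rewrite ltn_mod.
have Npos : (0 : R) < N%:R by rewrite ltr0n.
rewrite (eq_bigr (fun j : 'I_N => cos (ang N (r * j) + t))) => [|j _]; last first.
  rewrite {1}(divn_eq m N) mulnDl mulnAC angD -/r -[RHS](@cos_ang_dvd N (m %/ N * j))//.
  by congr cos; ring.
pose h : R := pi * r%:R / N%:R.
have sh : 0 < sin h.
  apply: sin_gt0_pi; rewrite divr_gt0 ?mulr_gt0 ?pi_gt0 ?ltr0n//=.
  by rewrite ltr_pdivrMr// ltr_pM2l ?pi_gt0// ltr_nat.
pose S j : R := sin (ang N (r * j) + t - h).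
have tele j : sin h *+ 2 * cos (ang N (r * j) + t) = S j.+1 - S j.
  have -> : S j.+1 = sin (ang N (r * j) + t + h).
    congr sin; rewrite mulnS angD /ang /h.
    by rewrite (_ : pi *+ 2 * r%:R / N%:R = h + h) /h; ring.
  by rewrite /S sinB sinD; ring.
apply: (@mulfI _ (sin h *+ 2)); first by rewrite mulrn_eq0/= gt_eqF.
rewrite mulr0 mulr_sumr (eq_bigr (fun j : 'I_N => S j.+1 - S j)) => [|j _]; last exact: tele.
rewrite -(big_mkord xpredT (fun j => S j.+1 - S j)) telescope_sumr//.
have -> : S N = S 0 by rewrite /S -addrA [in LHS]addrC sin_ang_dvd// muln0 ang0 add0r.
by rewrite subrr.
Qed.

Lemma sum_cos_ang_shift N m s t : (0 < N)%N ->
  \sum_(j < N) cos (ang N (m * (j + s)) + t) =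
  if (N %| m)%N then N%:R * cos t else 0.
Proof.
move=> N0; transitivity (\sum_(j < N) cos (ang N (m * j) + (t + ang N (m * s)))).
  by apply: eq_bigr => j _; rewrite mulnDr angD; congr cos; ring.
rewrite sum_cos_ang//; case: ifPn => // /dvdnP[q ->].
by rewrite mulnAC cos_ang_dvd.
Qed.

Lemma sum_cos_angD N m n s t : (0 < N)%N ->
  \sum_(j < N) cos (ang N (m * (j + s)) + ang N (n * (j + s)) + t) =
  if (N %| m + n)%N then N%:R * cos t else 0.
Proof.
move=> N0; rewrite -(sum_cos_ang_shift _ s)//.
by apply: eq_bigr => j _; rewrite mulnDl angD.
Qed.

Lemma sum_cos_angB N m n s t : (0 < N)%N ->
  \sum_(j < N) cos (ang N (m * (j + s)) - ang N (n * (j + s)) + t) =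
  if m == n %[mod N] then N%:R * cos t else 0.
Proof.
move=> N0; wlog nm : m n t / (n <= m)%N => [H|].
  case/orP: (leq_total n m) => nm; first exact: H.
  rewrite eq_sym -(cosN t) -H//; apply: eq_bigr => j _; rewrite -[LHS]cosN; congr cos; ring.
rewrite eqn_mod_dvd// -(sum_cos_ang_shift _ s)//.
apply: eq_bigr => j _; congr (cos (_ + _)); rewrite -{1}(subnK nm) mulnDl angD; ring.
Qed.

Lemma sum_cos_cos N m n s : (0 < N)%N ->
  \sum_(j < N) cos (ang N (m * (j + s))) * cos (ang N (n * (j + s))) =
  N%:R / 2 * ((m == n %[mod N])%:R + (N %| m + n)%N%:R).
Proof.
move=> N0; have := sum_cos_angD m n s 0 N0; have := sum_cos_angB m n s 0 N0.
rewrite cos0 mulr1 => HB HD.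
transitivity (2^-1 * (\sum_(j < N) cos (ang N (m * (j + s)) - ang N (n * (j + s)) + 0)
   + \sum_(j < N) cos (ang N (m * (j + s)) + ang N (n * (j + s)) + 0))).
  rewrite -big_split mulr_sumr; apply: eq_bigr => j _ /=.
  by rewrite !addr0 cosB cosD; field.
by rewrite HB HD; case: (m == n %[mod N]); case: (N %| m + n)%N; rewrite /=; field.
Qed.

Lemma sum_sin_sin N m n s : (0 < N)%N ->
  \sum_(j < N) sin (ang N (m * (j + s))) * sin (ang N (n * (j + s))) =
  N%:R / 2 * ((m == n %[mod N])%:R - (N %| m + n)%N%:R).
Proof.
move=> N0; have := sum_cos_angD m n s 0 N0; have := sum_cos_angB m n s 0 N0.
rewrite cos0 mulr1 => HB HD.
transitivity (2^-1 * (\sum_(j < N) cos (ang N (m * (j + s)) - ang N (n * (j + s)) + 0)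
   - \sum_(j < N) cos (ang N (m * (j + s)) + ang N (n * (j + s)) + 0))).
  rewrite -sumrB mulr_sumr; apply: eq_bigr => j _ /=.
  by rewrite !addr0 cosB cosD; field.
by rewrite HB HD; case: (m == n %[mod N]); case: (N %| m + n)%N; rewrite /=; field.
Qed.

Lemma sum_sin_cos N m n s : (0 < N)%N ->
  \sum_(j < N) sin (ang N (m * (j + s))) * cos (ang N (n * (j + s))) = 0.
Proof.
move=> N0; have := sum_cos_angD m n s (- (pi / 2)) N0; have := sum_cos_angB m n s (- (pi / 2)) N0.
rewrite cosN cos_pihalf mulr0 !if_same => HB HD.
transitivity (2^-1 * (\sum_(j < N) cos (ang N (m * (j + s)) - ang N (n * (j + s)) - pi / 2)
   + \sum_(j < N) cos (ang N (m * (j + s)) + ang N (n * (j + s)) - pi / 2))).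
  rewrite -big_split mulr_sumr; apply: eq_bigr => j _ /=.
  by rewrite !cosBpihalf sinB sinD; field.
by rewrite HB HD addr0 mulr0.
Qed.

Lemma sum_trig_orthogonal N m n s a b : (0 < N)%N ->
  ~~ (m == n %[mod N]) -> ~~ (N %| m + n)%N ->
  \sum_(j < N) (a * cos (ang N (m * (j + s))) + b * sin (ang N (m * (j + s)))) *
               (a * cos (ang N (n * (j + s))) + b * sin (ang N (n * (j + s)))) = 0.
Proof.
move=> N0 /negbTE mn /negbTE mn'.
have cc := sum_cos_cos m n s N0; have ss := sum_sin_sin m n s N0.
have sc := sum_sin_cos m n s N0; have cs := sum_sin_cos n m s N0.
rewrite mn mn' addr0 mulr0 in cc; rewrite mn mn' subr0 mulr0 in ss.
pose c (m j : nat) : R := cos (ang N (m * (j + s))); pose d (m j : nat) : R := sin (ang N (m * (j + s))).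
transitivity (a ^+ 2 * (\sum_(j < N) c m j * c n j) + b ^+ 2 * (\sum_(j < N) d m j * d n j)
    + a * b * (\sum_(j < N) d m j * c n j) + a * b * (\sum_(j < N) d n j * c m j)).
  rewrite !mulr_sumr -!big_split.
  by apply: eq_bigr => j _ /=; rewrite -/(c m j) -/(c n j) -/(d m j) -/(d n j); ring.
by rewrite [X in _ * X + _ + _ + _]cc [X in _ + _ * X + _ + _]ss
  [X in _ + _ * X + _]sc [X in _ + _ * X]cs !mulr0 !addr0.
Qed.

End trigonometric_sums.

(** * The spectrum of the swirl *)

Section eigenvalue_lists.

Lemma char_poly_similar (F : fieldType) n (M S D : 'M[F]_n) :
  S \in unitmx -> M *m S = S *m D -> char_poly M = char_poly D.
Proof.
move=> uS MS; pose S' := map_mx polyC S.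
have dS : \det S' != 0 by rewrite det_map_mx polyC_eq0 -unitfE -unitmxE.
have E : char_poly_mx M *m S' = S' *m char_poly_mx D.
  by rewrite mulmxBl mulmxBr -!map_mxM MS mul_scalar_mx mul_mx_scalar.
apply: (mulIf dS); rewrite /char_poly -det_mulmx E det_mulmx; exact: mulrC.
Qed.

Lemma char_poly_diag (F : comNzRingType) n (d : 'rV[F]_n) :
  char_poly (diag_mx d) = \prod_(i < n) ('X - (d 0 i)%:P).
Proof.
rewrite char_poly_trig ?diag_mx_is_trig//.
by apply: eq_bigr => i _; rewrite mxE eqxx mulr1n.
Qed.

Lemma mup_prod_XsubC (F : fieldType) (y : F) (s : seq F) :
  mup y (\prod_(x <- s) ('X - x%:P)) = count_mem y s.
Proof.
elim: s => [|x s IHs]; first by rewrite big_nil mupNroot// root1.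
rewrite big_cons mupM ?polyXsubC_eq0//; last exact: monic_neq0 (monic_prod_XsubC _ _ _).
by rewrite IHs/= -['X - _]expr1 mup_XsubCX eq_sym; case: eqP.
Qed.

Lemma perm_eigenvalues (R : rcfType) n (M : 'M[R]_n) (s : seq R) :
  char_poly M = \prod_(x <- s) ('X - x%:P) -> perm_eq (eigenvalues M) s.
Proof.
move=> pE; apply/allP => y _ /=; apply/eqP.
rewrite /eigenvalues; set p := char_poly M.
have p0 : p != 0 by rewrite monic_neq0// char_poly_monic.
have -> : count_mem y s = mup y p by rewrite /p pE mup_prod_XsubC.
have E (r : seq R) : uniq r ->
    count_mem y (flatten [seq nseq (mup x p) x | x <- r]) = ((y \in r) * mup y p)%N.
  elim: r => [|x r IHr]//= /andP[xr ur].
  rewrite count_cat count_nseq IHr// in_cons /=.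
  case: (eqVneq y x) => [->|yx] //=.
  by rewrite (negbTE xr) addn0 mul1n.
rewrite E; last exact: uniq_roots.
have := roots_on_rootsR p0 y; rewrite inE /= => <-.
by case: (boolP (root p y)) => [|/mupNroot ->]; rewrite ?mul1n.
Qed.

Lemma perm_remove_zeros (R : nzRingType) k (s t : seq R) :
  perm_eq s (t ++ nseq k 0) -> perm_eq (remove_zeros k s) t.
Proof.
elim: k s t => [|k IHk] s t; first by rewrite cats0.
move=> H; rewrite /remove_zeros iterSr; apply: IHk.
rewrite -(perm_cons 0); apply: (@perm_trans _ s).
  rewrite perm_sym; apply: perm_to_rem.
  by rewrite (perm_mem H) mem_cat /= inE eqxx orbT.
by apply: (perm_trans H); rewrite /= -cat_rcons -cats1 -catA perm_catCA.
Qed.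

End eigenvalue_lists.

(** * Eigenvectors of the Hankel circulant matrix and of the swirl *)

Section hankel_circulant_spectrum.
Context {R : realType}.
Implicit Types (N k l : nat) (b : nat -> R).

(** The shift by one matches the Hankel matrix, whose entry at (i, j) is [b u] with u + 1 = - (i +
    j) modulo N. *)
Definition fourier_cos N b k : R := \sum_(j < N) b j * cos (ang N (k * (j + 1))).
Definition fourier_sin N b k : R := \sum_(j < N) b j * sin (ang N (k * (j + 1))).

(** The Hartley kernel: unlike cosines or sines alone, it separates k from - k, so that k < N
    indexes a real orthogonal basis. *)
Definition cas N k (j : nat) : R := cos (ang N (k * j)) + sin (ang N (k * j)).

Lemma ang_opp N k j : (0 < N)%N -> (k <= N)%N ->
  cos (ang N ((N - k) * j)) = cos (ang N (k * j)) :> R /\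
  sin (ang N ((N - k) * j)) = - sin (ang N (k * j)) :> R.
Proof.
move=> N0 kN.
have E : ang N ((N - k) * j) = - ang N (k * j) + ang N (j * N) :> R.
  by rewrite -[X in _ = _ + ang N (_ * X)](subnK kN) mulnDr angD mulnC [(j * k)%N]mulnC; ring.
by rewrite E cos_ang_dvd// sin_ang_dvd// cosN sinN.
Qed.

Lemma cas_opp N k j : (0 < N)%N -> (k <= N)%N ->
  cas N (N - k) j = cos (ang N (k * j)) - sin (ang N (k * j)).
Proof. by move=> N0 kN; rewrite /cas; have [-> ->] := ang_opp j N0 kN. Qed.

Lemma sum_cas_cas N k l : (0 < N)%N ->
  \sum_(j < N) cas N k j * cas N l j = N%:R * (k == l %[mod N])%:R.
Proof.
move=> N0.
have cc := sum_cos_cos k l 0 N0; have ss := sum_sin_sin k l 0 N0.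
have sc := sum_sin_cos k l 0 N0; have cs := sum_sin_cos l k 0 N0.
transitivity (N%:R / 2 * ((k == l %[mod N])%:R + (N %| k + l)%N%:R) +
  N%:R / 2 * ((k == l %[mod N])%:R - (N %| k + l)%N%:R) + 0 + 0 : R).
  rewrite -cc -ss -[X in _ + X + _]sc -[X in _ + X]cs -!big_split.
  apply: eq_bigr => j _ /=; rewrite /cas !addn0; ring.
by case: (k == l %[mod N]); case: (N %| k + l)%N; rewrite /=; field.
Qed.

Lemma fourier_cos_opp N b k : (0 < N)%N -> (k <= N)%N ->
  fourier_cos N b (N - k) = fourier_cos N b k.
Proof. by move=> N0 kN; apply: eq_bigr => j _; rewrite (ang_opp _ N0 kN).1. Qed.

Lemma fourier_sin_opp N b k : (0 < N)%N -> (k <= N)%N ->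
  fourier_sin N b (N - k) = - fourier_sin N b k.
Proof.
move=> N0 kN; rewrite -sumrN; apply: eq_bigr => j _.
by rewrite (ang_opp _ N0 kN).2 mulrN.
Qed.

Definition hankel_mx N b : 'M[R]_N := circulant N b *m exchange_mx R N.

Lemma hankel_mxE N b (i j : 'I_N) :
  hankel_mx N b i j = b ((2 * N - 1 - j - i) %% N)%N.
Proof.
rewrite mxE (bigD1 (rev_ord j))//= !mxE /= big1 ?addr0 => [|l lj].
  have -> : ((N - j.+1 + j).+1 == N)%N by have := ltn_ord j; lia.
  by rewrite mulr1; congr (b (_ %% N)%N); have := ltn_ord j; lia.
rewrite !mxE; case: eqP => [E|_]; last by rewrite mulr0.
by case/eqP: lj; apply: val_inj => /=; lia.
Qed.

Lemma mod2N N w : (w < 2 * N)%N -> (w %% N = if w < N then w else w - N)%N.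
Proof.
move=> H; case: ltnP => wN; first by rewrite modn_small.
by rewrite -{1}(subnK wN) modnDr modn_small//; lia.
Qed.

Lemma dvdn_lt2 N w : (0 < w < 2 * N)%N -> (N %| w)%N = (w == N).
Proof.
move=> /andP[w0 w2]; apply/dvdnP/eqP => [[c E]|->]; last by exists 1%N; rewrite mul1n.
have : (c < 2)%N by rewrite -(@ltn_pmul2r N) -?E//; lia.
by case: c E => [|[|c]] E c2; lia.
Qed.

Lemma eqn_mod_oppr N k l : (k < N)%N -> (l < N)%N ->
  (k == N - l %[mod N])%N = (N %| k + l)%N.
Proof.
move=> kN lN; have [/eqP ->|l0] := boolP (l == 0)%N.
  by rewrite subn0 addn0 modnn.
rewrite !modn_small//; last by lia.
by rewrite dvdn_lt2; [apply/eqP/eqP => E; lia|lia].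
Qed.

Lemma eqn_mod_oppl N k l : (k < N)%N -> (l < N)%N ->
  (N - k == l %[mod N])%N = (N %| k + l)%N.
Proof. by move=> kN lN; rewrite eq_sym eqn_mod_oppr// addnC. Qed.

Lemma eqn_mod_subl N k l : (k < N)%N -> (l < N)%N ->
  (N - k == N - l %[mod N])%N = (k == l).
Proof.
move=> kN lN; apply/eqP/eqP => [|->//].
have [/eqP ->|k0] := boolP (k == 0)%N; have [/eqP ->|l0] := boolP (l == 0)%N => //.
- by rewrite subn0 modnn modn_small; lia.
- by rewrite subn0 modnn modn_small; lia.
- by rewrite !modn_small; lia.
Qed.

Lemma dvdn_double N k : (k < N)%N -> ~~ ((k == 0) || (2 * k == N))%N ->
  (N %| k + k)%N = false.
Proof.
move=> kN; rewrite negb_or => /andP[k0 /negbTE kk].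
by rewrite dvdn_lt2 ?addnn -?mul2n//; lia.
Qed.

Lemma dvdn_opposite N k l : (k < N)%N -> (l < N)%N -> k != l -> (N %| k + l)%N ->
  [/\ (N - l = k)%N, (N - k = l)%N, ((k == 0) || (2 * k == N))%N = false,
      ((l == 0) || (2 * l == N))%N = false & (2 * l < N)%N = ~~ (2 * k < N)%N].
Proof.
move=> kN lN kl; rewrite dvdn_lt2; last by lia.
by move=> /eqP klN; split; lia.
Qed.

(** The involution u -> - (u + 1 + i) modulo N turns the matrix entry into [b u] and the angle at k
    into minus the sum of the angles of k (u + 1) and k i. The addition formulas then separate u
    from i. *)
Lemma hankel_cas N b k (i : 'I_N) : (k <= N)%N ->
  \sum_(j < N) hankel_mx N b i j * cas N k j =
  fourier_cos N b k * cas N (N - k) i - fourier_sin N b k * cas N k i.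
Proof.
move=> kN; have iN := ltn_ord i; have N0 : (0 < N)%N by lia.
pose h (u : 'I_N) : 'I_N := Ordinal (ltn_pmod (2 * N - 1 - u - i) N0).
have hE (u : 'I_N) : nat_of_ord (h u) =
    (if 2 * N - 1 - u - i < N then 2 * N - 1 - u - i else N - 1 - u - i)%N.
  have uN := ltn_ord u; rewrite /= mod2N; last by lia.
  by case: ltnP => //; lia.
have hK : involutive h.
  move=> u; apply: val_inj; rewrite [LHS]hE; have uN := ltn_ord u; have := hE u.
  by move: (nat_of_ord (h u)) => w; case: ltnP => ? -> /=; case: ltnP => ?; lia.
rewrite (reindex_inj (inv_inj hK)) /= /fourier_cos /fourier_sin !mulr_suml -sumrB.
apply: eq_bigr => u _.
have -> : hankel_mx N b i (h u) = b u.
  by rewrite hankel_mxE -[in RHS](hK u).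
have [c hc] : exists c, (h u + (u + 1) + i = c * N)%N.
  exists (if 2 * N - 1 - u - i < N then 2 else 1)%N; rewrite hE.
  by have uN := ltn_ord u; case: ltnP => ?; lia.
have E : ang N (k * h u) = - (ang N (k * (u + 1)) + ang N (k * i)) + ang N ((k * c) * N) :> R.
  by rewrite -mulnA -hc !mulnDr !angD; ring.
rewrite cas_opp// /cas E cos_ang_dvd// sin_ang_dvd// cosN sinN cosD sinD; ring.
Qed.

(** Unit eigenvector of [[q, p], [p, -q]] for the eigenvalue [r], obtained by normalizing (q + r,
    p). That vector is zero only if p = 0 and q = - r, where the matrix is diag (- r, r) and (0, 1)
    serves. *)
Definition rotation (q p : R) : R * R :=
  let r := Num.sqrt (q ^+ 2 + p ^+ 2) in
  let t := Num.sqrt ((q + r) ^+ 2 + p ^+ 2) in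
  if t == 0 then (0, 1) else ((q + r) / t, p / t).

Lemma rotationP (q p : R) (r := Num.sqrt (q ^+ 2 + p ^+ 2)) :
  let c := (rotation q p).1 in let s := (rotation q p).2 in
  [/\ c ^+ 2 + s ^+ 2 = 1, c * q + s * p = r * c & c * p - s * q = r * s].
Proof.
rewrite /rotation -/r; set t := Num.sqrt _.
have r2 : r ^+ 2 = q ^+ 2 + p ^+ 2 by rewrite sqr_sqrtr// addr_ge0 ?sqr_ge0.
have t2 : t ^+ 2 = (q + r) ^+ 2 + p ^+ 2 by rewrite sqr_sqrtr// addr_ge0 ?sqr_ge0.
case: eqP => [t0|/eqP t0] /=.
  move: t2; rewrite t0 expr0n/= => /esym/eqP.
  rewrite paddr_eq0 ?sqr_ge0// !sqrf_eq0 => /andP[/eqP qr /eqP ->].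
  by split; [ring|ring|rewrite -(subr0 (0 * 0)); lra].
split.
- by rewrite !exprMn -mulrDl -t2 exprVn divff// expf_neq0.
- have -> : (q + r) / t * q + p / t * p = (q * r + (q ^+ 2 + p ^+ 2)) / t by field.
  by rewrite -r2; field.
- by field.
Qed.

Section eigenvectors.
Variables (N : nat) (b : nat -> R).
Hypothesis N0 : (0 < N)%N.

Let p k := fourier_cos N b k.
Let q k := - fourier_sin N b k.

Definition fourier_modulus k := Num.sqrt (fourier_cos N b k ^+ 2 + fourier_sin N b k ^+ 2).

(* In the basis of the vectors cas_k the Hankel matrix acts on the span of
   cas_k and cas_(N-k) by the symmetric matrix [[q, p], [p, -q]]; when k and
   N - k coincide modulo N, q vanishes and cas_k is an eigenvector. *)
Definition hankel_eigenvalue k : R :=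
  if ((k == 0) || (2 * k == N))%N then p k
  else if (2 * k < N)%N then fourier_modulus k else - fourier_modulus k.

(** Coordinates of the eigenvector on cas_k and cas_(N-k). Beyond N / 2 the plane of N - k is met
    again with its basis swapped. The pair (c, - s) is then the vector orthogonal to the one chosen
    at N - k, with the opposite eigenvalue. *)
Let cs k : R * R :=
  if ((k == 0) || (2 * k == N))%N then (1, 0)
  else if (2 * k < N)%N then rotation (q k) (p k)
  else let r := rotation (q (N - k)) (p (N - k)) in (r.1, - r.2).

Let V : 'M[R]_N := \matrix_(i, l) ((cs l).1 * cas N l i + (cs l).2 * cas N (N - l) i).

Let p_opp k : (k <= N)%N -> p (N - k) = p k. Proof. exact: fourier_cos_opp. Qed.
Let q_opp k : (k <= N)%N -> q (N - k) = - q k.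
Proof. by move=> kN; rewrite /q fourier_sin_opp. Qed.

Let q_self k : (k < N)%N -> ((k == 0) || (2 * k == N))%N -> q k = 0.
Proof.
move=> kN /orP[/eqP ->|/eqP kk].
  by rewrite /q /fourier_sin big1 ?oppr0// => j _; rewrite mul0n ang0 sin0 mulr0.
have := q_opp (ltnW kN); have -> : (N - k = k)%N by lia.
by move=> H; lra.
Qed.

Let cas_self k (j : nat) : (k < N)%N -> ((k == 0) || (2 * k == N))%N ->
  cas N (N - k) j = cas N k j.
Proof.
move=> kN /orP[/eqP ->|/eqP kk]; last by have -> : (N - k = k)%N by lia.
by rewrite cas_opp// /cas mul0n ang0 sin0 subr0 addr0.
Qed.

Let modulus_opp k : (k <= N)%N -> fourier_modulus (N - k) = fourier_modulus k.
Proof. by move=> kN; rewrite /fourier_modulus fourier_cos_opp// fourier_sin_opp// sqrrN. Qed.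

Let modulusE k : fourier_modulus k = Num.sqrt (q k ^+ 2 + p k ^+ 2).
Proof. by rewrite /fourier_modulus /q /p sqrrN addrC. Qed.

Let csP k : (k < N)%N -> ~~ ((k == 0) || (2 * k == N))%N ->
  [/\ (cs k).1 ^+ 2 + (cs k).2 ^+ 2 = 1,
   (cs k).1 * q k + (cs k).2 * p k = hankel_eigenvalue k * (cs k).1 &
   (cs k).1 * p k - (cs k).2 * q k = hankel_eigenvalue k * (cs k).2].
Proof.
move=> kN k0; rewrite /cs /hankel_eigenvalue (negbTE k0); case: ifPn => kk.
  by have := rotationP (q k) (p k); rewrite -modulusE.
have := rotationP (q (N - k)) (p (N - k)); rewrite -modulusE modulus_opp ?(ltnW kN)//=.
rewrite p_opp ?q_opp ?(ltnW kN)//; set r := rotation _ _ => -[h1 h2 h3].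
by split; [rewrite sqrrN| |]; lra.
Qed.

Let hankel_V : hankel_mx N b *m V = V *m diag_mx (\row_l hankel_eigenvalue l).
Proof.
apply/matrixP => i l; rewrite mul_mx_diag !mxE.
have lN := ltn_ord l.
transitivity ((cs l).1 * (\sum_(j < N) hankel_mx N b i j * cas N l j) +
              (cs l).2 * (\sum_(j < N) hankel_mx N b i j * cas N (N - l) j)).
  rewrite !mulr_sumr -big_split; apply: eq_bigr => j _ /=; rewrite [V _ _]mxE; ring.
rewrite !hankel_cas ?leq_subr// ?(ltnW lN)// subKn ?(ltnW lN)//.
rewrite -/(p l) -/(p (N - l)) -!mulNr -/(q l) -/(q (N - l)) p_opp ?q_opp ?(ltnW lN)//.
case: (boolP ((l == 0 :> nat) || (2 * l == N))%N) => l0.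
  rewrite cas_self// q_self//; rewrite /cs /hankel_eigenvalue l0 /=; ring.
have [_ h2 h3] := csP lN l0.
transitivity (((cs l).1 * q l + (cs l).2 * p l) * cas N l i +
   ((cs l).1 * p l - (cs l).2 * q l) * cas N (N - l) i); first by ring.
rewrite h2 h3; ring.
Qed.

Let V_orthogonal : V^T *m V = N%:R%:M.
Proof.
apply/matrixP => l m; rewrite !mxE.
have lN := ltn_ord l; have mN := ltn_ord m.
pose S (k k' : nat) : R := \sum_(j < N) cas N k j * cas N k' j.
transitivity ((cs l).1 * (cs m).1 * S l m + (cs l).1 * (cs m).2 * S l (N - m)%N +
   (cs l).2 * (cs m).1 * S (N - l)%N m + (cs l).2 * (cs m).2 * S (N - l)%N (N - m)%N).
  rewrite !mulr_sumr -!big_split; apply: eq_bigr => j _ /=; rewrite !mxE; ring.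
rewrite /S !sum_cas_cas//.
have E1 : (l == m %[mod N])%N = (l == m) by rewrite !modn_small.
have E4 : (N - l == N - m %[mod N])%N = (l == m) by rewrite eqn_mod_subl.
rewrite E1 eqn_mod_oppr// eqn_mod_oppl// E4.
have [<-|lm] := eqVneq l m.
  rewrite mulr1n; case: (boolP ((l == 0 :> nat) || (2 * l == N))%N) => l0.
    by rewrite /cs l0/=; ring.
  have [h1 _ _] := csP lN l0.
  rewrite (dvdn_double lN l0).
  transitivity (N%:R * ((cs l).1 ^+ 2 + (cs l).2 ^+ 2)); last by rewrite h1 mulr1.
  by rewrite /=; ring.
rewrite mulr0n !mulr0 add0r addr0.
case: (boolP (N %| l + m)%N) => [lmN|_]; last by rewrite !mulr0 addr0.
have [e1 e2 l0 m0 lt] := dvdn_opposite lN mN lm lmN.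
rewrite /cs l0 m0 lt e1 e2; case: ifP => _ /=; ring.
Qed.

Lemma exchange_mx_sym : (exchange_mx R N)^T = exchange_mx R N.
Proof. by apply/matrixP => i j; rewrite !mxE addnC. Qed.

Lemma exchange_mxK : exchange_mx R N *m exchange_mx R N = 1%:M.
Proof.
apply/matrixP => i j; rewrite !mxE (bigD1 (rev_ord i))//= big1 => [|l li].
  rewrite !mxE /= addr0; have := ltn_ord i; have := ltn_ord j => jN iN.
  have -> : ((i + (N - i.+1)).+1 == N)%N by lia.
  rewrite mul1r; have -> // : ((N - i.+1 + j).+1 == N)%N = (i == j).
  by apply/eqP/eqP => [E|->]; [apply: val_inj => /=; lia|lia].
rewrite !mxE; case: eqP => [E|_]; last by rewrite mul0r.
by case/eqP: li; apply: val_inj => /=; lia.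
Qed.

Let J := exchange_mx R N.
(** The swirl sends (v, w) to (A (J v + w), J A (J v + w)). Hence an eigenvector v of A J gives (v,
    J v) with twice its eigenvalue, while every (v, - J v) is killed. *)
Let S : 'M[R]_(N + N) := block_mx V V (J *m V) (- (J *m V)).
Let d2 : 'rV[R]_N := \row_l (2 * hankel_eigenvalue l).

Let swirl_S : swirl_circulant N b *m S = S *m diag_mx (row_mx d2 0).
Proof.
have D2 : hankel_mx N b *m V *+ 2 = V *m diag_mx d2.
  rewrite hankel_V; apply/matrixP => i l; rewrite mulmxnE !mul_mx_diag !mxE; ring.
have HV : circulant N b *m (J *m V) = hankel_mx N b *m V by rewrite mulmxA.
have JH : J *m circulant N b *m J *m V = J *m (hankel_mx N b *m V) by rewrite !mulmxA.
have HJ : J *m circulant N b *m (J *m V) = J *m (hankel_mx N b *m V) by rewrite !mulmxA.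
rewrite /swirl_circulant /swirl diag_mx_row linear0 !mulmx_block !mulmx0 !addr0.
rewrite !mulmxN JH HJ HV -/(hankel_mx N b) !subrr -!mulr2n -mulmxA -D2.
by rewrite -(raddfMn (mulmx J)).
Qed.

Let S_unit : S \in unitmx.
Proof.
have E : S^T *m S = (2 * N%:R)%:M.
  have JT : J^T = J := exchange_mx_sym.
  have JJ : J *m J = 1%:M := exchange_mxK.
  have trN : (- (J *m V))^T = - (V^T *m J).
    have -> : V^T *m J = (J *m V)^T by rewrite trmx_mul JT.
    by apply/matrixP => i j; rewrite !mxE.
  rewrite tr_block_mx mulmx_block trN !mulmxN !mulNmx !trmx_mul JT.
  have -> : V^T *m J *m (J *m V) = V^T *m V.
    by rewrite mulmxA -(mulmxA V^T) JJ mulmx1.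
  rewrite opprK subrr V_orthogonal -mulr2n -raddfMn -scalar_mx_block.
  by rewrite mulr_natl.
have : S^T *m S \in unitmx.
  by rewrite E unitmxE det_scalar unitfE expf_neq0// mulf_neq0// pnatr_eq0 -lt0n.
by rewrite unitmx_mul => /andP[].
Qed.

Lemma perm_nontrivial_eigenvalues :
  perm_eq (remove_zeros N (eigenvalues (swirl_circulant N b)))
          (map (fun l : 'I_N => 2 * hankel_eigenvalue l) (enum 'I_N)).
Proof.
apply/perm_remove_zeros/perm_eigenvalues.
rewrite (char_poly_similar S_unit swirl_S) char_poly_diag big_split_ord /= big_cat /= big_map.
congr (_ * _).
  by rewrite big_enum; apply: eq_bigr => l _; rewrite row_mxEl mxE.
rewrite (eq_bigr (fun=> 'X - 0%:P)) => [|l _]; last by rewrite row_mxEr mxE.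
by rewrite prodr_const card_ord big_nseq -Monoid.iteropE /=.
Qed.

Lemma sum_nontrivial_eigenvalue (f : R -> R) :
  \sum_(i < N) f (nontrivial_eigenvalue N b i) =
  \sum_(l < N) f (2 * hankel_eigenvalue l).
Proof.
have H := perm_nontrivial_eigenvalues.
have sz : size (remove_zeros N (eigenvalues (swirl_circulant N b))) = N.
  by rewrite (perm_size H) size_map size_enum_ord.
transitivity (\sum_(x <- remove_zeros N (eigenvalues (swirl_circulant N b))) f x).
  by rewrite (big_nth 0) sz big_mkord.
by rewrite (perm_big _ H) /= big_map big_enum.
Qed.

Lemma hankel_eigenvalue_opp k : (0 < k < N)%N -> (2 * k != N)%N ->
  hankel_eigenvalue (N - k) = - hankel_eigenvalue k.
Proof.
move=> /andP[k0 kN] kk; rewrite /hankel_eigenvalue modulus_opp ?(ltnW kN)//.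
have -> : ((k == 0) || (2 * k == N))%N = false by lia.
have -> : ((N - k == 0) || (2 * (N - k) == N))%N = false by lia.
have -> : (2 * (N - k) < N)%N = ~~ (2 * k < N)%N by lia.
by case: (2 * k < N)%N; rewrite /= ?opprK.
Qed.

Lemma hankel_eigenvalue_abs k : (0 < k < N)%N -> (2 * k != N)%N ->
  hankel_eigenvalue k = fourier_modulus k \/ hankel_eigenvalue k = - fourier_modulus k.
Proof.
move=> /andP[k0 kN] kk; rewrite /hankel_eigenvalue.
have -> : ((k == 0) || (2 * k == N))%N = false by lia.
by case: ifP; [left|right].
Qed.

(* The spectrum is symmetric, except that the at most two frequencies with
   k = - k modulo N contribute one eigenvalue each. *)
Lemma sum_eigenvalue_symmetrize (f : R -> R) (M : R) : (forall x, `|f x| <= M) ->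
  `|\sum_(k < N) f (hankel_eigenvalue k) -
    \sum_(k < N) (f (fourier_modulus k) + f (- fourier_modulus k)) / 2| <= 4 * M.
Proof.
move=> fM; pose e k : R := f (hankel_eigenvalue k).
have M0 : 0 <= M by apply: le_trans (fM 0).
pose oppk (k : 'I_N) : 'I_N := Ordinal (ltn_pmod (N - k) N0).
have oppkE (k : 'I_N) : oppk k = (if k == 0 :> nat then 0 else N - k)%N :> nat.
  rewrite /=; case: eqP => [->|k0]; first by rewrite subn0 modnn.
  by rewrite modn_small//; have := ltn_ord k; lia.
have oppkK : involutive oppk.
  move=> k; apply: val_inj; rewrite [LHS]oppkE; have kN := ltn_ord k.
  move: (oppkE k); move: (nat_of_ord (oppk k)) => w.
  by case: eqP => k0 -> /=; [rewrite k0|case: eqP => ?; lia].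
(* Averaging the sum with its image under k -> - k matches each eigenvalue with its opposite. Only k
   = 0 and k = N / 2 escape, each costing at most 2 M. *)
have -> : \sum_(k < N) f (hankel_eigenvalue k) = \sum_(k < N) (e k + e (oppk k)) / 2.
  have reE : \sum_(k < N) e (oppk k) = \sum_(k < N) e k.
    by rewrite [RHS](reindex_inj (inv_inj oppkK)).
  by rewrite -mulr_suml big_split /= reE -mulr2n -[X in X / 2]mulr_natr mulfK.
rewrite -sumrB.
have le2 (k : 'I_N) : `|(e k + e (oppk k)) / 2 -
    (f (fourier_modulus k) + f (- fourier_modulus k)) / 2| <=
    (if (k == 0 :> nat) || (2 * k == N)%N then 2 * M else 0).
  case: ifPn => [_|]; last first.
    rewrite negb_or => /andP[k0 kk]; rewrite /e oppkE (negbTE k0).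
    have kN : (0 < k < N)%N by rewrite lt0n k0 ltn_ord.
    rewrite hankel_eigenvalue_opp//.
    by case: (hankel_eigenvalue_abs kN kk) => ->; rewrite ?opprK [X in _ - X / 2]addrC ?subrr ?normr0//
       addrC subrr normr0.
  rewrite -mulrBl normrM (@ger0_norm _ 2^-1)// ler_pdivrMr//.
  apply: le_trans (ler_normB _ _) _.
  rewrite (le_trans (lerD (ler_normD _ _) (ler_normD _ _)))//.
  have := fM (hankel_eigenvalue k); have := fM (hankel_eigenvalue (oppk k)).
  have := fM (fourier_modulus k); have := fM (- fourier_modulus k).
  by rewrite /e; lra.
apply: le_trans (ler_norm_sum _ _ _) _.
apply: (@le_trans _ _ (\sum_(k < N)
  if (k == 0 :> nat) || (2 * k == N)%N then 2 * M else 0)).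
  by apply: ler_sum => k _; exact: le2.
rewrite -big_mkcond /= sumr_const -[leLHS]mulr_natr.
have -> : 4 * M = 2 * M * 2 by ring.
rewrite ler_wpM2l ?mulr_ge0// ler_nat.
have h2 : (N./2 < N)%N by rewrite ltn_half_double -addnn; lia.
apply: (@leq_trans #|[set Ordinal N0; Ordinal h2]%SET|); last first.
  by rewrite cards2; case: (_ != _).
apply: subset_leq_card; apply/fintype.subsetP => k; rewrite !inE -!val_eqE /=.
case/orP => [->//|/eqP E].
have -> : N./2 = k :> nat by rewrite -[in LHS]E mul2n doubleK.
by rewrite eqxx orbT.
Qed.

End eigenvectors.

Lemma integral_empirical_spectral_measure N b (f : R -> R) : measurable_fun setT f ->
  (\int[empirical_spectral_measure N b]_x (f x)%:E =
   (N%:R^-1 * \sum_(i < N) f (nontrivial_eigenvalue N b i / (2 * Num.sqrt N%:R)))%:E)%E.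
Proof.
move=> mf; pose x i := nontrivial_eigenvalue N b i / (2 * Num.sqrt N%:R).
have ge0E (g : R -> R) : measurable_fun setT g -> (forall y, 0 <= g y) ->
    (\int[empirical_spectral_measure N b]_x (g x)%:E =
     (N%:R^-1 * \sum_(i < N) g (x i))%:E)%E.
  move=> mg g0; have mg' : measurable_fun setT (EFin \o g) by exact/measurable_EFinP.
  rewrite ge0_integral_mscale//; last by move=> y _; rewrite lee_fin.
  rewrite ge0_integral_measure_sum//; last by move=> y _; rewrite lee_fin.
  rewrite EFinM -sumEFin; congr (_ * _)%E; apply: eq_bigr => i _.
  by rewrite integral_dirac// diracT mul1e.
rewrite integralE.
under eq_integral do rewrite funeposE -EFin_max.
under [X in (_ - X)%E]eq_integral do rewrite funenegE -EFinN -EFin_max.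
rewrite !ge0E.
- rewrite -EFinB; congr EFin; rewrite -mulrBr -sumrB; congr (_ * _).
  by apply: eq_bigr => i _; rewrite /Num.max; case: ifP; case: ifP; lra.
- by apply: measurable_maxr => //; exact: measurableT_comp.
- by move=> y; rewrite le_max lexx orbT.
- by apply: measurable_maxr.
- by move=> y; rewrite le_max lexx orbT.
Qed.

End hankel_circulant_spectrum.

(** * Products of independent random variables *)

Section independence.
Context d (T : measurableType d) (R : realType) (P : probability T R).

Section one_coordinate.
Import HBNNSimple.

Let integralM_nnsfun (W : T -> R) (X : {RV P >-> R})
    (h : {nnsfun R >-> R}) :
  measurable_fun setT W -> (forall w, 0 <= W w) ->
  (\int[P]_w (W w * h (X w))%:E = \sum_(r \in range h)
     (r%:E * \int[P]_w (W w * \1_(h @^-1` [set r]) (X w))%:E))%E.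
Proof.
move=> mW W0.
have mI r : measurable_fun setT (fun w => \1_(h @^-1` [set r]) (X w) : R).
  apply: (@measurableT_comp _ _ _ _ R _ (\1_(h @^-1` [set r]) : R -> R) setT X).
    exact: measurable_indic.
  exact: measurable_funP.
have mWI r : measurable_fun setT (fun w => (W w * \1_(h @^-1` [set r]) (X w))%:E).
  by apply/measurable_EFinP; apply: measurable_funM.
have WI0 r w : (0 <= (W w * \1_(h @^-1` [set r]) (X w))%:E)%E.
  by rewrite lee_fin mulr_ge0.
have rWI0 r w : (0 <= r%:E * (W w * \1_(h @^-1` [set r]) (X w))%:E)%E.
  by rewrite -EFinM mulrCA lee_fin mulr_ge0// -lee_fin EFinM nnfun_muleindic_ge0.
transitivity (\int[P]_w \sum_(r \in range h) (r%:E * (W w * \1_(h @^-1` [set r]) (X w))%:E))%E.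
  apply: eq_integral => w _; rewrite fimfunE.
  under [RHS]eq_fsbigr do rewrite -EFinM mulrCA EFinM.
  rewrite EFinM -fsumEFin// ge0_mule_fsumr// => r.
  by rewrite EFinM nnfun_muleindic_ge0.
rewrite ge0_integral_fsum//; last first.
  by move=> r; apply: measurable_funeM.
apply: eq_fsbigr => r /set_mem[y _ <-]; rewrite ge0_integralZl//.
by rewrite lee_fin.
Qed.

Lemma ge0_integralM_indep (Z : T -> R) (X : {RV P >-> R}) (c : R) :
  measurable_fun setT Z -> (forall w, 0 <= Z w) -> 0 <= c ->
  (forall B : set R, measurable B ->
    (\int[P]_w (Z w * \1_B (X w))%:E = c%:E * P (X @^-1` B))%E) ->
  forall g : R -> R, measurable_fun setT g -> (forall x, 0 <= g x) ->
  (\int[P]_w (Z w * g (X w))%:E = c%:E * \int[P]_w (g (X w))%:E)%E.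
Proof.
move=> mZ Z0 c0 ZB g mg g0.
have mgE : measurable_fun setT (EFin \o g) by exact/measurable_EFinP.
pose h := nnsfun_approx measurableT mgE.
have mh n : measurable_fun setT (fun w => h n (X w)).
  by apply: (measurableT_comp (f := h n)).
have nnsfunM n : (\int[P]_w (Z w * h n (X w))%:E = c%:E * \int[P]_w (h n (X w))%:E)%E.
  rewrite integralM_nnsfun//.
  have -> : (\int[P]_w (h n (X w))%:E = \int[P]_w (cst 1 w * h n (X w))%:E)%E.
    by apply: eq_integral => w _; rewrite mul1r.
  rewrite (@integralM_nnsfun (cst 1))// ge0_mule_fsumr; last first.
    move=> r; have [[y _ <-]|nr] := pselect (range (h n) r).
      by rewrite mule_ge0 ?lee_fin// integral_ge0// => w _; rewrite lee_fin mulr_ge0.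
    rewrite integral0_eq ?mule0// => w _; rewrite indicE memNset ?mulr0//.
    by move=> /= hr; apply: nr; exists (X w).
  apply: eq_fsbigr => r _; rewrite ZB// muleCA; congr (_ * (_ * _))%E.
  have mXB : measurable (X @^-1` (h n @^-1` [set r])) by exact: measurable_funPTI.
  have := integral_indic P measurableT mXB; rewrite setIT => <-.
  by apply: eq_integral => w _; rewrite mul1r.
transitivity (limn (fun n => \int[P]_w (Z w * h n (X w))%:E))%E.
  rewrite -monotone_convergence//=.
  - apply: eq_integral => w _; apply/esym/cvg_lim => //=.
    rewrite EFinM; under eq_fun do rewrite EFinM.
    by apply: cvgeZl => //; by apply: (cvg_nnsfun_approx measurableT mgE) => // y _; rewrite lee_fin g0.
  - by move=> n; apply/measurable_EFinP; apply: measurable_funM.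
  - by move=> n w _; rewrite lee_fin mulr_ge0.
  - move=> w _ a b ab; rewrite lee_fin ler_wpM2l//.
    exact/lefP/nd_nnsfun_approx.
rewrite (_ : \int[P]_w (g (X w))%:E = limn (fun n => \int[P]_w (h n (X w))%:E))%E; last first.
  rewrite -monotone_convergence//=.
  - apply: eq_integral => w _; apply/esym/cvg_lim => //=.
    by apply: (cvg_nnsfun_approx measurableT mgE) => // y _; rewrite lee_fin g0.
  - by move=> n; apply/measurable_EFinP.
  - by move=> n w _; rewrite lee_fin.
  - by move=> w _ a b ab; rewrite lee_fin; exact/lefP/nd_nnsfun_approx.
under eq_fun do rewrite nnsfunM.
rewrite limeMl//; apply/ereal_nondecreasing_is_cvgn => a b ab; apply: ge0_le_integral => //.
- by move=> w _; rewrite lee_fin.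
- exact/measurable_EFinP.
- exact/measurable_EFinP.
- by move=> w _; rewrite lee_fin; exact/lefP/nd_nnsfun_approx.
Qed.

End one_coordinate.

Section product_of_coordinates.
Variable X : nat -> {RV P >-> R}.
Hypothesis X_indep : mutually_independent X.

Let mean (i : nat) (g : R -> R) : R := \int[P]_w g (X i w).

Let mgX (i : nat) (g : R -> R) : measurable_fun setT g -> measurable_fun setT (fun w => g (X i w)).
Proof. by move=> mg; apply: (measurableT_comp mg); exact: measurable_funP. Qed.

Let upd (h : nat -> R -> R) (k : nat) (g : R -> R) (i : nat) : R -> R :=
  if i == k then g else h i.

Let upd_id h k : upd h k (h k) = h.
Proof. by apply/funext => i; rewrite /upd; case: eqP => [->|]. Qed.

Let prod_upd h k g n (F : nat -> (R -> R) -> R) : (k < n)%N ->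
  \prod_(i < n) F i (upd h k g i) =
  (\prod_(i < n | i != k :> nat) F i (h i)) * F k g.
Proof.
move=> kn; rewrite (bigD1 (Ordinal kn))//= {1}/upd eqxx mulrC; congr (_ * _).
by apply: eq_big => i //; rewrite -val_eqE /upd => /= /negbTE ->.
Qed.

Let meas_prod (h : nat -> R -> R) n (Q : pred nat) : (forall i, measurable_fun setT (h i)) ->
  measurable_fun setT (fun w => \prod_(i < n | Q i) h i (X i w)).
Proof.
move=> mh; rewrite (_ : (fun w => _) = (fun w => \prod_(i < n) (if Q i then h i (X i w) else 1))).
  apply: measurable_prod => i _; case: (Q i) => //.
  exact: mgX.
by apply/funext => w; rewrite big_mkcond.
Qed.

Let integrable_indicX (i : nat) (B : set R) : measurable B ->
  P.-integrable setT (fun w => (\1_B (X i w))%:E).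
Proof.
move=> mB; have mXB : measurable (X i @^-1` B) by exact: measurable_funPTI.
exact: (integrable_indic P mXB).
Qed.

Let mean_indic i B : measurable B -> (mean i (\1_B))%:E = P (X i @^-1` B).
Proof.
move=> mB; rewrite /mean fineK; last exact/integrable_fin_num/integrable_indicX.
have mXB : measurable (X i @^-1` B) by exact: measurable_funPTI.
by have := integral_indic P measurableT mXB; rewrite setIT => <-.
Qed.

Let mean_ge0 i g : (forall x, 0 <= g x) -> 0 <= mean i g.
Proof. by move=> g0; apply: Rintegral_ge0 => w _. Qed.

Let prod_indic n (B : nat -> set R) : (forall i, measurable (B i)) ->
  (\int[P]_w (\prod_(i < n) \1_(B i) (X i w))%:E =
   (\prod_(i < n) mean i (\1_(B i)))%:E)%E.
Proof.
move=> mB; have := X_indep (iota_uniq 0 n) mB.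
have -> : (\prod_(i <- iota 0 n) P (X i @^-1` B i) = \prod_(i < n) P (X i @^-1` B i))%E.
  by rewrite -[in LHS](subn0 n) -/(index_iota 0 n) big_mkord.
under [X in _ = X -> _]eq_bigr do rewrite -mean_indic//.
rewrite prodEFin => <-.
set C := \bigcap_(i in _) _.
have mC : measurable C.
  by apply: bigcap_measurableType => i _; exact: measurable_funPTI.
have := integral_indic P measurableT mC; rewrite setIT => <-.
apply: eq_integral => w _; congr EFin; rewrite indicE.
have [/set_mem Cw|/negP Cw] := boolP (w \in C).
  rewrite big1// => i _; rewrite indicE mem_set//.
  by apply: Cw => /=; rewrite mem_iota/= ltn_ord.
have [i Bi] : exists i : 'I_n, ~ B i (X i w).
  apply: contrapT => nB; apply: Cw; apply/mem_set => j /=; rewrite mem_iota/= => jn.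
  by apply: contrapT => nBj; apply: nB; exists (Ordinal jn).
by rewrite (bigD1 i)//= indicE memNset// mul0r.
Qed.

Let factors n (h : nat -> R -> R) := (\int[P]_w (\prod_(i < n) h i (X i w))%:E =
  (\prod_(i < n) mean i (h i))%:E)%E.

Let integrable_coord (h : nat -> R -> R) := forall i : nat, P.-integrable setT (fun w => (h i (X i w) : R)%:E).

(** Induction on the number [k] of leading coordinates that carry arbitrary nonnegative functions,
    the others being indicators. The last arbitrary one is tested against indicators, which lowers
    [k], and is then restored by monotone approximation. *)
Let ge0_factors n k (h : nat -> R -> R) : (k <= n)%N ->
  (forall i, measurable_fun setT (h i)) -> (forall i x, 0 <= h i x) -> integrable_coord h ->
  (forall i, (k <= i)%N -> exists2 B, measurable B & h i = \1_B) -> factors n h.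
Proof.
move=> + mh h0 ih; elim: k h mh h0 ih => [|k IHk] h mh h0 ih kn hB.
  have /choice[B HB] : forall i, exists B, measurable B /\ h i = \1_B.
    by move=> i; have [//|B mB hi] := hB i; exists B.
  rewrite (_ : h = fun i => \1_(B i)); last by apply/funext => i; exact: (HB i).2.
  by apply: prod_indic => i; exact: (HB i).1.
rewrite /factors -{1 2}(upd_id h k).
under eq_integral do rewrite (prod_upd h (h k) (fun i g => g (X i _)) kn).
rewrite (prod_upd h (h k) mean kn).
have Z0 w : 0 <= \prod_(i < n | i != k :> nat) h i (X i w) by apply: prodr_ge0.
rewrite (@ge0_integralM_indep (fun w => \prod_(i < n | i != k :> nat) h i (X i w)) (X k)
  (\prod_(i < n | i != k :> nat) mean i (h i))) //.
- rewrite EFinM /mean fineK//; exact: integrable_fin_num.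
- by apply: (meas_prod n (fun i => i != k)).
- by apply: prodr_ge0 => i _; exact: mean_ge0.
move=> B mB; rewrite -mean_indic// -EFinM -(prod_upd h (\1_B) mean kn).
under eq_integral do rewrite -(prod_upd h (\1_B) (fun i g => g (X i _)) kn).
apply: IHk => //.
- by move=> i; rewrite /upd; case: eqP => // _; exact: measurable_indic.
- by move=> i x; rewrite /upd; case: eqP.
- by move=> i; rewrite /upd; case: eqP => // _; exact: integrable_indicX.
- exact: ltnW.
- move=> i; rewrite /upd leq_eqVlt eq_sym; case: eqP => [_ _|_ /=]; first by exists B.
  exact: hB.
Qed.

Let factors_ext n (h h' : nat -> R -> R) : (forall i, (i < n)%N -> h i = h' i) -> factors n h -> factors n h'.
Proof.
rewrite /factors => hh'.
rewrite (eq_bigr (fun i : 'I_n => mean i (h' i))) => [|i _]; last by rewrite hh'.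
move=> <-; apply: eq_integral => w _; congr EFin.
by apply: eq_bigr => i _; rewrite hh'.
Qed.

Let ge0_factorsT n (h : nat -> R -> R) :
  (forall i, measurable_fun setT (h i)) -> (forall i x, 0 <= h i x) -> integrable_coord h ->
  factors n h.
Proof.
move=> mh h0 ih.
(* Beyond [n] the functions do not enter the product, so they may be replaced by the indicator of
   the whole line. *)
apply: (@factors_ext n (fun i => if (i < n)%N then h i else \1_setT)).
  by move=> i ->.
apply: (@ge0_factors n n) => //.
- by move=> i; case: ifP => _ //; exact: measurable_indic.
- by move=> i x; case: ifP.
- by move=> i; case: ifP => // _; exact: integrable_indicX.
- by move=> i; rewrite leqNgt => /negbTE ->; exists setT.
Qed.

Let integrable_prod n (h : nat -> R -> R) :
  (forall i, measurable_fun setT (h i)) -> integrable_coord h ->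
  P.-integrable setT (fun w => (\prod_(i < n) h i (X i w))%:E).
Proof.
move=> mh ih; pose g i x := `|h i x|.
have mg i : measurable_fun setT (g i) by exact: measurableT_comp.
have ig : integrable_coord g.
  by move=> i; have := integrable_abse (ih i).
apply/integrableP; split.
  by apply/measurable_EFinP; exact: (@meas_prod h n xpredT).
have -> : (\int[P]_w `|(\prod_(i < n) h i (X i w))%:E| =
    \int[P]_w (\prod_(i < n) g i (X i w))%:E)%E.
  by apply: eq_integral => w _ /=; rewrite normr_prod.
by rewrite (ge0_factorsT n mg) ?ltry// => i x; rewrite /g.
Qed.

(** Here [k] counts the leading coordinates that may change sign. Both sides are linear in the last
    of them, which is split into positive and negative parts. *)
Let factors_integrable n k (h : nat -> R -> R) : (k <= n)%N ->
  (forall i, measurable_fun setT (h i)) -> integrable_coord h ->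
  (forall i, (k <= i)%N -> forall x, 0 <= h i x) -> factors n h.
Proof.
move=> + mh ih; elim: k h mh ih => [|k IHk] h mh ih kn h0.
  by apply: ge0_factorsT => // i; exact: h0.
pose hp x := Num.max (h k x) 0; pose hn x := Num.max (- h k x) 0.
have hE : h k = hp \- hn.
  by apply/funext => x; rewrite /hp /hn /Num.max /=; case: ifP; case: ifP; lra.
have ip : P.-integrable setT (fun w => (hp (X k w))%:E).
  have := integrable_funepos measurableT (ih k).
  by apply: eq_integrable => // w _; rewrite funeposE /= -EFin_max.
have in_ : P.-integrable setT (fun w => (hn (X k w))%:E).
  have := integrable_funeneg measurableT (ih k).
  by apply: eq_integrable => // w _; rewrite funenegE /= -EFin_max.
have mp : measurable_fun setT hp by apply: measurable_maxr.
have mn : measurable_fun setT hn by apply: measurable_maxr => //; exact: measurableT_comp.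
have FP g : measurable_fun setT g -> P.-integrable setT (fun w => (g (X k w))%:E) ->
    (forall x, 0 <= g x) -> factors n (upd h k g) /\
    P.-integrable setT (fun w => (\prod_(i < n) upd h k g i (X i w))%:E).
  move=> mg ig g0; have mu i : measurable_fun setT (upd h k g i).
    by rewrite /upd; case: eqP.
  have iu : integrable_coord (upd h k g) by move=> i; rewrite /upd; case: eqP => // ->.
  split; last exact: integrable_prod.
  apply: IHk => //; first exact: ltnW.
  move=> i; rewrite /upd leq_eqVlt eq_sym; case: eqP => // _ /=; exact: h0.
have [fp jp] : factors n (upd h k hp) /\
    P.-integrable setT (fun w => (\prod_(i < n) upd h k hp i (X i w))%:E).
  by apply: FP => // x; rewrite /hp le_max lexx orbT.
have [fn jn] : factors n (upd h k hn) /\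
    P.-integrable setT (fun w => (\prod_(i < n) upd h k hn i (X i w))%:E).
  by apply: FP => // x; rewrite /hn le_max lexx orbT.
rewrite /factors -{1 2}(upd_id h k) (prod_upd h (h k) mean kn).
have -> : mean k (h k) = mean k hp - mean k hn by rewrite hE /mean -RintegralB.
rewrite mulrBr EFinB -!(prod_upd h _ mean kn) -fp -fn -integralB//.
apply: eq_integral => w _; rewrite -EFinB; congr EFin.
rewrite !(prod_upd h _ (fun i g => g (X i w)) kn) hE /=; ring.
Qed.

Lemma integral_prod_indep n (h : nat -> R -> R) :
  (forall i, measurable_fun setT (h i)) ->
  (forall i, P.-integrable setT (fun w => (h i (X i w))%:E)) ->
  P.-integrable setT (fun w => (\prod_(i < n) h i (X i w))%:E) /\
  \int[P]_w (\prod_(i < n) h i (X i w)) = \prod_(i < n) \int[P]_w (h i (X i w)).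
Proof.
move=> mh ih; split; first exact: integrable_prod.
rewrite /Rintegral (@factors_ext n (fun i => if (i < n)%N then h i else \1_setT) h)//.
  by move=> i ->.
apply: (@factors_integrable n n) => //.
- by move=> i; case: ifP => _ //; exact: measurable_indic.
- by move=> i; case: ifP => // _; exact: integrable_indicX.
- by move=> i; rewrite leqNgt => /negbTE -> x.
Qed.

End product_of_coordinates.
End independence.

(** * Fourth moments of multilinear polynomials *)

Section Rintegral_sum.
Context d (T : measurableType d) (R : realType) (mu : {measure set T -> \bar R}).

Lemma integrable_sum_seq (I : Type) (s : seq I) (F : I -> T -> R) :
  (forall i, mu.-integrable setT (EFin \o F i)) ->
  mu.-integrable setT (EFin \o (fun w => \sum_(i <- s) F i w)).
Proof.
move=> iF; rewrite (_ : _ \o _ = (fun w => \sum_(i <- s) (EFin \o F i) w)%E); last first.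
  by apply/funext => w /=; rewrite -sumEFin.
exact: integrable_sum.
Qed.

Lemma Rintegral_sum_seq (I : Type) (s : seq I) (F : I -> T -> R) :
  (forall i, mu.-integrable setT (EFin \o F i)) ->
  \int[mu]_w (\sum_(i <- s) F i w) = \sum_(i <- s) \int[mu]_w (F i w).
Proof.
move=> iF; elim: s => [|i s IHs].
  rewrite big_nil; under eq_Rintegral do rewrite big_nil.
  by rewrite /Rintegral integral0.
rewrite big_cons -IHs -RintegralD//; first by apply: eq_Rintegral => w _; rewrite big_cons.
exact: integrable_sum_seq.
Qed.

End Rintegral_sum.

Section hypercontractivity.
Context d (T : measurableType d) (R : realType) (P : probability T R).
Variable Y : nat -> T -> R.

Definition monomial n (e : nat -> nat) (w : T) : R := \prod_(i < n) Y i w ^+ e i.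

(** A class closed under sums and products in which integrability and the splitting off of [Y n]
    reduce to the statement for monomials. [Y] will be the sequence of the [b i] and also that of
    the centred squares [b i ^+ 2 - 1]. *)
Definition polynomial_in n (F : T -> R) : Prop :=
  exists s : seq (R * (nat -> nat)),
    F = fun w => \sum_(p <- s) p.1 * monomial n p.2 w.

Lemma polynomial_in_cst n c : polynomial_in n (cst c).
Proof.
exists [:: (c, fun=> 0%N)]; apply/funext => w.
by rewrite big_seq1 /monomial /= big1 ?mulr1.
Qed.

Lemma polynomial_inD n F G :
  polynomial_in n F -> polynomial_in n G -> polynomial_in n (fun w => F w + G w).
Proof.
move=> [s ->] [t ->]; exists (s ++ t); apply/funext => w.
by rewrite big_cat.
Qed.

Lemma polynomial_inM n F G :
  polynomial_in n F -> polynomial_in n G -> polynomial_in n (fun w => F w * G w).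
Proof.
move=> [s ->] [t ->].
exists [seq (p.1 * q.1, fun i => (p.2 i + q.2 i)%N) | p <- s, q <- t].
apply/funext => w; rewrite big_allpairs_dep mulr_suml; apply: eq_bigr => p _.
rewrite mulr_sumr; apply: eq_bigr => q _ /=.
rewrite mulrACA; congr (_ * _); rewrite /monomial -big_split.
by apply: eq_bigr => i _; rewrite exprD.
Qed.

Lemma polynomial_inX n F k : polynomial_in n F -> polynomial_in n (fun w => F w ^+ k).
Proof.
move=> pF; elim: k => [|k IHk]; first exact: polynomial_in_cst.
rewrite (_ : (fun w => _) = (fun w => F w * F w ^+ k)); last first.
  by apply/funext => w; rewrite exprS.
exact: polynomial_inM.
Qed.

Lemma polynomial_inW n F : polynomial_in n F -> polynomial_in n.+1 F.
Proof.
move=> [s ->]; exists [seq (p.1, fun i => if (i < n)%N then p.2 i else 0%N) | p <- s].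
apply/funext => w; rewrite big_map; apply: eq_bigr => p _ /=; congr (_ * _).
rewrite /monomial big_ord_recr/= ltnn expr0 mulr1.
by apply: eq_bigr => i _; rewrite ltn_ord.
Qed.

Lemma polynomial_in_coord n : polynomial_in n.+1 (Y n).
Proof.
exists [:: (1, fun i => (i == n) : nat)]; apply/funext => w.
rewrite big_seq1 mul1r /monomial big_ord_recr/= eqxx expr1 big1 ?mul1r// => i _.
by rewrite ltn_eqF.
Qed.

Hypothesis Y_indep : forall n (e : nat -> nat),
  P.-integrable setT (EFin \o monomial n e) /\
  \int[P]_w monomial n e w = \prod_(i < n) \int[P]_w (Y i w ^+ e i).

Lemma integrable_polynomial_in n F : polynomial_in n F -> P.-integrable setT (EFin \o F).
Proof.
move=> [s ->]; rewrite (_ : _ \o _ =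
    (fun w => \sum_(p <- s) (p.1%:E * (EFin \o monomial n p.2) w)%E)); last first.
  by apply/funext => w /=; rewrite -sumEFin.
apply: integrable_sum => // p _.
by apply: integrableZl => //; exact: (Y_indep n p.2).1.
Qed.

Lemma Rintegral_polynomial_inM n F k : polynomial_in n F ->
  \int[P]_w (F w * Y n w ^+ k) = \int[P]_w (F w) * \int[P]_w (Y n w ^+ k).
Proof.
move=> [s ->].
have iM p : P.-integrable setT (EFin \o (fun w => p.1 * monomial n p.2 w)).
  apply: (integrable_polynomial_in (n := n)); exists [:: p].
  by apply/funext => w; rewrite big_seq1.
have E p w : p.1 * monomial n p.2 w * Y n w ^+ k =
    p.1 * monomial n.+1 (fun i => if (i < n)%N then p.2 i else k) w.
  rewrite -mulrA; congr (_ * _); rewrite /monomial big_ord_recr/= ltnn; congr (_ * _).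
  by apply: eq_bigr => i _; rewrite ltn_ord.
have iMk p : P.-integrable setT (EFin \o (fun w => p.1 * monomial n p.2 w * Y n w ^+ k)).
  apply: (integrable_polynomial_in (n := n.+1)).
  exists [:: (p.1, fun i => if (i < n)%N then p.2 i else k)].
  by apply/funext => w; rewrite big_seq1 E.
under eq_Rintegral do rewrite mulr_suml.
rewrite !Rintegral_sum_seq// mulr_suml; apply: eq_bigr => p _.
under eq_Rintegral do rewrite E.
rewrite RintegralZl//; last exact: (Y_indep _ _).1.
rewrite RintegralZl//; last exact: (Y_indep _ _).1.
rewrite !(Y_indep _ _).2 -mulrA big_ord_recr/= ltnn; congr (_ * (_ * _)).
by apply: eq_bigr => i _; rewrite ltn_ord.
Qed.

(** Turns AM-GM bounds with a free weight [t] into Cauchy-Schwarz. The optimal weight is b / a; when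
    [a] or [b] vanishes, large or small weights bring the bound below any positive e. *)
Lemma le_mul_of_amgm (x a b : R) : 0 <= a -> 0 <= b ->
  (forall t, 0 < t -> x <= (t * a ^+ 2 + b ^+ 2 / t) / 2) -> x <= a * b.
Proof.
move=> a0 b0 H.
case: (ltrgt0P a) a0 => // [ap _|a_0 _]; last first.
  rewrite a_0 mul0r.
  apply/ler_addgt0Pl => e e0; rewrite addr0.
  have t0 : 0 < (b ^+ 2 + 1) / e by rewrite divr_gt0// ltr_wpDl ?sqr_ge0.
  apply: le_trans (H _ t0) _; rewrite a_0 expr0n/= mulr0 add0r invf_div.
  rewrite ler_pdivrMr// mulrA ler_pdivrMr ?ltr_wpDl ?sqr_ge0//.
  have := sqr_ge0 b; nra.
case: (ltrgt0P b) b0 => // [bp _|b_0 _]; last first.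
  rewrite b_0 mulr0; apply/ler_addgt0Pl => e e0; rewrite addr0.
  have t0 : 0 < e / a ^+ 2 by rewrite divr_gt0// exprn_gt0.
  apply: le_trans (H _ t0) _; rewrite b_0 expr0n/= mul0r addr0 divfK ?expf_neq0 ?gt_eqF//.
  lra.
have t0 : 0 < b / a by rewrite divr_gt0.
apply: le_trans (H _ t0) _.
have -> : (b / a * a ^+ 2 + b ^+ 2 / (b / a)) / 2 = a * b by field; rewrite !gt_eqF.
by [].
Qed.

Variable C : R.
Hypothesis Y_mean : forall i, \int[P]_w (Y i w) = 0.
Hypothesis Y_moments : forall i,
  3 * \int[P]_w (Y i w ^+ 2) + `|\int[P]_w (Y i w ^+ 3)| <= C /\
  \int[P]_w (Y i w ^+ 4) + 2 * `|\int[P]_w (Y i w ^+ 3)| <= C ^+ 2.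

Let iP n F := @integrable_polynomial_in n F.

(** In the expansion of (U + Y V)^4 the term linear in Y has mean zero. The square term gives 6 m2 A
    B, and the cubic one is absorbed into 2 |m3| (A B + B^2). The total is at most A^2 + 2 C A B +
    C^2 B^2 exactly under the two conditions relating C to the moments. *)
Lemma fourth_moment_step n U V (A B : R) : 0 <= A -> 0 <= B ->
  polynomial_in n U -> polynomial_in n V ->
  \int[P]_w (U w ^+ 4) <= A ^+ 2 -> \int[P]_w (V w ^+ 4) <= B ^+ 2 ->
  \int[P]_w ((U w + Y n w * V w) ^+ 4) <= (A + C * B) ^+ 2.
Proof.
move=> A0 B0 pU pV UA VB.
pose m k := \int[P]_w (Y n w ^+ k).
have m1 : m 1%N = 0 by rewrite /m; under eq_Rintegral do rewrite expr1; exact: Y_mean.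
have [hC1 hC2] := Y_moments n; rewrite -!/(m _) in hC1 hC2.
have pUV i j : polynomial_in n (fun w => U w ^+ i * V w ^+ j).
  by apply: polynomial_inM; exact: polynomial_inX.
have pW : polynomial_in n.+1 (fun w => U w + Y n w * V w).
  apply: polynomial_inD; first exact: polynomial_inW.
  by apply: polynomial_inM; [exact: polynomial_in_coord|exact: polynomial_inW].
pose I i j := \int[P]_w (U w ^+ i * V w ^+ j).
have pc c k F : polynomial_in n F -> polynomial_in n.+1 (fun w => c * (F w * Y n w ^+ k)).
  move=> pF; apply: polynomial_inM; first exact: polynomial_in_cst.
  apply: polynomial_inM; first exact: polynomial_inW.
  by apply: polynomial_inX; exact: polynomial_in_coord.
have Ic c i j k : \int[P]_w (c * (U w ^+ i * V w ^+ j * Y n w ^+ k)) = c * (I i j * m k).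
  rewrite RintegralZl//; last first.
    have := iP (pc 1 k _ (pUV i j)); apply: eq_integrable => // w _ /=; by rewrite mul1r.
  by rewrite Rintegral_polynomial_inM.
have E : \int[P]_w ((U w + Y n w * V w) ^+ 4) =
    I 4%N 0%N * m 0%N + 4 * (I 3%N 1%N * m 1%N) + 6 * (I 2%N 2%N * m 2%N) + 4 * (I 1%N 3%N * m 3%N)
    + I 0%N 4%N * m 4%N.
  pose G (k : nat) w : R := [:: 1; 4; 6; 4; 1]`_k * (U w ^+ (4 - k) * V w ^+ k * Y n w ^+ k).
  transitivity (\int[P]_w (\sum_(k <- iota 0 5) G k w)).
    apply: eq_Rintegral => w _; rewrite /= !big_cons big_nil /G /=; ring.
  rewrite Rintegral_sum_seq; last first.
    by move=> k; exact: (iP (pc _ _ _ (pUV _ _))).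
  rewrite /= !big_cons big_nil /G !Ic /=; ring.
have m0 : m 0%N = 1.
  by rewrite /m; under eq_Rintegral do rewrite expr0; rewrite Rintegral_cst// mul1r; exact: (congr1 fine (@probability_setT _ _ _ P)).
have I40 : I 4%N 0%N <= A ^+ 2.
  by rewrite /I; under eq_Rintegral do rewrite expr0 mulr1.
have I04 : I 0%N 4%N <= B ^+ 2.
  by rewrite /I; under eq_Rintegral do rewrite expr0 mul1r.
have iUV i j : P.-integrable setT (EFin \o (fun w => U w ^+ i * V w ^+ j)) by exact: iP (pUV i j).
have le_int F G : polynomial_in n F -> polynomial_in n G -> (forall w, F w <= G w) ->
    \int[P]_w F w <= \int[P]_w G w.
  move=> pF pG FG; apply: le_Rintegral => //; [exact: (iP pF)|exact: (iP pG)].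
have lin a b i j k l : \int[P]_w (a * (U w ^+ i * V w ^+ j) + b * (U w ^+ k * V w ^+ l)) =
    a * I i j + b * I k l.
  rewrite RintegralD//; try (apply: iP; apply: polynomial_inM => //; exact: polynomial_in_cst).
  by rewrite !RintegralZl.
have plin a b i j k l : polynomial_in n (fun w => a * (U w ^+ i * V w ^+ j) + b * (U w ^+ k * V w ^+ l)).
  by apply: polynomial_inD; apply: polynomial_inM => //; exact: polynomial_in_cst.
have I22 : I 2%N 2%N <= A * B.
  apply: le_mul_of_amgm => // t t0.
  apply: (@le_trans _ _ (t / 2 * I 4%N 0%N + (t^-1 / 2) * I 0%N 4%N)); last first.
    have ti : 0 < t^-1 by rewrite invr_gt0.
    have : t * I 4%N 0%N <= t * A ^+ 2 by rewrite ler_pM2l.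
    have : t^-1 * I 0%N 4%N <= t^-1 * B ^+ 2 by rewrite ler_pM2l.
    by rewrite [B ^+ 2 / t]mulrC; lra.
  rewrite -lin; apply: le_int => // w; rewrite !expr0 mulr1 mul1r.
  rewrite -subr_ge0 (_ : _ - _ = (t * U w ^+ 2 - V w ^+ 2) ^+ 2 / (2 * t)).
    by rewrite divr_ge0 ?sqr_ge0// mulr_ge0// ltW.
  by field; rewrite gt_eqF.
have m2 : 0 <= m 2%N by apply: Rintegral_ge0 => w _; exact: sqr_ge0.
(* Used with [s] equal to 1 or -1 according to the sign of the third moment: the integrated form of
   2 s U V^3 <= V^2 (U^2 + V^2). *)
have I13 (s : R) : `|s| <= 1 -> 2 * (s * I 1%N 3%N) <= I 2%N 2%N + I 0%N 4%N.
  move=> s1; have -> : 2 * (s * I 1%N 3%N) = (2 * s) * I 1%N 3%N + 0 * I 1%N 3%N by ring.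
  have -> : I 2%N 2%N + I 0%N 4%N = 1 * I 2%N 2%N + 1 * I 0%N 4%N by ring.
  rewrite -!lin; apply: le_int => // w; rewrite -subr_ge0.
  have -> : 1 * (U w ^+ 2 * V w ^+ 2) + 1 * (U w ^+ 0 * V w ^+ 4) -
     (2 * s * (U w ^+ 1 * V w ^+ 3) + 0 * (U w ^+ 1 * V w ^+ 3)) =
     V w ^+ 2 * ((U w - s * V w) ^+ 2 + (1 - s ^+ 2) * V w ^+ 2) by ring.
  rewrite mulr_ge0 ?sqr_ge0// addr_ge0 ?sqr_ge0// mulr_ge0 ?sqr_ge0//.
  by rewrite subr_ge0 -real_normK ?num_real// expr_le1.
have I22_0 : 0 <= I 2%N 2%N by apply: Rintegral_ge0 => w _; rewrite mulr_ge0 ?sqr_ge0.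
have I04_0 : 0 <= I 0%N 4%N.
  by apply: Rintegral_ge0 => w _; rewrite mul1r -[4%N]/(2 * 2)%N exprM sqr_ge0.
have m4 : 0 <= m 4%N.
  by apply: Rintegral_ge0 => w _; rewrite -[4%N]/(2 * 2)%N exprM sqr_ge0.
have K : 4 * (I 1%N 3%N * m 3%N) <= 2 * `|m 3%N| * (I 2%N 2%N + I 0%N 4%N).
  have [m3|m3] := leP 0 (m 3%N).
    have h1 : 2 * (1 * I 1%N 3%N) <= I 2%N 2%N + I 0%N 4%N by apply: I13; rewrite normr1.
    by have h := ler_wpM2l m3 h1; rewrite (ger0_norm m3); lra.
  have h1 : 2 * (-1 * I 1%N 3%N) <= I 2%N 2%N + I 0%N 4%N by apply: I13; rewrite normrN normr1.
  have m3' : 0 <= - m 3%N by rewrite oppr_ge0 ltW.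
  by have h := ler_wpM2l m3' h1; rewrite (ltr0_norm m3); lra.
rewrite E m0 m1.
set M3 := `|m 3%N| in K hC1 hC2 *.
have M30 : 0 <= M3 by rewrite normr_ge0.
have k1 : (6 * m 2%N + 2 * M3) * I 2%N 2%N <= (6 * m 2%N + 2 * M3) * (A * B).
  by apply: ler_wpM2l => //; lra.
have k2 : (m 4%N + 2 * M3) * I 0%N 4%N <= (m 4%N + 2 * M3) * B ^+ 2.
  by apply: ler_wpM2l => //; lra.
have k3 : (6 * m 2%N + 2 * M3) * (A * B) <= 2 * C * (A * B).
  by apply: ler_wpM2r; [exact: mulr_ge0|lra].
have k4 : (m 4%N + 2 * M3) * B ^+ 2 <= C ^+ 2 * B ^+ 2.
  by apply: ler_wpM2r => //; exact: sqr_ge0.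
have -> : (A + C * B) ^+ 2 = A ^+ 2 + 2 * C * (A * B) + C ^+ 2 * B ^+ 2 by ring.
lra.
Qed.

End hypercontractivity.

(** * Multilinear polynomials and the products of factors 1 + i x *)

Section multilinear_polynomials.
Context {R : realType}.
Implicit Types (w : seq bool -> R) (c x : nat -> R).

(* [w s] is the coefficient of the product of the variables selected by [s],
   the head of a list of length n being attached to the variable of index n.-1. *)
Fixpoint multilinear n w x : R :=
  if n is n'.+1 then multilinear n' (fun s => w (false :: s)) x +
    x n' * multilinear n' (fun s => w (true :: s)) x
  else w [::].

(** The bilinear form weighting the coefficients of a monomial of degree d by C^d. On the diagonal
    it is the weighted second moment that dominates the square root of the fourth moment. *)
Fixpoint coef_form (C : R) n w w' : R :=
  if n is n'.+1 then
    coef_form C n' (fun s => w (false :: s)) (fun s => w' (false :: s)) +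
    C * coef_form C n' (fun s => w (true :: s)) (fun s => w' (true :: s))
  else w [::] * w' [::].

Lemma eq_multilinear n w w' x : (forall s, size s = n -> w s = w' s) ->
  multilinear n w x = multilinear n w' x.
Proof.
elim: n w w' => [|n IHn] w w' E /=; first exact: E.
by congr (_ + _ * _); apply: IHn => s sn; apply: E; rewrite /= sn.
Qed.

Lemma eq_coef_form C n w1 w1' w2 w2' :
  (forall s, size s = n -> w1 s = w1' s) -> (forall s, size s = n -> w2 s = w2' s) ->
  coef_form C n w1 w2 = coef_form C n w1' w2'.
Proof.
elim: n w1 w1' w2 w2' => [|n IHn] w1 w1' w2 w2' E E' /=; first by rewrite E// E'.
by congr (_ + _ * _); apply: IHn => s sn; (apply: E || apply: E'); rewrite /= sn.
Qed.

Lemma multilinearZ n a w x : multilinear n (fun s => a * w s) x = a * multilinear n w x.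
Proof. by elim: n w => [|n IHn] w //=; rewrite !IHn; ring. Qed.

Lemma multilinear_sum (I : Type) (r : seq I) n (w : I -> seq bool -> R) x :
  multilinear n (fun s => \sum_(i <- r) w i s) x = \sum_(i <- r) multilinear n (w i) x.
Proof.
by elim: n w => [|n IHn] w //=; rewrite !IHn mulr_sumr -big_split.
Qed.

Lemma multilinearB n w w' x :
  multilinear n (fun s => w s - w' s) x = multilinear n w x - multilinear n w' x.
Proof. by elim: n w w' => [|n IHn] w w' //=; rewrite !IHn; ring. Qed.

Lemma coef_formC C n w w' : coef_form C n w w' = coef_form C n w' w.
Proof.
elim: n w w' => [|n IHn] w w' /=; first exact: mulrC.
by congr (_ + _ * _); exact: IHn.
Qed.

Lemma coef_formZl C n a w w' : coef_form C n (fun s => a * w s) w' = a * coef_form C n w w'.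
Proof. by elim: n w w' => [|n IHn] w w' /=; rewrite ?IHn; ring. Qed.

Lemma coef_formZr C n a w w' : coef_form C n w (fun s => a * w' s) = a * coef_form C n w w'.
Proof. by rewrite coef_formC coef_formZl coef_formC. Qed.

Lemma coef_formBl C n w1 w2 w' :
  coef_form C n (fun s => w1 s - w2 s) w' = coef_form C n w1 w' - coef_form C n w2 w'.
Proof. by elim: n w1 w2 w' => [|n IHn] w1 w2 w' /=; rewrite ?IHn; ring. Qed.

Lemma coef_formBr C n w w1 w2 :
  coef_form C n w (fun s => w1 s - w2 s) = coef_form C n w w1 - coef_form C n w w2.
Proof. by rewrite coef_formC coef_formBl; congr (_ - _); exact: coef_formC. Qed.

Lemma coef_form_suml (I : Type) (r : seq I) C n (w : I -> seq bool -> R) w' :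
  coef_form C n (fun s => \sum_(i <- r) w i s) w' = \sum_(i <- r) coef_form C n (w i) w'.
Proof.
by elim: n w w' => [|n IHn] w w' /=; rewrite ?mulr_suml// !IHn mulr_sumr -big_split.
Qed.

Lemma coef_form_sumr (I : Type) (r : seq I) C n w (w' : I -> seq bool -> R) :
  coef_form C n w (fun s => \sum_(i <- r) w' i s) = \sum_(i <- r) coef_form C n w (w' i).
Proof.
by rewrite coef_formC coef_form_suml; apply: eq_bigr => i _; exact: coef_formC.
Qed.

Lemma coef_form_ge0 C n w : 0 <= C -> 0 <= coef_form C n w w.
Proof.
move=> C0; elim: n w => [|n IHn] w /=; first by rewrite -expr2 sqr_ge0.
by rewrite addr_ge0// mulr_ge0.
Qed.

(* Real and imaginary parts of the product of the 1 + i x_j. *)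
Fixpoint oneDi_prod x n : R * R :=
  if n is n'.+1 then let z := oneDi_prod x n' in (z.1 - x n' * z.2, z.2 + x n' * z.1)
  else (1, 0).

(** Multiplication by i c sends (x, y) to (- c y, c x); [size s'] is the index of the variable
    attached to the head of the list. *)
Fixpoint oneDi_coef c (s : seq bool) : R * R :=
  match s with
  | [::] => (1, 0)
  | false :: s' => oneDi_coef c s'
  | true :: s' => let z := oneDi_coef c s' in (- c (size s') * z.2, c (size s') * z.1)
  end.

Lemma multilinear_oneDi n c x :
  multilinear n (fun s => (oneDi_coef c s).1) x = (oneDi_prod (fun j => c j * x j) n).1 /\
  multilinear n (fun s => (oneDi_coef c s).2) x = (oneDi_prod (fun j => c j * x j) n).2.
Proof.
elim: n => [|n [IH1 IH2]] //=; rewrite IH1 IH2; split.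
  rewrite (@eq_multilinear n _ (fun s => - c n * (oneDi_coef c s).2)) => [|s ->//].
  by rewrite multilinearZ IH2; ring.
rewrite (@eq_multilinear n _ (fun s => c n * (oneDi_coef c s).1)) => [|s ->//].
by rewrite multilinearZ IH1; ring.
Qed.

(** Monomials of even degree have real coefficients and those of odd degree imaginary ones, and the
    signs cancel between the two arguments. What remains is the even or odd part in C of the product
    of the 1 + C c_j c'_j. *)
Lemma coef_form_oneDi C n c c' :
  coef_form C n (fun s => (oneDi_coef c s).1) (fun s => (oneDi_coef c' s).1) =
    2^-1 * (\prod_(j < n) (1 + C * (c j * c' j)) + \prod_(j < n) (1 - C * (c j * c' j))) /\
  coef_form C n (fun s => (oneDi_coef c s).2) (fun s => (oneDi_coef c' s).2) =
    2^-1 * (\prod_(j < n) (1 + C * (c j * c' j)) - \prod_(j < n) (1 - C * (c j * c' j))).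
Proof.
elim: n => [|n [IH1 IH2]] /=; first by rewrite !big_ord0; split; field.
rewrite IH1 IH2 !big_ord_recr /=; split.
  rewrite (@eq_coef_form C n _ (fun s => - c n * (oneDi_coef c s).2)
    _ (fun s => - c' n * (oneDi_coef c' s).2)) => [|s ->//|s ->//].
  by rewrite coef_formZl coef_formZr IH2; field.
rewrite (@eq_coef_form C n _ (fun s => c n * (oneDi_coef c s).1)
    _ (fun s => c' n * (oneDi_coef c' s).1)) => [|s ->//|s ->//].
by rewrite coef_formZl coef_formZr IH1; field.
Qed.

Lemma oneDi_prod0 n : (oneDi_prod (fun=> 0) n) = (1, 0).
Proof. by elim: n => [|n IHn] //=; rewrite IHn /= !mul0r subr0 addr0. Qed.

End multilinear_polynomials.

Section multilinear_fourth_moment.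
Context d (T : measurableType d) (R : realType) (P : probability T R).
Variable Y : nat -> T -> R.
Hypothesis Y_indep : forall n (e : nat -> nat),
  P.-integrable setT (EFin \o monomial Y n e) /\
  \int[P]_w monomial Y n e w = \prod_(i < n) \int[P]_w (Y i w ^+ e i).
Variable C : R.
Hypothesis Y_mean : forall i, \int[P]_w (Y i w) = 0.
Hypothesis Y_moments : forall i,
  3 * \int[P]_w (Y i w ^+ 2) + `|\int[P]_w (Y i w ^+ 3)| <= C /\
  \int[P]_w (Y i w ^+ 4) + 2 * `|\int[P]_w (Y i w ^+ 3)| <= C ^+ 2.

Lemma moment_constant_ge0 : 0 <= C.
Proof.
apply: le_trans (Y_moments 0).1; rewrite addr_ge0// mulr_ge0//.
by apply: Rintegral_ge0 => w _; exact: sqr_ge0.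
Qed.

Lemma fourth_moment_multilinear n (u : seq bool -> R) :
  polynomial_in Y n (fun w => multilinear n u (Y ^~ w)) /\
  \int[P]_w (multilinear n u (Y ^~ w) ^+ 4) <= coef_form C n u u ^+ 2.
Proof.
elim: n u => [|n IHn] u /=.
  split; first exact: polynomial_in_cst.
  rewrite Rintegral_cst//.
  have -> : fine (P setT) = 1 by exact: (congr1 fine (@probability_setT _ _ _ P)).
  by rewrite mulr1 -expr2 -exprM.
have [pU hU] := IHn (fun s => u (false :: s)); have [pV hV] := IHn (fun s => u (true :: s)).
split; last first.
  by apply: fourth_moment_step => //; exact: (coef_form_ge0 _ _ moment_constant_ge0).
apply: polynomial_inD; first exact: polynomial_inW.
by apply: polynomial_inM; [exact: polynomial_in_coord|exact: polynomial_inW].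
Qed.

Lemma fourth_moment_oneDi_mean N n (c : 'I_N -> nat -> R) :
  let S w := N%:R^-1 * \sum_(k < N) ((oneDi_prod (fun j => c k j * Y j w) n).1 - 1) in
  let Q := N%:R ^- 2 * \sum_(k < N) \sum_(l < N)
    (2^-1 * (\prod_(j < n) (1 + C * (c k j * c l j)) +
             \prod_(j < n) (1 - C * (c k j * c l j))) - 1) in
  [/\ polynomial_in Y n S, 0 <= Q & \int[P]_w (S w ^+ 4) <= Q ^+ 2].
Proof.
move=> S Q.
(* The constant 1 is the product whose coefficients all vanish, so subtracting it stays within the
   family. Its pairings with the other products equal 1, which leaves the single [- 1] in [Q]. *)
pose u0 := fun s : seq bool => (oneDi_coef (fun=> 0 : R) s).1.
pose uk (k : 'I_N) := fun s => (oneDi_coef (c k) s).1.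
pose u s := N%:R^-1 * \sum_(k < N) (uk k s - u0 s).
have SE w : S w = multilinear n u (Y ^~ w).
  rewrite multilinearZ multilinear_sum; congr (_ * _); apply: eq_bigr => k _.
  rewrite multilinearB (multilinear_oneDi _ _ _).1 (multilinear_oneDi _ _ _).1.
  congr (_ - _); rewrite (_ : (fun j => _) = fun=> 0) ?oneDi_prod0//.
  by apply/funext => j; rewrite mul0r.
have [pS hS] := fourth_moment_multilinear n u.
have QE : coef_form C n u u = Q; last first.
  rewrite -QE; split; last by under eq_Rintegral do rewrite SE.
    by rewrite (_ : S = (fun w => multilinear n u (Y ^~ w)))//; exact/funext.
  exact: (coef_form_ge0 _ _ moment_constant_ge0).
rewrite /Q.
rewrite coef_formZl coef_formZr mulrA -invfM -expr2; congr (_ * _).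
rewrite coef_form_suml; apply: eq_bigr => k _.
rewrite coef_form_sumr; apply: eq_bigr => l _.
rewrite coef_formBl !coef_formBr !(coef_form_oneDi _ _ _ _).1.
have p1 (a : nat -> R) : \prod_(j < n) (1 + C * (a j * 0)) = 1.
  by rewrite big1// => j _; rewrite !mulr0 addr0.
have m1 (a : nat -> R) : \prod_(j < n) (1 - C * (a j * 0)) = 1.
  by rewrite big1// => j _; rewrite !mulr0 subr0.
have p2 (a : nat -> R) : \prod_(j < n) (1 + C * (0 * a j)) = 1.
  by rewrite big1// => j _; rewrite mul0r !mulr0 addr0.
have m2 (a : nat -> R) : \prod_(j < n) (1 - C * (0 * a j)) = 1.
  by rewrite big1// => j _; rewrite mul0r !mulr0 subr0.
by rewrite /= !p1 !m1 !p2 !m2 (p1 (fun=> 0)) (m1 (fun=> 0)); field.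
Qed.

End multilinear_fourth_moment.

(** * Almost sure limits *)

Section almost_sure_convergence.
Context d (T : measurableType d) (R : realType) (P : probability T R).

Lemma sum_inv_sqr_le2 m : \sum_(0 <= i < m) (i.+1%:R : R) ^- 2 <= 2.
Proof.
case: m => [|m]; first by rewrite big_geq.
suff : \sum_(0 <= i < m.+1) (i.+1%:R : R) ^- 2 <= 2 - m.+1%:R^-1.
  by move/le_trans; apply; rewrite gerBl invr_ge0.
elim: m => [|m IHm]; first by rewrite big_nat1 expr1n invr1; lra.
rewrite big_nat_recr//=; apply: le_trans (lerD IHm (lexx _)) _.
have p : 0 < m.+1%:R :> R by rewrite ltr0n.
have -> : m.+2%:R = m.+1%:R + 1 :> R by rewrite -natr1.
move: (m.+1%:R : R) p => x p.
rewrite -subr_ge0 (_ : _ - _ = (x * (x + 1) ^+ 2)^-1); last first.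
  have x1 : x + 1 != 0 by rewrite gt_eqF// addr_gt0.
  by field; rewrite x1 gt_eqF.
by rewrite invr_ge0 mulr_ge0 ?sqr_ge0// ltW.
Qed.

(** Summable means make the series of the [Z n] integrable, hence finite almost everywhere, and the
    terms of a convergent series tend to 0. *)
Lemma ae_cvg0_of_mean_le (Z : nat -> T -> R) (K : R) (N0 : nat) :
  (forall n w, 0 <= Z n w) -> (forall n, P.-integrable setT (EFin \o Z n)) -> 0 <= K ->
  (forall n, (N0 < n)%N -> \int[P]_w Z n w <= K / n%:R ^+ 2) ->
  {ae P, forall w, Z n w @[n --> \oo] --> (0 : R)}.
Proof.
move=> Z0 iZ K0 ZK.
(* The shift skips the indices up to [N0], and in particular n = 0, where the bound says nothing. *)
pose f n w := (Z (n + N0.+1)%N w)%:E.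
have mf n : measurable_fun setT (f n) by exact: (measurable_int P (iZ _)).
have f0 n w : setT w -> (0 <= f n w)%E by rewrite lee_fin.
have mF : measurable_fun setT (fun w => \sum_(0 <= n <oo) f n w)%E.
  by apply: ge0_emeasurable_sum => // n w _ _; exact: f0.
have F0 w : (0 <= \sum_(0 <= n <oo) f n w)%E by apply: nneseries_ge0 => n _ _; exact: f0.
have intF : (\int[P]_w (\sum_(0 <= n <oo) f n w) <= (K * 2)%:E)%E.
  rewrite integral_nneseries//.
  apply: lime_le; first by apply: is_cvg_nneseries => n _ _; apply: integral_ge0 => w _; exact: f0.
  apply: nearW => m.
  apply: (@le_trans _ _ (\sum_(0 <= n < m) (K * n.+1%:R ^- 2)%:E)%E); last first.
    by rewrite sumEFin lee_fin -mulr_sumr ler_wpM2l// sum_inv_sqr_le2.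
  apply: lee_sum => n _; rewrite -[leLHS]fineK ?lee_fin; last exact/integrable_fin_num/iZ.
  apply: (le_trans (ZK _ _)); first by lia.
  rewrite ler_wpM2l// lef_pV2 ?posrE ?exprn_gt0 ?ltr0n//; last by lia.
  by rewrite lerXn2r ?nnegrE ?ler_nat//; lia.
have iF : P.-integrable setT (fun w => \sum_(0 <= n <oo) f n w)%E.
  apply/integrableP; split => //.
  under eq_integral do rewrite gee0_abs//.
  by apply: (le_lt_trans intF); rewrite ltry.
have := integrable_ae measurableT iF.
apply: filterS => w /(_ I) Fw.
rewrite -(cvg_shiftn N0.+1).
apply: (@cvg_series_cvg_0 _ R^o).
apply: nondecreasing_is_cvgn.
  by apply: nondecreasing_series => n _ _; exact: Z0.
exists (fine (\sum_(0 <= n <oo) f n w)%E) => _ [m _ <-].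
rewrite -lee_fin fineK// -sumEFin.
by apply: nneseries_lim_ge => n _ _; exact: f0.
Qed.

End almost_sure_convergence.

(** * Sums over pairs of frequencies *)

Section trigonometric_products.
Context {R : realType}.

Definition trig_coef (N : nat) (a c : R) (k j : nat) : R :=
  a * cos (ang N (k * (j + 1))) + c * sin (ang N (k * (j + 1))).

Lemma trig_coef_le N a c k j : `|trig_coef N a c k j| <= `|a| + `|c|.
Proof.
apply: le_trans (ler_normD _ _) _; rewrite !normrM lerD//.
  by rewrite ler_piMr// cos_max.
by rewrite ler_piMr// sin_max.
Qed.

Lemma trig_coefM_le N a c k l j :
  `|trig_coef N a c k j * trig_coef N a c l j| <= (`|a| + `|c|) ^+ 2.
Proof. by rewrite normrM expr2 ler_pM// trig_coef_le. Qed.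

(** The hypothesis on [N] keeps every factor nonnegative, so 1 + y <= exp y may be multiplied over
    j. Unless l = k or l = - k modulo N the exponents sum to 0 and the term is at most 0. Each k
    thus retains at most two terms, each at most the exponential on the right. *)
Lemma sum_trig_coef_le N a c (C : R) : (0 < N)%N -> 0 <= C ->
  C * (`|a| + `|c|) ^+ 2 <= N%:R ->
  \sum_(k < N) \sum_(l < N)
    (2^-1 * (\prod_(j < N) (1 + C * (trig_coef N a c k j / Num.sqrt N%:R *
                                     (trig_coef N a c l j / Num.sqrt N%:R))) +
             \prod_(j < N) (1 - C * (trig_coef N a c k j / Num.sqrt N%:R *
                                     (trig_coef N a c l j / Num.sqrt N%:R)))) - 1)
  <= N%:R * (2 * expR (C * (`|a| + `|c|) ^+ 2)).
Proof.
move=> N0 C0 NC; set s := (`|a| + `|c|) ^+ 2 in NC *; set E := expR _.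
have Np : (0 : R) < N%:R by rewrite ltr0n.
have E1 : 1 <= E by rewrite /E -[leLHS]expR0 ler_expR mulr_ge0// sqr_ge0.
pose x k l j := C * (trig_coef N a c k j / Num.sqrt N%:R * (trig_coef N a c l j / Num.sqrt N%:R)).
have xE k l j : x k l j = C / N%:R * (trig_coef N a c k j * trig_coef N a c l j).
  rewrite /x mulrACA -invfM -expr2 sqr_sqrtr ?ltW//; ring.
have x_le k l j : `|x k l j| <= C * s / N%:R.
  rewrite xE normrM ger0_norm; last by rewrite divr_ge0// ltW.
  by rewrite [leRHS]mulrAC ler_wpM2l ?divr_ge0 ?(ltW Np)// trig_coefM_le.
have x_le1 k l j : `|x k l j| <= 1.
  by apply: le_trans (x_le _ _ _) _; rewrite ler_pdivrMr// mul1r.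
have prod_exp (y : nat -> R) : (forall j, -1 <= y j) ->
    \prod_(j < N) (1 + y j) <= expR (\sum_(j < N) y j).
  move=> y1; rewrite expR_sum; apply: ler_prod => j _.
  by rewrite expR_ge1Dx andbT; have := y1 j; lra.
have x_geN1 k l j : -1 <= x k l j by have := x_le1 k l j; rewrite ler_norml => /andP[].
have Nx_geN1 k l j : -1 <= - x k l j by rewrite lerN2; have := x_le1 k l j; rewrite ler_norml => /andP[].
have sum_x k l : `|\sum_(j < N) x k l j| <= C * s.
  apply: le_trans (ler_norm_sum _ _ _) _.
  apply: (@le_trans _ _ (\sum_(j < N) (C * s / N%:R))); first by apply: ler_sum.
  by rewrite sumr_const card_ord -[leLHS]mulr_natr divfK ?gt_eqF.
have term_le (k l : 'I_N) : 2^-1 * (\prod_(j < N) (1 + x k l j) + \prod_(j < N) (1 - x k l j)) - 1 <=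
    ((k == l)%:R + (N %| k + l)%N%:R) * E.
  have p1 := prod_exp _ (x_geN1 k l); have p2 := prod_exp _ (Nx_geN1 k l).
  rewrite sumrN in p2.
  have [kl|kl] := boolP ((k == l) || (N %| k + l)%N).
    have e1 : expR (\sum_(j < N) x k l j) <= E.
      by rewrite ler_expR (le_trans (ler_norm _))// sum_x.
    have e2 : expR (- \sum_(j < N) x k l j) <= E.
      by rewrite ler_expR (le_trans (ler_norm _))// normrN sum_x.
    have h : 1 <= (k == l)%:R + (N %| k + l)%N%:R :> R.
      by case/orP: kl => ->; rewrite ?lerDl ?lerDr.
    have := ler_wpM2r (le_trans ler01 E1) h; lra.
  move: kl; rewrite negb_or => /andP[kl Nkl]; rewrite (negbTE kl) (negbTE Nkl) addr0 mul0r.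
  have S0 : \sum_(j < N) x k l j = 0.
    under eq_bigr do rewrite xE.
    rewrite -mulr_sumr sum_trig_orthogonal ?mulr0//.
    by rewrite !modn_small.
  rewrite S0 oppr0 expR0 in p1 p2; lra.
apply: (@le_trans _ _ (\sum_(k < N) \sum_(l < N) ((k == l)%:R + (N %| k + l)%N%:R) * E)).
  by apply: ler_sum => k _; apply: ler_sum => l _; exact: term_le.
apply: (@le_trans _ _ (\sum_(k < N) (2 * E))); last first.
  by rewrite sumr_const card_ord -[leLHS]mulr_natl.
apply: ler_sum => k _; rewrite -mulr_suml ler_wpM2r ?(le_trans ler01)//.
pose o : 'I_N := Ordinal (ltn_pmod (N - k) N0).
have sum1 (i : 'I_N) : \sum_(l < N) (i == l)%:R = 1 :> R.
  by rewrite (bigD1 i)//= eqxx big1 ?addr0// => l; rewrite eq_sym => /negbTE ->.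
rewrite big_split /= sum1 (eq_bigr (fun l : 'I_N => (o == l)%:R)) => [|l _]; last first.
  by rewrite -eqn_mod_oppl// [in (l %% N)%N]modn_small.
by rewrite sum1.
Qed.

End trigonometric_products.

Lemma sqr_sum_le (R : realFieldType) n (x : 'I_n -> R) :
  (\sum_(j < n) x j) ^+ 2 <= n%:R * \sum_(j < n) x j ^+ 2.
Proof.
case: n x => [|n] x; first by rewrite !big_ord0 mulr0 expr0n.
set S := \sum_(j < n.+1) x j; set N : R := n.+1%:R.
have Np : 0 < N by rewrite ltr0n.
rewrite -subr_ge0 -(pmulr_rge0 _ Np).
have -> : N * (N * \sum_(j < n.+1) x j ^+ 2 - S ^+ 2) = \sum_(j < n.+1) (N * x j - S) ^+ 2.
  rewrite [RHS](eq_bigr (fun j => N ^+ 2 * x j ^+ 2 - 2 * N * S * x j + S ^+ 2)) => [|j _]; last by ring.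
  rewrite [RHS]big_split /= sumrB -!mulr_sumr sumr_const card_ord -/S.
  by rewrite -(mulr_natr S n.+1) -/N; ring.
by apply: sumr_ge0 => j _; exact: sqr_ge0.
Qed.

Section almost_sure_properties.
Context d (T : measurableType d) (R : realType) (P : probability T R).
Variable b : nat -> {RV P >-> R}.
Hypothesis b_indep : mutually_independent b.
Hypothesis b_ident : identically_distributed b.
Hypothesis b_moments : forall i k : nat, P.-integrable setT (fun w => (b i w ^+ k)%:E).
Hypothesis b_mean : forall i, \int[P]_w b i w = 0.
Hypothesis b_sqr : forall i, \int[P]_w (b i w ^+ 2) = 1.

Let b_monomial n e : P.-integrable setT (EFin \o monomial b n e) /\
  \int[P]_w monomial b n e w = \prod_(i < n) \int[P]_w (b i w ^+ e i).
Proof.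
by apply: (integral_prod_indep b_indep n (h := fun i x => x ^+ e i)).
Qed.

Let integral_ident (g : R -> R) i j : measurable_fun setT g ->
  P.-integrable setT (fun w => (g (b i w))%:E) -> P.-integrable setT (fun w => (g (b j w))%:E) ->
  \int[P]_w g (b i w) = \int[P]_w g (b j w).
Proof.
move=> mg ii ij; rewrite /Rintegral; congr fine.
have mg' : measurable_fun setT (EFin \o g) by exact/measurable_EFinP.
have <- := integral_distribution mg' ii; have <- := integral_distribution mg' ij.
by apply: eq_measure_integral => A mA _; exact: b_ident.
Qed.

Let moment_constant (Y : nat -> T -> R) : (forall i k, \int[P]_w (Y i w ^+ k) = \int[P]_w (Y 0%N w ^+ k)) ->
  exists C, forall i, 3 * \int[P]_w (Y i w ^+ 2) + `|\int[P]_w (Y i w ^+ 3)| <= C /\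
  \int[P]_w (Y i w ^+ 4) + 2 * `|\int[P]_w (Y i w ^+ 3)| <= C ^+ 2.
Proof.
move=> E; set m2 := \int[P]_w (Y 0%N w ^+ 2) in E *.
pose m k := \int[P]_w (Y 0%N w ^+ k).
have m2_0 : 0 <= m 2%N by apply: Rintegral_ge0 => w _; exact: sqr_ge0.
have m4_0 : 0 <= m 4%N.
  by apply: Rintegral_ge0 => w _; rewrite -[4%N]/(2 * 2)%N exprM sqr_ge0.
(* The summand 1 forces c <= c^2, so one bound linear in the moments meets both conditions. *)
exists (1 + 3 * m 2%N + 2 * `|m 3%N| + m 4%N) => i; rewrite !E -/(m 3%N) -/(m 2%N) -/(m 4%N).
have m3 := normr_ge0 (m 3%N); split; first by lra.
set c := 1 + _ + _ + _; have c1 : 1 <= c by rewrite /c; lra.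
have : c <= c ^+ 2 by rewrite expr2 ler_peMl//; lra.
by rewrite /c; lra.
Qed.

Let b_moment_ident i k : \int[P]_w (b i w ^+ k) = \int[P]_w (b 0%N w ^+ k).
Proof. by apply: (@integral_ident (fun x => x ^+ k)). Qed.

Let integrable_poly_b n F : polynomial_in b n F -> P.-integrable setT (EFin \o F).
Proof. exact: integrable_polynomial_in. Qed.

Let ae_cvg0_of_fourth_moment (S : nat -> T -> R) (K : R) (N0 : nat) :
  (forall n, P.-integrable setT (EFin \o (fun w => S n w ^+ 4))) -> 0 <= K ->
  (forall n, (N0 < n)%N -> \int[P]_w (S n w ^+ 4) <= K ^+ 2 / n%:R ^+ 2) ->
  {ae P, forall w, S n w @[n --> \oo] --> (0 : R)}.
Proof.
move=> iS K0 hS.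
have S0 n w : 0 <= S n w ^+ 4 by rewrite -[4%N]/(2 * 2)%N exprM sqr_ge0.
have := @ae_cvg0_of_mean_le _ _ _ P (fun n w => S n w ^+ 4) (K ^+ 2) N0 S0 iS (sqr_ge0 _) hS.
apply: filterS => w /cvgrPdist_lt Sw; apply/cvgrPdist_lt => e e0.
have := Sw _ (exprn_gt0 4 e0); apply: filterS => n.
rewrite !sub0r !normrN (ger0_norm (S0 _ _)) => h.
have : `|S n w| ^+ 4 < e ^+ 4.
  by rewrite -normrX ger0_norm.
apply: contraTT; rewrite -!leNgt => eS.
by rewrite lerXn2r ?nnegrE// ltW.
Qed.

Lemma ae_trig_products (a c : R) :
  {ae P, forall w, N%:R^-1 * \sum_(k < N)
    ((oneDi_prod (fun j => trig_coef N a c k j / Num.sqrt N%:R * b j w) N).1 - 1)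
    @[N --> \oo] --> (0 : R)}.
Proof.
have [C HC] := moment_constant b_moment_ident.
have C0 := moment_constant_ge0 HC.
set E := expR (C * (`|a| + `|c|) ^+ 2).
(* From this threshold on [sum_trig_coef_le] applies. It gives Q <= 2 E / n, and Q^2 is summable. *)
have [N0 HN0] : exists N0 : nat, C * (`|a| + `|c|) ^+ 2 <= N0%:R.
  have := archi_boundP (mulr_ge0 C0 (sqr_ge0 (`|a| + `|c|))).
  by move=> /ltW h; exists (Num.bound (C * (`|a| + `|c|) ^+ 2)).
pose S N w := N%:R^-1 * \sum_(k < N)
    ((oneDi_prod (fun j => trig_coef N a c k j / Num.sqrt N%:R * b j w) N).1 - 1).
have HS N := fourth_moment_oneDi_mean b_monomial b_mean HC N
   (fun (k : 'I_N) j => trig_coef N a c k j / Num.sqrt N%:R).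
apply: (@ae_cvg0_of_fourth_moment S (2 * E) N0).
- by move=> n; have [pS _ _] := HS n; apply: (integrable_poly_b (n := n)); exact: polynomial_inX.
- by rewrite mulr_ge0// expR_ge0.
move=> n Nn; have n0 : (0 < n)%N by lia.
have np : (0 : R) < n%:R by rewrite ltr0n.
have [_ Q0 SQ] := HS n.
apply: (le_trans SQ).
have -> : (2 * E) ^+ 2 / n%:R ^+ 2 = (n%:R ^- 2 * (n%:R * (2 * E))) ^+ 2.
  by field; rewrite gt_eqF.
rewrite lerXn2r ?nnegrE//; first by rewrite mulr_ge0 ?invr_ge0 ?sqr_ge0// mulr_ge0 ?ler0n// mulr_ge0// expR_ge0.
rewrite ler_wpM2l ?invr_ge0 ?sqr_ge0//.
apply: sum_trig_coef_le => //.
by apply: (le_trans HN0); rewrite ler_nat ltnW.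
Qed.

(** A strong law for the centred squares. Adding one summand is [fourth_moment_step] with [V = 1],
    so the fourth moment of the sum is at most (C n)^2, and dividing by n^4 makes it summable. *)
Lemma ae_mean_sqr : {ae P, forall w, N%:R^-1 * \sum_(j < N) b j w ^+ 2 @[N --> \oo] --> (1 : R)}.
Proof.
pose Y i w := b i w ^+ 2 - 1.
have pY n : polynomial_in b n.+1 (Y n).
  apply: polynomial_inD; last exact: polynomial_in_cst.
  by apply: polynomial_inX; exact: polynomial_in_coord.
have iY i k : P.-integrable setT (fun w => (Y i w ^+ k)%:E).
  by apply: (integrable_poly_b (n := i.+1)); exact: polynomial_inX.
have mY k : measurable_fun setT (fun x : R => (x ^+ 2 - 1) ^+ k).
  by apply: measurable_funX; apply: measurable_funB.
have Y_monomial n e : P.-integrable setT (EFin \o monomial Y n e) /\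
    \int[P]_w monomial Y n e w = \prod_(i < n) \int[P]_w (Y i w ^+ e i).
  exact: (integral_prod_indep b_indep n (h := fun i x => (x ^+ 2 - 1) ^+ e i)
    (fun i => mY (e i)) (fun i => iY i (e i))).
have Y_ident i k : \int[P]_w (Y i w ^+ k) = \int[P]_w (Y 0%N w ^+ k).
  exact: (integral_ident (mY k) (iY i k) (iY 0%N k)).
have Y_mean i : \int[P]_w Y i w = 0.
  rewrite RintegralB//; [|exact: b_moments|exact: finite_measure_integrable_cst].
  rewrite b_sqr Rintegral_cst// mul1r.
  have -> : fine (P setT) = 1 by exact: (congr1 fine (@probability_setT _ _ _ P)).
  by rewrite subrr.
have [C HC] := moment_constant Y_ident.
have C0 := moment_constant_ge0 HC.
have S4 : forall n, polynomial_in Y n (fun w => \sum_(j < n) Y j w) /\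
    \int[P]_w ((\sum_(j < n) Y j w) ^+ 4) <= (C * n%:R) ^+ 2.
  elim=> [|m [pS IHm]].
    split; last by under eq_Rintegral do rewrite big_ord0 expr0n/=; rewrite Rintegral_cst// mul0r mulr0 expr0n.
    rewrite (_ : (fun w => _) = cst 0); last by apply/funext => w; rewrite big_ord0.
    exact: polynomial_in_cst.
  have E w : \sum_(j < m.+1) Y j w = \sum_(j < m) Y j w + Y m w * cst 1 w.
    by rewrite big_ord_recr mulr1.
  split.
    under eq_fun do rewrite E.
    apply: polynomial_inD; first exact: polynomial_inW.
    by apply: polynomial_inM; [exact: polynomial_in_coord|exact: polynomial_in_cst].
  under eq_Rintegral do rewrite E.
  have -> : C * m.+1%:R = C * m%:R + C * 1 by rewrite -natr1 mulrDr.
  apply: (fourth_moment_step Y_monomial Y_mean HC) => //.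
  - by rewrite mulr_ge0.
  - exact: polynomial_in_cst.
  under eq_Rintegral do rewrite expr1n; rewrite Rintegral_cst// mul1r.
  have -> : fine (P setT) = 1 by exact: (congr1 fine (@probability_setT _ _ _ P)).
  by rewrite expr1n.
have := @ae_cvg0_of_fourth_moment (fun n w => n%:R^-1 * \sum_(j < n) Y j w) C 0%N.
have pS n : polynomial_in Y n (fun w => (n%:R^-1 * \sum_(j < n) Y j w) ^+ 4).
  apply: polynomial_inX; apply: polynomial_inM; [exact: polynomial_in_cst|exact: (S4 n).1].
have iS n : P.-integrable setT (EFin \o (fun w => (n%:R^-1 * \sum_(j < n) Y j w) ^+ 4)).
  exact: (integrable_polynomial_in Y_monomial (pS n)).
have S4' n : (0 < n)%N -> \int[P]_w ((n%:R^-1 * \sum_(j < n) Y j w) ^+ 4) <= C ^+ 2 / n%:R ^+ 2.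
  move=> n0; have np : (0 : R) < n%:R by rewrite ltr0n.
  under eq_Rintegral do rewrite exprMn.
  rewrite RintegralZl//; last first.
    by apply: (integrable_polynomial_in Y_monomial (n := n)); apply: polynomial_inX; exact: (S4 n).1.
  apply: (@le_trans _ _ (n%:R^-1 ^+ 4 * (C * n%:R) ^+ 2)).
    by rewrite ler_wpM2l ?exprn_ge0 ?invr_ge0 ?(ltW np)//; exact: (S4 n).2.
  by rewrite le_eqVlt; apply/orP; left; apply/eqP; field; rewrite gt_eqF.
move=> /(_ iS C0 S4'); apply: filterS => w Sw.
rewrite -[X in _ --> X](addr0 1) -(@cvg_shiftS _ _).
rewrite [X in X @ _ --> _](_ : _ = fun n => 1 + (n.+1%:R^-1 * \sum_(j < n.+1) Y j w)).
  apply: cvgD; first exact: cvg_cst.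
  by rewrite (cvg_shiftS (fun n => n%:R^-1 * \sum_(j < n) Y j w)).
apply/funext => n; rewrite /Y sumrB mulrBr sumr_const card_ord mulVf ?pnatr_eq0//.
by rewrite addrC subrK.
Qed.

(** By Cauchy-Schwarz the square of the sum is at most n times the sum of the b_j^8. The second
    moment of the normalized sum is therefore at most K / n^2, with K the common eighth moment. *)
Lemma ae_mean_fourth : {ae P, forall w,
  N%:R ^- 2 * \sum_(j < N) b j w ^+ 4 @[N --> \oo] --> (0 : R)}.
Proof.
pose S n w := n%:R ^- 2 * \sum_(j < n) b j w ^+ 4.
have pb j n k : (j < n)%N -> polynomial_in b n (fun w => b j w ^+ k).
  elim: n => // n IHn; rewrite ltnS leq_eqVlt => /orP[/eqP ->|jn].
    by apply: polynomial_inX; exact: polynomial_in_coord.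
  by apply: polynomial_inW; exact: IHn.
have ib j k : P.-integrable setT (EFin \o (fun w => b j w ^+ k)).
  exact: b_moments.
pose K := \int[P]_w (b 0%N w ^+ 8).
have K0 : 0 <= K by apply: Rintegral_ge0 => w _; rewrite -[8%N]/(2 * 4)%N exprM exprn_ge0// sqr_ge0.
have pS n : polynomial_in b n (S n).
  apply: polynomial_inM; first exact: polynomial_in_cst.
  have : forall m, (m <= n)%N -> polynomial_in b n (fun w => \sum_(j < m) b j w ^+ 4).
    elim=> [_|m IHm mn].
      rewrite (_ : (fun w => _) = cst 0); last by apply/funext => w; rewrite big_ord0.
      exact: polynomial_in_cst.
    rewrite (_ : (fun w => _) = (fun w => \sum_(j < m) b j w ^+ 4 + b m w ^+ 4)); last first.
      by apply/funext => w; rewrite big_ord_recr.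
    by apply: polynomial_inD; [exact/IHm/ltnW|exact: pb].
  exact.
have iS n k : P.-integrable setT (EFin \o (fun w => S n w ^+ k)).
  by apply: (integrable_poly_b (n := n)); exact: polynomial_inX.
have S_le n w : (0 < n)%N -> S n w ^+ 2 <= n%:R ^- 3 * \sum_(j < n) b j w ^+ 8.
  move=> n0; have np : (0 : R) < n%:R by rewrite ltr0n.
  rewrite /S exprMn.
  have -> : n%:R ^- 3 = (n%:R ^- 2) ^+ 2 * n%:R :> R by field; rewrite gt_eqF.
  rewrite -mulrA ler_wpM2l ?sqr_ge0//.
  apply: le_trans (sqr_sum_le _) _; rewrite ler_wpM2l ?(ltW np)//.
  by apply: ler_sum => j _; rewrite -exprM.
have h3 n : (0 < n)%N -> \int[P]_w (S n w ^+ 2) <= K / n%:R ^+ 2.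
  move=> n0; have np : (0 : R) < n%:R by rewrite ltr0n.
  have iT : P.-integrable setT (EFin \o (fun w => \sum_(j < n) b j w ^+ 8)).
    have -> : EFin \o (fun w => \sum_(j < n) b j w ^+ 8) = (fun w => \sum_(j < n) (b j w ^+ 8)%:E)%E.
      by apply/funext => w /=; rewrite sumEFin.
    by apply: integrable_sum => // j _; exact: b_moments.
  apply: (@le_trans _ _ (\int[P]_w (n%:R ^- 3 * \sum_(j < n) b j w ^+ 8))).
    apply: le_Rintegral; [by []|exact: (iS n 2%N)| |].
      have := integrableZl measurableT (n%:R ^- 3) iT.
      by apply: eq_integrable.
    by move=> w _; exact: S_le.
  rewrite RintegralZl// Rintegral_sum_seq; last by move=> j; exact: ib.
  under eq_bigr do rewrite b_moment_ident.
  rewrite sumr_const card_ord -mulr_natr -/K.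
  by rewrite le_eqVlt; apply/orP; left; apply/eqP; field; rewrite gt_eqF.
have := @ae_cvg0_of_mean_le _ _ _ P (fun n w => S n w ^+ 2) K 0%N (fun n w => sqr_ge0 _) (iS ^~ 2%N) K0 h3.
apply: filterS => w /cvgrPdist_lt Sw; apply/cvgrPdist_lt => e e0.
have := Sw _ (exprn_gt0 2 e0); apply: filterS => n.
rewrite !sub0r !normrN (ger0_norm (sqr_ge0 _)) -/(S n w) => h.
have : `|S n w| ^+ 2 < e ^+ 2 by rewrite -normrX ger0_norm// sqr_ge0.
apply: contraTT; rewrite -!leNgt => eS.
by rewrite lerXn2r ?nnegrE// ltW.
Qed.


End almost_sure_properties.

(** * The empirical characteristic function *)

Section quadratic_sums.
Context {R : realType}.

Lemma sum_sqr_expand (I J : finType) (u : J -> R) (f : I -> J -> R) :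
  \sum_(i : I) (\sum_(j : J) u j * f i j) ^+ 2 =
  \sum_(j : J) \sum_(l : J) u j * u l * (\sum_(i : I) f i j * f i l).
Proof.
transitivity (\sum_(i : I) \sum_(j : J) \sum_(l : J) u j * u l * (f i j * f i l)).
  apply: eq_bigr => i _; rewrite expr2 mulr_suml; apply: eq_bigr => j _.
  by rewrite mulr_sumr; apply: eq_bigr => l _; ring.
rewrite exchange_big /=; apply: eq_bigr => j _.
by rewrite exchange_big /=; apply: eq_bigr => l _; rewrite mulr_sumr.
Qed.

Lemma parseval N (b : nat -> R) : (0 < N)%N ->
  \sum_(k < N) (fourier_cos N b k ^+ 2 + fourier_sin N b k ^+ 2) =
  N%:R * \sum_(j < N) b j ^+ 2.
Proof.
move=> N0; rewrite big_split /= /fourier_cos /fourier_sin !sum_sqr_expand -big_split /=.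
rewrite mulr_sumr; apply: eq_bigr => j _; rewrite -big_split /=.
rewrite (bigD1 j)//= [X in _ + X]big1 ?addr0 => [|l lj].
  rewrite -mulrDr -big_split /= (eq_bigr (fun=> 1)) => [|k _]; last first.
    by rewrite -!expr2 cos2Dsin2.
  by rewrite sumr_const card_ord -expr2 mulrC.
rewrite -mulrDr -big_split /=.
have := @sum_cos_angB R N (j + 1) (l + 1) 0 0 N0.
have -> : (j + 1 == l + 1 %[mod N])%N = false.
  rewrite eqn_modDr !modn_small//; apply/negbTE; rewrite eq_sym; exact: lj.
move=> h; rewrite (_ : \sum_(k < N) _ = 0) ?mulr0// -[RHS]h.
apply: eq_bigr => k _; rewrite addr0 addn0 cosB.
by rewrite ![(k * _)%N]mulnC.
Qed.

(** Doubling modulo N is at most two-to-one. *)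
Lemma count_double_le2 N r : (0 < N)%N -> \sum_(j < N) (N %| 2 * j + r)%N%:R <= 2 :> R.
Proof.
move=> N0; rewrite -natr_sum ler_nat.
wlog rN : r / (r < N)%N => [H|].
  rewrite (eq_bigr (fun j : 'I_N => (N %| 2 * j + r %% N)%N : nat)) => [|j _].
    by apply: H; rewrite ltn_mod.
  by rewrite /dvdn modnDmr.
(* With r < N, a multiple of N of the form 2 j + r is 0, N or 2 N. The last two values give [o1] and
   [o2]; the first forces j = r = 0, which the reduction modulo N merges with [o2]. *)
pose o1 : 'I_N := Ordinal (ltn_pmod (N - r)./2 N0).
pose o2 : 'I_N := Ordinal (ltn_pmod (N + (N - r))./2 N0).
apply: (@leq_trans (\sum_(j < N) ((j == o1) + (j == o2)))%N); last first.
  have s1 (o : 'I_N) : (\sum_(j < N) (j == o) = 1)%N.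
    by rewrite (bigD1 o)//= eqxx big1 // => j /negbTE ->.
  by rewrite big_split /= !s1.
apply: leq_sum => j _; case: (boolP (N %| _)%N) => // /dvdnP[c E].
have jN := ltn_ord j.
have c3 : (c < 3)%N by rewrite -(@ltn_pmul2r N)// -E; lia.
suff : (j == o1) || (j == o2) by case: (j == o1); case: (j == o2).
have [h|[h|h]] : (2 * j + r = 0 \/ 2 * j + r = N \/ 2 * j + r = 2 * N)%N.
- by case: c c3 E => [|[|[|c]]] // _ E; [left|right; left|right; right]; lia.
- apply/orP; right; rewrite -val_eqE /=; have -> : r = 0%N by lia.
  by rewrite subn0 addnn doubleK modnn; apply/eqP; lia.
- apply/orP; left; rewrite -val_eqE /=; have -> : (N - r = 2 * j)%N by lia.
  by rewrite mul2n doubleK modn_small.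
- apply/orP; right; rewrite -val_eqE /=; have -> : (N + (N - r) = 2 * j)%N by lia.
  by rewrite mul2n doubleK modn_small.
Qed.

(** After expansion only pairs with 2 (j + 1) = 2 (l + 1) or its opposite modulo N survive, at most
    four l for each j. Bounding w_j w_l by (w_j^2 + w_l^2) / 2 then gives (N / 2) times 4, as in a
    Schur test. *)
Lemma sum_double_frequency_le N (w : nat -> R) p q : (0 < N)%N -> (forall j, 0 <= w j) ->
  \sum_(k < N) (\sum_(j < N) w j *
     (p * cos (ang N (2 * (k * (j + 1)))) + q * sin (ang N (2 * (k * (j + 1)))))) ^+ 2
  <= 2 * N%:R * (p ^+ 2 + q ^+ 2) * \sum_(j < N) w j ^+ 2.
Proof.
move=> N0 w0; rewrite sum_sqr_expand.
have Np : (0 : R) < N%:R by rewrite ltr0n.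
pose e (j l : 'I_N) : bool := (2 * (j + 1) == 2 * (l + 1) %[mod N])%N.
pose e' (j l : 'I_N) : bool := (N %| 2 * (j + 1) + 2 * (l + 1))%N.
have inner (j l : 'I_N) : \sum_(k < N) (p * cos (ang N (2 * (k * (j + 1)))) + q * sin (ang N (2 * (k * (j + 1))))) *
    (p * cos (ang N (2 * (k * (l + 1)))) + q * sin (ang N (2 * (k * (l + 1)))))
    <= (p ^+ 2 + q ^+ 2) * (N%:R / 2) * ((e j l)%:R + (e' j l)%:R).
  have cc := @sum_cos_cos R N (2 * (j + 1)) (2 * (l + 1)) 0 N0.
  have ss := @sum_sin_sin R N (2 * (j + 1)) (2 * (l + 1)) 0 N0.
  have sc := @sum_sin_cos R N (2 * (j + 1)) (2 * (l + 1)) 0 N0.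
  have cs := @sum_sin_cos R N (2 * (l + 1)) (2 * (j + 1)) 0 N0.
  rewrite -/(e j l) -/(e' j l) in cc ss.
  pose C (m : nat) (k : 'I_N) : R := cos (ang N (2 * (m + 1) * (k + 0))).
  pose D (m : nat) (k : 'I_N) : R := sin (ang N (2 * (m + 1) * (k + 0))).
  have reC (m : nat) (k : 'I_N) : (2 * (k * (m + 1)) = 2 * (m + 1) * (k + 0))%N.
    by rewrite addn0 -mulnA [(k * _)%N]mulnC.
  rewrite (eq_bigr (fun k => p ^+ 2 * (C j k * C l k) + q ^+ 2 * (D j k * D l k) +
     p * q * (D j k * C l k) + p * q * (D l k * C j k))) => [|k _]; last first.
    by rewrite !reC -/(C j k) -/(C l k) -/(D j k) -/(D l k); ring.
  rewrite !big_split /= -!mulr_sumr cc ss sc cs !mulr0 !addr0.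
  have p0 := sqr_ge0 p; have q0 := sqr_ge0 q.
  by case: (e j l); case: (e' j l); rewrite /=; nra.
apply: (@le_trans _ _ (\sum_(j < N) \sum_(l < N) (p ^+ 2 + q ^+ 2) * (N%:R / 2) *
    ((w j ^+ 2 + w l ^+ 2) / 2 * ((e j l)%:R + (e' j l)%:R)))).
  apply: ler_sum => j _; apply: ler_sum => l _.
  apply: (le_trans (ler_wpM2l (mulr_ge0 (w0 _) (w0 _)) (inner j l))).
  rewrite mulrCA; apply: ler_wpM2l.
    by rewrite mulr_ge0 ?addr_ge0 ?sqr_ge0// divr_ge0// ltW.
  apply: ler_wpM2r; first by rewrite addr_ge0.
  by have := sqr_ge0 (w j - w l); lra.
have cnt (j : 'I_N) : \sum_(l < N) ((e j l)%:R + (e' j l)%:R) <= 4 :> R.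
  rewrite big_split /=.
  have h1 := count_double_le2 (2 + (2 * N - 2 * (j + 1))) N0.
  have h2 := count_double_le2 (2 + 2 * (j + 1)) N0.
  have E1 : \sum_(l < N) (e j l)%:R = \sum_(l < N) (N %| 2 * l + (2 + (2 * N - 2 * (j + 1))))%N%:R :> R.
    apply: eq_bigr => l _; congr (_%:R); rewrite /e eq_sym.
    have jN := ltn_ord j.
    have -> : (2 * l + (2 + (2 * N - 2 * (j + 1))) = (2 * (l + 1) + 2 * N) - 2 * (j + 1))%N by lia.
    by rewrite -eqn_mod_dvd; [rewrite -modnDmr modnMl addn0|lia].
  have E2 : \sum_(l < N) (e' j l)%:R = \sum_(l < N) (N %| 2 * l + (2 + 2 * (j + 1)))%N%:R :> R.
    apply: eq_bigr => l _; congr (_%:R); rewrite /e'.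
    by congr (_ %| _)%N; lia.
  rewrite E1 E2; lra.
have eC j l : e j l = e l j by rewrite /e eq_sym.
have e'C j l : e' j l = e' l j by rewrite /e' addnC.
under eq_bigr do rewrite -mulr_sumr.
rewrite -mulr_sumr.
have -> : \sum_(j < N) \sum_(l < N) (w j ^+ 2 + w l ^+ 2) / 2 * ((e j l)%:R + (e' j l)%:R) =
    \sum_(j < N) w j ^+ 2 * \sum_(l < N) ((e j l)%:R + (e' j l)%:R).
  transitivity (2^-1 * (\sum_(j < N) \sum_(l < N) w j ^+ 2 * ((e j l)%:R + (e' j l)%:R) +
     \sum_(j < N) \sum_(l < N) w l ^+ 2 * ((e j l)%:R + (e' j l)%:R))).
    rewrite -big_split mulr_sumr; apply: eq_bigr => j _ /=.
    by rewrite -big_split mulr_sumr; apply: eq_bigr => l _ /=; field.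
  rewrite [X in _ + X]exchange_big /=.
  rewrite [X in _ + X](eq_bigr (fun l : 'I_N => \sum_(j < N) w l ^+ 2 * ((e l j)%:R + (e' l j)%:R))) => [|l _].
    rewrite -mulr2n -[X in _ * X]mulr_natl mulKf ?pnatr_eq0//.
    by apply: eq_bigr => j _; rewrite mulr_sumr.
  by apply: eq_bigr => j _; rewrite eC e'C.
have -> : 2 * N%:R * (p ^+ 2 + q ^+ 2) * \sum_(j < N) w j ^+ 2 =
   (p ^+ 2 + q ^+ 2) * (N%:R / 2) * (\sum_(j < N) w j ^+ 2 * 4).
  by rewrite -mulr_suml; field.
apply: ler_wpM2l; first by rewrite mulr_ge0 ?addr_ge0 ?sqr_ge0// divr_ge0// ltW.
by apply: ler_sum => j _; apply: ler_wpM2l => //; exact: sqr_ge0.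
Qed.

End quadratic_sums.

(** * Comparison of the cosine of a sum with a product *)

Section products_and_cosines.
Context {R : realType}.
Implicit Types (x : nat -> R) (n : nat).

Lemma mean_value_le (f df : R -> R) (a b : R) : (forall t : R, is_derive t 1 f (df t)) ->
  exists2 c, `|c| <= Num.max `|a| `|b| & f b - f a = df c * (b - a).
Proof.
move=> fd; have between (u v c : R) : u <= c -> c <= v -> `|c| <= Num.max `|u| `|v|.
  move=> uc cv; rewrite le_max; have [c0|c0] := leP 0 c.
    by rewrite (ger0_norm c0) (le_trans cv (ler_norm v)) orbT.
  by rewrite (ltr0_norm c0) -(normrN u) (le_trans _ (ler_norm _))// lerN2.
have cf u v : {within `[u, v], continuous f}.
  apply: continuous_subspaceT => t; apply: differentiable_continuous.
  by apply/derivable1_diffP; exact: ex_derive.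
have [ab|ba|<-] := ltgtP a b.
- have [c] := @MVT R f df a b ab (fun t _ => fd t) (cf _ _).
  rewrite in_itv/= => /andP[ac cb] E; exists c => //.
  by apply: between; apply: ltW.
- have [c] := @MVT R f df b a ba (fun t _ => fd t) (cf _ _).
  rewrite in_itv/= => /andP[bc ca] E; exists c; last by lra.
  by rewrite maxC; apply: between; apply: ltW.
- by exists a; [rewrite maxxx|rewrite !subrr mulr0].
Qed.

Lemma cos_lipschitz (a b : R) : `|cos a - cos b| <= `|a - b|.
Proof.
have [c _ ->] := @mean_value_le cos (fun t => - sin t) b a (@is_derive_cos R).
by rewrite normrM normrN ler_piMl// sin_max.
Qed.

Lemma atan_approx (t : R) : `|t - atan t| <= `|t| ^+ 3.
Proof.
have d (u : R) : is_derive u 1 (fun u => u - atan u) (1 - (1 + u ^+ 2)^-1).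
  exact: is_deriveB.
have [c c_le E] := mean_value_le 0 t d.
move: E; rewrite atan0 !subr0 => ->.
rewrite normrM (exprSr `|t| 2) ler_wpM2r//.
have c2 := sqr_ge0 c; have p : 0 < 1 + c ^+ 2 by lra.
have -> : 1 - (1 + c ^+ 2)^-1 = c ^+ 2 / (1 + c ^+ 2) by field; rewrite gt_eqF.
rewrite ger0_norm; last by rewrite divr_ge0// ltW.
apply: (@le_trans _ _ (c ^+ 2)).
  by rewrite ler_pdivrMr// ler_peMr//; lra.
rewrite -(real_normK (num_real c)) lerXn2r ?nnegrE//.
by move: c_le; rewrite normr0 max_r.
Qed.

Lemma ln1D_bounds (u : R) : 0 <= u -> u - u ^+ 2 <= ln (1 + u) <= u.
Proof.
move=> u0; have p : 0 < 1 + u by lra.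
have ln_le (y : R) : 0 < y -> ln y <= y - 1.
  by move=> y0; have := expR_ge1Dx (ln y); rewrite lnK ?posrE//; lra.
apply/andP; split; last by have := ln_le _ p; lra.
have := ln_le (1 + u)^-1; rewrite invr_gt0 lnV ?posrE// => /(_ p) h.
have E : 1 - (1 + u)^-1 = u / (1 + u) by field; rewrite gt_eqF.
have : u - u ^+ 2 <= u / (1 + u).
  rewrite ler_pdivlMr//; have := mulr_ge0 (sqr_ge0 u) u0; lra.
lra.
Qed.

(** The factor 1 + i x has modulus sqrt (1 + x^2) and argument atan x. This separates the phase
    error from the modulus error in the comparison with the cosine. *)
Lemma oneDi_prod_polar x n :
  let r := expR (2^-1 * \sum_(j < n) ln (1 + x j ^+ 2)) in
  let t := \sum_(j < n) atan (x j) in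
  oneDi_prod x n = (r * cos t, r * sin t).
Proof.
elim: n => [|n IHn] /=; first by rewrite !big_ord0 mulr0 expR0 cos0 sin0 mulr0 mulr1.
rewrite IHn !big_ord_recr /= mulrDr expRD cosD sinD.
set r := expR _; set t := \sum_(j < n) _.
have p : 0 < 1 + x n ^+ 2 by have := sqr_ge0 (x n); lra.
have E : expR (2^-1 * ln (1 + x n ^+ 2)) = Num.sqrt (1 + x n ^+ 2).
  have e : expR (2^-1 * ln (1 + x n ^+ 2)) ^+ 2 = 1 + x n ^+ 2.
    by rewrite -expRM_natl mulrA divff// mul1r lnK.
  by rewrite -[LHS]ger0_norm ?expR_ge0// -sqrtr_sqr e.
have s0 : Num.sqrt (1 + x n ^+ 2) != 0 by rewrite gt_eqF// sqrtr_gt0.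
have C : expR (2^-1 * ln (1 + x n ^+ 2)) * cos (atan (x n)) = 1.
  by rewrite E cos_atan divff.
have S : expR (2^-1 * ln (1 + x n ^+ 2)) * sin (atan (x n)) = x n.
  have c0 : cos (atan (x n)) != 0 by rewrite cos_atan invr_eq0.
  rewrite -[RHS](atanK (x n)) /tan mulrC; congr (_ * _).
  by apply: (mulIf c0); rewrite C mulVf.
congr (_, _).
- transitivity (r * (cos t * (expR (2^-1 * ln (1 + x n ^+ 2)) * cos (atan (x n))) -
    sin t * (expR (2^-1 * ln (1 + x n ^+ 2)) * sin (atan (x n))))); last by ring.
  by rewrite C S; ring.
- transitivity (r * (sin t * (expR (2^-1 * ln (1 + x n ^+ 2)) * cos (atan (x n))) +
    cos t * (expR (2^-1 * ln (1 + x n ^+ 2)) * sin (atan (x n))))); last by ring.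
  by rewrite C S; ring.
Qed.

Lemma expR_approx1 (u K : R) : 1 <= K -> expR u <= K -> `|1 - expR u| <= K * `|u|.
Proof.
move=> K1 uK; have [u0|u0] := leP 0 u.
  rewrite (ger0_norm u0) distrC ger0_norm; last by rewrite subr_ge0 -[leLHS]expR0 ler_expR.
  have h := expR_ge1Dx (- u); have e := expR_gt0 u.
  have : expR u * (1 - u) <= 1.
    by rewrite -[leRHS]expR0 -(subrr u) expRD ler_pM2l.
  have : expR u * u <= K * u by rewrite ler_wpM2r.
  lra.
rewrite (ltr0_norm u0) ger0_norm; last by rewrite subr_ge0 -[leRHS]expR0 ler_expR ltW.
have h := expR_ge1Dx u.
have : - u <= K * - u by rewrite ler_peMl//; lra.
lra.
Qed.

(* McLeish's device: exp(i x) = (1 + i x) exp(- x^2 / 2 + O(|x|^3)). *)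
Lemma cos_sum_approx x n (v : R) : 0 <= v ->
  `|cos (\sum_(j < n) x j) - (oneDi_prod x n).1 * expR (- v)| <=
  \sum_(j < n) `|x j| ^+ 3 + expR (2^-1 * \sum_(j < n) x j ^+ 2) *
    (2^-1 * \sum_(j < n) x j ^+ 4 + `|2^-1 * \sum_(j < n) x j ^+ 2 - v|).
Proof.
move=> v0; rewrite oneDi_prod_polar /=.
set t := \sum_(j < n) atan _; set L := 2^-1 * \sum_(j < n) ln _.
set X := \sum_(j < n) x j; set q := \sum_(j < n) x j ^+ 2; set f := \sum_(j < n) x j ^+ 4.
have Xt : `|X - t| <= \sum_(j < n) `|x j| ^+ 3.
  rewrite /X /t -sumrB; apply: le_trans (ler_norm_sum _ _ _) _.
  by apply: ler_sum => j _; exact: atan_approx.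
have Lb : 2^-1 * q - 2^-1 * f <= L <= 2^-1 * q.
  have h j := ln1D_bounds (sqr_ge0 (x j)).
  apply/andP; split; last by rewrite ler_pM2l//; apply: ler_sum => j _; have /andP[] := h j.
  rewrite -mulrBr ler_pM2l// -sumrB; apply: ler_sum => j _.
  by have /andP[+ _] := h j; rewrite -exprM.
have q0 : 0 <= q by apply: sumr_ge0 => j _; exact: sqr_ge0.
have f0 : 0 <= f by apply: sumr_ge0 => j _; rewrite -[4%N]/(2 * 2)%N exprM sqr_ge0.
(* The first difference is the phase error, of third order in the x_j; the second is the modulus
   error, governed by the distance from L to v. *)
have -> : cos X - expR L * cos t * expR (- v) = (cos X - cos t) + cos t * (1 - expR (L - v)).
  by rewrite expRD; ring.
apply: le_trans (ler_normD _ _) _; apply: lerD.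
  exact: le_trans (cos_lipschitz _ _) Xt.
rewrite normrM; apply: (@le_trans _ _ `|1 - expR (L - v)|).
  by rewrite ler_piMl// cos_max.
have [Lb1 Lb2] := andP Lb.
apply: (@le_trans _ _ (expR (2^-1 * q) * `|L - v|)).
  apply: expR_approx1; first by rewrite -[leLHS]expR0 ler_expR mulr_ge0.
  by rewrite ler_expR; lra.
apply: ler_wpM2l; first exact: expR_ge0.
have : `|L - 2^-1 * q| <= 2^-1 * f by rewrite ler_norml; lra.
by have := ler_normD (L - 2^-1 * q) (2^-1 * q - v); rewrite addrA subrK; lra.
Qed.

End products_and_cosines.

Section mean_cosine.
Context {R : realType}.
Variable b : nat -> R.

Let m2 N : R := N%:R^-1 * \sum_(j < N) b j ^+ 2.
Let m4 N : R := N%:R ^- 2 * \sum_(j < N) b j ^+ 4.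

Let m2_ge0 N : 0 <= m2 N.
Proof. by rewrite mulr_ge0 ?invr_ge0// sumr_ge0// => j _; exact: sqr_ge0. Qed.

Let fourth_ge0 (t : R) : 0 <= t ^+ 4.
Proof. by rewrite -[4%N]/(2 * 2)%N exprM sqr_ge0. Qed.

Let m4_ge0 N : 0 <= m4 N.
Proof. by rewrite mulr_ge0 ?invr_ge0 ?sqr_ge0// sumr_ge0. Qed.

(** Cauchy-Schwarz for |b|^3 = |b| b^2, so that the cubic error is controlled by [m2], which stays
    bounded, and [m4], which tends to 0. *)
Let third_le N : (0 < N)%N ->
  (Num.sqrt N%:R)^-1 ^+ 3 * \sum_(j < N) `|b j| ^+ 3 <= Num.sqrt (m2 N) * Num.sqrt (m4 N).
Proof.
move=> N0; have Np : (0 : R) < N%:R by rewrite ltr0n.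
apply: le_mul_of_amgm => [||t t0]; rewrite ?sqrtr_ge0//.
rewrite !sqr_sqrtr// /m2 /m4; set r := Num.sqrt N%:R.
have r2 : r ^+ 2 = N%:R by rewrite sqr_sqrtr// ltW.
have r0 : 0 < r by rewrite sqrtr_gt0.
rewrite -r2.
apply: (@le_trans _ _ (\sum_(j < N) (t / 2 * r ^- 2 * b j ^+ 2 + r ^- 4 / t / 2 * b j ^+ 4))); last first.
  rewrite le_eqVlt; apply/orP; left; apply/eqP.
  by rewrite big_split /= -!mulr_sumr; field; rewrite !gt_eqF.
rewrite mulr_sumr; apply: ler_sum => j _; rewrite -subr_ge0.
set y := `|b j|; have y0 : 0 <= y by rewrite normr_ge0.
have -> : b j ^+ 2 = y ^+ 2 by rewrite /y real_normK// num_real.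
have -> : b j ^+ 4 = y ^+ 4.
  by rewrite -[4%N]/(2 * 2)%N !exprM /y real_normK// num_real.
rewrite (_ : _ - _ = (y / r - y ^+ 2 / (r ^+ 2 * t)) ^+ 2 * (t / 2)); last first.
  by field; rewrite !gt_eqF.
by rewrite mulr_ge0 ?sqr_ge0// divr_ge0// ltW.
Qed.

(** The oscillating part of the sum of the squares (t_j b_j)^2, at frequency 2k. It need not be
    small for each k: at k = 0 it equals p times [m2 N]. Only its mean over k is controlled. *)
Let R_ N (p q : R) k : R := N%:R^-1 * \sum_(j < N) b j ^+ 2 *
  (p * cos (ang N (2 * (k * (j + 1)))) + q * sin (ang N (2 * (k * (j + 1))))).

Let mean_R_le N p q : (0 < N)%N ->
  N%:R^-1 * \sum_(k < N) `|R_ N p q k| <= Num.sqrt (2 * (p ^+ 2 + q ^+ 2) * m4 N).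
Proof.
move=> N0; have Np : (0 : R) < N%:R by rewrite ltr0n.
rewrite -[leRHS]mulr1; apply: le_mul_of_amgm; [exact: sqrtr_ge0|by []|move=> t t0].
have pq0 : 0 <= p ^+ 2 + q ^+ 2 by rewrite addr_ge0 ?sqr_ge0.
rewrite sqr_sqrtr; last by apply: mulr_ge0 (m4_ge0 N); exact: mulr_ge0.
have h := sum_double_frequency_le p q N0 (fun j => sqr_ge0 (b j)).
have SR : N%:R^-1 * \sum_(k < N) R_ N p q k ^+ 2 <= 2 * (p ^+ 2 + q ^+ 2) * m4 N.
  under eq_bigr do rewrite exprMn.
  rewrite -mulr_sumr mulrA.
  apply: le_trans (ler_wpM2l _ h) _; first by rewrite mulr_ge0 ?exprn_ge0 ?invr_ge0 ?ltW.
  rewrite le_eqVlt; apply/orP; left; apply/eqP; rewrite /m4.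
  under eq_bigr do rewrite -exprM.
  by field; rewrite gt_eqF.
apply: (@le_trans _ _ (N%:R^-1 * \sum_(k < N) (t * R_ N p q k ^+ 2 + 1 / t) / 2)).
  apply: ler_wpM2l; first by rewrite invr_ge0 ltW.
  apply: ler_sum => k _; set y := R_ _ _ _ _.
  rewrite -(real_normK (num_real y)) -subr_ge0.
  rewrite (_ : _ - _ = (t * `|y| - 1) ^+ 2 / (2 * t)); last by field; rewrite gt_eqF.
  by rewrite divr_ge0 ?sqr_ge0// mulr_ge0// ltW.
rewrite -mulr_suml big_split /= -mulr_sumr sumr_const card_ord -[(1 / t) *+ N]mulr_natr.
have -> : N%:R^-1 * ((t * \sum_(k < N) R_ N p q k ^+ 2 + 1 / t * N%:R) / 2) =
  (t * (N%:R^-1 * \sum_(k < N) R_ N p q k ^+ 2) + 1 / t) / 2.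
  by field; rewrite !gt_eqF.
rewrite expr1n ler_pM2r// lerD2r ler_pM2l//.
Qed.

Let trig_coef_sqr N (a c : R) k j : trig_coef N a c k j ^+ 2 = (a ^+ 2 + c ^+ 2) / 2 +
  ((a ^+ 2 - c ^+ 2) / 2 * cos (ang N (2 * (k * (j + 1)))) +
   a * c * sin (ang N (2 * (k * (j + 1))))).
Proof.
rewrite mul2n -addnn angD cosD sinD /trig_coef.
set C := cos _; set S := sin _.
have : C ^+ 2 + S ^+ 2 = 1 by exact: cos2Dsin2.
move=> h; transitivity ((a ^+ 2 + c ^+ 2) / 2 * (C ^+ 2 + S ^+ 2) +
  ((a ^+ 2 - c ^+ 2) / 2 * (C * C - S * S) + a * c * (S * C + C * S))); first by field.
by rewrite h mulr1.
Qed.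

(** All the errors gathered as a continuous function of two empirical moments, vanishing at u4 = 0,
    u2 = 1. *)
Let bound (a c u4 u2 : R) : R :=
  let s := `|a| + `|c| in let p := (a ^+ 2 - c ^+ 2) / 2 in let q := a * c in
  s ^+ 3 * (Num.sqrt u2 * Num.sqrt u4) +
  expR (2^-1 * (s ^+ 2 * u2)) * (2^-1 * (s ^+ 4 * u4) + (a ^+ 2 + c ^+ 2) / 4 * `|u2 - 1| +
    2^-1 * Num.sqrt (2 * (p ^+ 2 + q ^+ 2) * u4)).

Let mean_cos_error N (a c : R) : (0 < N)%N ->
  `|N%:R^-1 * \sum_(k < N) cos (a * (fourier_cos N b k / Num.sqrt N%:R) +
                                c * (fourier_sin N b k / Num.sqrt N%:R))
    - expR (- ((a ^+ 2 + c ^+ 2) / 4))| <=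
  bound a c (m4 N) (m2 N) + `|N%:R^-1 * \sum_(k < N)
    ((oneDi_prod (fun j => trig_coef N a c k j / Num.sqrt N%:R * b j) N).1 - 1)|.
Proof.
move=> N0; have Np : (0 : R) < N%:R by rewrite ltr0n.
have Ni : 0 <= N%:R^-1 :> R by rewrite invr_ge0 ltW.
set v := (a ^+ 2 + c ^+ 2) / 4; set r := Num.sqrt N%:R.
have v0 : 0 <= v by rewrite divr_ge0// addr_ge0 ?sqr_ge0.
have r2 : r ^+ 2 = N%:R by rewrite sqr_sqrtr// ltW.
have r0 : 0 < r by rewrite sqrtr_gt0.
pose x (k : nat) (j : nat) := trig_coef N a c k j / r * b j.
pose s := `|a| + `|c|; have s0 : 0 <= s by rewrite addr_ge0.
pose p := (a ^+ 2 - c ^+ 2) / 2; pose q := a * c.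
have XE k : a * (fourier_cos N b k / r) + c * (fourier_sin N b k / r) = \sum_(j < N) x k j.
  rewrite /fourier_cos /fourier_sin !mulr_suml !mulr_sumr -big_split.
  by apply: eq_bigr => j _; rewrite /x /trig_coef /=; ring.
have x_le k j : `|x k j| <= s * (`|b j| / r).
  rewrite /x mulrAC -mulrA normrM [X in _ * X <= _]normrM ler_pM// ?mulr_ge0//.
    exact: trig_coef_le.
  by rewrite (ger0_norm (_ : 0 <= r^-1)) ?invr_ge0 ?(ltW r0).
have x_pow k j n : `|x k j| ^+ n <= (s * (`|b j| / r)) ^+ n.
  have sb0 : 0 <= s * (`|b j| / r) by rewrite mulr_ge0// divr_ge0// ltW.
  by apply: lerXn2r; rewrite ?nnegrE//; exact: x_le.
have x3 k : \sum_(j < N) `|x k j| ^+ 3 <= s ^+ 3 * (Num.sqrt (m2 N) * Num.sqrt (m4 N)).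
  apply: (@le_trans _ _ (s ^+ 3 * (r^-1 ^+ 3 * \sum_(j < N) `|b j| ^+ 3))).
    rewrite !mulr_sumr; apply: ler_sum => j _.
    have -> : s ^+ 3 * (r^-1 ^+ 3 * `|b j| ^+ 3) = (s * (`|b j| / r)) ^+ 3 by ring.
    exact: x_pow.
  by apply: ler_wpM2l; [rewrite exprn_ge0|exact: third_le].
have x2E k : \sum_(j < N) x k j ^+ 2 = N%:R^-1 * \sum_(j < N) trig_coef N a c k j ^+ 2 * b j ^+ 2.
  rewrite -r2 mulr_sumr; apply: eq_bigr => j _; rewrite /x; field; by rewrite gt_eqF.
have x2 k : \sum_(j < N) x k j ^+ 2 <= s ^+ 2 * m2 N.
  rewrite x2E /m2 mulrCA ler_wpM2l// mulr_sumr; apply: ler_sum => j _.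
  rewrite ler_wpM2r ?sqr_ge0//.
  by have := trig_coefM_le N a c k k j; rewrite -expr2 ger0_norm// sqr_ge0.
have x4 k : \sum_(j < N) x k j ^+ 4 <= s ^+ 4 * m4 N.
  rewrite /m4 mulrCA !mulr_sumr; apply: ler_sum => j _.
  have -> : N%:R ^- 2 * (s ^+ 4 * b j ^+ 4) = (s * (`|b j| / r)) ^+ 4.
    rewrite -r2 (_ : b j ^+ 4 = `|b j| ^+ 4).
      by field; rewrite gt_eqF.
    by rewrite -normrX ger0_norm.
  rewrite -(ger0_norm (fourth_ge0 (x k j))) normrX.
  exact: x_pow.
have xv k : `|2^-1 * \sum_(j < N) x k j ^+ 2 - v| <= v * `|m2 N - 1| + 2^-1 * `|R_ N p q k|.
  have -> : 2^-1 * \sum_(j < N) x k j ^+ 2 - v = v * (m2 N - 1) + 2^-1 * R_ N p q k.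
    rewrite x2E /R_ /m2.
    rewrite (eq_bigr (fun j : 'I_N => (2 * v) * b j ^+ 2 + b j ^+ 2 *
      (p * cos (ang N (2 * (k * (j + 1)))) + q * sin (ang N (2 * (k * (j + 1))))))) => [|j _].
      by rewrite big_split /= -mulr_sumr; field; rewrite gt_eqF.
    by rewrite trig_coef_sqr /p /q /v; field.
  apply: le_trans (ler_normD _ _) _.
  by rewrite (normrM v) (normrM 2^-1) (ger0_norm v0) (@ger0_norm _ 2^-1).
set E := expR (2^-1 * (s ^+ 2 * m2 N)).
have E0 : 0 <= E by exact: expR_ge0.
have per_k k : `|cos (\sum_(j < N) x k j) - (oneDi_prod (x k) N).1 * expR (- v)| <=
   s ^+ 3 * (Num.sqrt (m2 N) * Num.sqrt (m4 N)) +
   E * (2^-1 * (s ^+ 4 * m4 N) + (v * `|m2 N - 1| + 2^-1 * `|R_ N p q k|)).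
  apply: le_trans (cos_sum_approx _ _ v0) _; apply: lerD; first exact: x3.
  apply: ler_pM; rewrite ?expR_ge0//.
  - by rewrite addr_ge0// mulr_ge0// sumr_ge0.
  - by rewrite ler_expR ler_pM2l.
  - by apply: lerD; [rewrite ler_pM2l|].
pose Tk k := (oneDi_prod (x k) N).1.
(* The first part compares cosines with products for each k; the second is the mean of the products
   minus 1, whose convergence is supplied by the fourth moments. *)
have -> : N%:R^-1 * \sum_(k < N) cos (a * (fourier_cos N b k / r) + c * (fourier_sin N b k / r)) -
     expR (- v) = N%:R^-1 * \sum_(k < N) (cos (\sum_(j < N) x k j) - Tk k * expR (- v)) +
     expR (- v) * (N%:R^-1 * \sum_(k < N) (Tk k - 1)).
  under eq_bigr do rewrite XE.
  rewrite !sumrB -mulr_suml sumr_const card_ord; field; by rewrite gt_eqF.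
apply: le_trans (ler_normD _ _) _; apply: lerD; last first.
  rewrite normrM ler_piMl// ger0_norm ?expR_ge0//.
  by rewrite -[leRHS]expR0 ler_expR oppr_le0.
rewrite normrM (ger0_norm Ni).
apply: (@le_trans _ _ (N%:R^-1 * \sum_(k < N) (s ^+ 3 * (Num.sqrt (m2 N) * Num.sqrt (m4 N)) +
   E * (2^-1 * (s ^+ 4 * m4 N) + (v * `|m2 N - 1| + 2^-1 * `|R_ N p q k|))))).
  apply: ler_wpM2l => //; apply: le_trans (ler_norm_sum _ _ _) _.
  by apply: ler_sum => k _; exact: per_k.
have h := mean_R_le p q N0.
rewrite /bound -/s -/p -/q -/v -/E big_split /= sumr_const card_ord -mulr_sumr !big_split /=.
rewrite !sumr_const card_ord -mulr_sumr.
set A := s ^+ 3 * _; set B := 2^-1 * (s ^+ 4 * _); set C := v * _; set D := \sum_(k < N) `|_|.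
rewrite -[A *+ N]mulr_natr -[B *+ N]mulr_natr -[C *+ N]mulr_natr.
have -> : N%:R^-1 * (A * N%:R + E * (B * N%:R + (C * N%:R + 2^-1 * D))) =
  A + E * (B + C + 2^-1 * (N%:R^-1 * D)) by field; rewrite gt_eqF.
by rewrite lerD2l ler_wpM2l// lerD2l ler_pM2l.
Qed.

Hypothesis cvg_m2 : m2 N @[N --> \oo] --> (1 : R).
Hypothesis cvg_m4 : m4 N @[N --> \oo] --> (0 : R).

Lemma mean_cos_cvg (a c : R) :
  N%:R^-1 * \sum_(k < N)
    ((oneDi_prod (fun j => trig_coef N a c k j / Num.sqrt N%:R * b j) N).1 - 1)
    @[N --> \oo] --> (0 : R) ->
  N%:R^-1 * \sum_(k < N) cos (a * (fourier_cos N b k / Num.sqrt N%:R) +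
                              c * (fourier_sin N b k / Num.sqrt N%:R))
    @[N --> \oo] --> expR (- ((a ^+ 2 + c ^+ 2) / 4)).
Proof.
move=> cvgT.
have cvgB : bound a c (m4 N) (m2 N) @[N --> \oo] --> bound a c 0 1.
  rewrite /bound; apply: cvgD.
    apply: cvgMr; apply: cvgM.
      exact: (continuous_cvg _ (@sqrt_continuous R 1) cvg_m2).
    exact: (continuous_cvg _ (@sqrt_continuous R 0) cvg_m4).
  apply: cvgM.
    apply: (continuous_cvg _ (@continuous_expR R _)).
    by apply: cvgMr; apply: cvgMr.
  apply: cvgD; first apply: cvgD.
  - by apply: cvgMr; apply: cvgMr.
  - by apply: cvgMr; apply: cvg_norm; apply: cvgB => //; exact: cvg_cst.
  - apply: cvgMr; apply: (continuous_cvg _ (@sqrt_continuous R _)).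
    by apply: cvgMr.
have b0 : bound a c 0 1 = 0.
  by rewrite /bound !mulr0 subrr normr0 !mulr0 !sqrtr0 !mulr0 !addr0 mulr0 addr0.
rewrite b0 in cvgB.
set T := fun N : nat => _ in cvgT.
have cvgBT : bound a c (m4 N) (m2 N) + `|T N| @[N --> \oo] --> (0 : R).
  rewrite -[X in _ --> X](addr0 0); apply: cvgD => //.
  by rewrite -(normr0 R); exact: cvg_norm.
apply/cvgrPdist_lt => e e0; near=> N.
rewrite distrC; apply: (le_lt_trans (mean_cos_error _ _ _)).
  by near: N; exact: nbhs_infty_gt.
have : `|0 - (bound a c (m4 N) (m2 N) + `|T N|)| < e.
  by near: N; move/cvgrPdist_lt : cvgBT; exact.
by rewrite sub0r normrN; apply: le_lt_trans; exact: ler_norm.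
Unshelve. all: by end_near. Qed.

End mean_cosine.

(** * From rational to real frequencies *)

Section density_argument.
Context {R : realType}.

(** The Lipschitz constant depends on N, but being convergent it is eventually below |l| + 1. A
    single rational close to [s], for both this constant and the modulus of continuity of [F],
    therefore serves all large N. *)
Lemma cvg_of_rational (f : R -> nat -> R) (F : R -> R) (K : nat -> R) (l : R) :
  continuous F -> K N @[N --> \oo] --> l ->
  (forall s t N, (0 < N)%N -> `|f s N - f t N| <= `|s - t| * K N) ->
  (forall q : rat, f (ratr q) N @[N --> \oo] --> F (ratr q)) ->
  forall s, f s N @[N --> \oo] --> F s.
Proof.
move=> cF cK fK fq s; apply/cvgrPdist_lt => e e0.
have e4 : 0 < e / 4 by rewrite divr_gt0.
pose M := `|l| + 1; have M0 : 0 < M by rewrite ltr_wpDl.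
have /cvgrPdist_lt /(_ _ e4) := cF s; rewrite nearE /= => -[d /= d0 Hd].
have ss : s < s + Num.min d (e / (4 * M)) by rewrite ltrDl lt_min d0 divr_gt0// mulr_gt0.
have [q] := rat_in_itvoo ss.
rewrite in_itv/= => /andP[sq qs].
have qd : ratr q - s < d.
  by rewrite ltrBlDl (lt_le_trans qs)// lerD2l ge_min lexx.
have qe : (ratr q - s) * M <= e / 4.
  have : ratr q - s <= e / (4 * M) by rewrite lerBlDl (le_trans (ltW qs))// lerD2l ge_min lexx orbT.
  move=> h; have := ler_wpM2r (ltW M0) h.
  by rewrite (_ : e / (4 * M) * M = e / 4)//; field; rewrite gt_eqF.
have Fq : `|F s - F (ratr q)| < e / 4.
  by apply: Hd; rewrite /= distrC gtr0_norm// subr_gt0.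
near=> N.
have N0 : (0 < N)%N by near: N; exact: nbhs_infty_gt.
have KM : K N <= M.
  have : `|l - K N| < 1 by near: N; move/cvgrPdist_lt : cK; exact.
  by rewrite ltr_norml /M => /andP[h _]; have := ler_norm l; lra.
have h1 : `|F (ratr q) - f (ratr q) N| < e / 4.
  by near: N; have /cvgrPdist_lt := fq q; exact.
have h2 : `|f (ratr q) N - f s N| <= e / 4.
  apply: (le_trans (fK _ _ _ N0)); rewrite gtr0_norm ?subr_gt0//.
  apply: le_trans qe; rewrite ler_wpM2l// subr_ge0 ltW//.
have -> : F s - f s N = (F s - F (ratr q)) + (F (ratr q) - f (ratr q) N) + (f (ratr q) N - f s N).
  by ring.
apply: (le_lt_trans (ler_normD _ _)).
have := ler_normD (F s - F (ratr q)) (F (ratr q) - f (ratr q) N); lra.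
Unshelve. all: by end_near. Qed.

(** Since |t| <= 1 + t^2, Parseval's identity bounds the Lipschitz constant in (a, c) by 1 + [m2 N],
    which converges. The two arguments are made real one after the other. *)
Lemma mean_cos_cvg_real (b : nat -> R) :
  N%:R^-1 * \sum_(j < N) b j ^+ 2 @[N --> \oo] --> (1 : R) ->
  let u a c N := N%:R^-1 * \sum_(k < N) cos (a * (fourier_cos N b k / Num.sqrt N%:R) +
                                             c * (fourier_sin N b k / Num.sqrt N%:R)) in
  (forall p q : rat, u (ratr p) (ratr q) N @[N --> \oo] -->
     expR (- ((ratr p ^+ 2 + ratr q ^+ 2) / 4))) ->
  forall a c, u a c N @[N --> \oo] --> expR (- ((a ^+ 2 + c ^+ 2) / 4)).
Proof.
move=> cvg_m2 u urat; set m2 := fun N : nat => _ in cvg_m2.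
have lip a c a' c' N : (0 < N)%N ->
    `|u a c N - u a' c' N| <= (`|a - a'| + `|c - c'|) * (1 + m2 N).
  move=> N0; have Np : (0 : R) < N%:R by rewrite ltr0n.
  have Ni : (0 : R) <= N%:R^-1 by rewrite invr_ge0 ltW.
  rewrite /u -mulrBr -sumrB normrM (ger0_norm Ni).
  pose x k := fourier_cos N b k / Num.sqrt N%:R; pose y k := fourier_sin N b k / Num.sqrt N%:R.
  apply: (@le_trans _ _ (N%:R^-1 * \sum_(k < N) (`|a - a'| + `|c - c'|) * (1 + (x k ^+ 2 + y k ^+ 2)))).
    apply: ler_wpM2l; first by rewrite invr_ge0 ltW.
    apply: le_trans (ler_norm_sum _ _ _) _; apply: ler_sum => k _.
    apply: le_trans (cos_lipschitz _ _) _.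
    rewrite -/(x k) -/(y k).
    have -> : a * x k + c * y k - (a' * x k + c' * y k) = (a - a') * x k + (c - c') * y k by ring.
    apply: le_trans (ler_normD _ _) _; rewrite (normrM (a - a')) (normrM (c - c')) mulrDl.
    have le1 (t : R) : `|t| <= 1 + t ^+ 2.
      by rewrite -(real_normK (num_real t)); have := sqr_ge0 (`|t| - 1); have := normr_ge0 t; nra.
    have x0 := sqr_ge0 (x k); have y0 := sqr_ge0 (y k).
    apply: lerD; apply: ler_wpM2l => //.
      by apply: le_trans (le1 _) _; lra.
    by apply: le_trans (le1 _) _; lra.
  rewrite -mulr_sumr big_split /= sumr_const card_ord mulrCA ler_wpM2l ?addr_ge0//.
  have -> : \sum_(k < N) (x k ^+ 2 + y k ^+ 2) = N%:R^-1 * (N%:R * \sum_(j < N) b j ^+ 2).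
    rewrite -parseval// mulr_sumr; apply: eq_bigr => k _.
    by rewrite /x /y !exprMn exprVn sqr_sqrtr ?ltW//; ring.
  by rewrite /m2 mulrDr mulKf ?gt_eqF// mulVf ?gt_eqF.
have cont (c : R) : continuous (fun a : R => expR (- ((a ^+ 2 + c ^+ 2) / 4))).
  move=> a; apply: (continuous_cvg _ (@continuous_expR R _)).
  apply: cvgN; apply: cvgM; last exact: cvg_cst.
  by apply: cvgD; [exact: exprn_continuous|exact: cvg_cst].
have cvgK : 1 + m2 N @[N --> \oo] --> (1 + 1 : R) by apply: cvgD => //; exact: cvg_cst.
have step1 a (q : rat) : u a (ratr q) N @[N --> \oo] --> expR (- ((a ^+ 2 + ratr q ^+ 2) / 4)).
  apply: (@cvg_of_rational (fun a => u a (ratr q)) (fun a => expR (- ((a ^+ 2 + ratr q ^+ 2) / 4))) _ _ (cont _) cvgK).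
    by move=> s t N N0; have := lip s (ratr q) t (ratr q) N N0; rewrite subrr normr0 addr0.
  by move=> p; exact: urat.
move=> a c.
apply: (@cvg_of_rational (fun c => u a c) (fun c => expR (- ((a ^+ 2 + c ^+ 2) / 4))) _ _ _ cvgK).
- by move=> t; under eq_fun do rewrite addrC; exact: cont.
- by move=> s t N N0; have := lip a s a t N N0; rewrite subrr normr0 add0r.
- by move=> q; exact: step1.
Qed.

End density_argument.

(** * Averaging against Gaussian weights *)

Section gaussian_characteristic_function.
Context {R : realType}.
Local Notation mu := (@lebesgue_measure R).

Lemma integral_derivative_eq0 (h H : R -> R) :
  mu.-integrable setT (EFin \o h) -> continuous h -> (forall t : R, is_derive t 1 H (h t)) ->
  H n%:R @[n --> \oo] --> (0 : R) -> H (- n%:R) @[n --> \oo] --> (0 : R) ->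
  (\int[mu]_t (h t)%:E = 0)%E.
Proof.
move=> ih ch Hh H1 H2.
(* The radius [n.+1] keeps the interval nondegenerate for the fundamental theorem of calculus. *)
pose I (n : nat) : set R := `[- n.+1%:R, n.+1%:R]%classic.
pose f (n : nat) := (EFin \o h) \_ (I n).
have mh : measurable_fun setT (EFin \o h) by exact: (measurable_int mu).
have fE n : (\int[mu]_t f n t = (H n.+1%:R - H (- n.+1%:R))%:E)%E.
  rewrite -integral_mkcond (@continuous_FTC2 R h H) ?EFinB//.
  - by apply: (@lt_trans _ _ 0); rewrite ?oppr_lt0 ltr0n.
  - by apply: continuous_subspaceT.
  - have cH x : {for x, continuous H}.
      by apply/differentiable_continuous/derivable1_diffP; exact: ex_derive.
    split.
    + by move=> x _; exact: ex_derive.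
    + by apply: cvg_at_right_filter; exact: cH.
    + by apply: cvg_at_left_filter; exact: cH.
  - by move=> x _; rewrite derive1E derive_val.
have fcvg : (fun n => \int[mu]_t f n t)%E @ \oo --> (0%:E : \bar R).
  under eq_fun do rewrite fE.
  apply: cvg_EFin; first exact: nearW.
  rewrite -[X in _ --> X](subrr 0); apply: cvgB.
    by rewrite (cvg_shiftS (fun n => H n%:R)).
  by rewrite (cvg_shiftS (fun n => H (- n%:R))).
have mf n : measurable_fun setT (f n).
  apply/(measurable_restrictT _ _).1 => //; first exact: measurable_itv.
  exact: measurable_funTS.
have ff : {ae mu, forall x, setT x -> f ^~ x @ \oo --> (EFin \o h) x}.
  apply: aeW => x _; apply: cvg_near_cst; near=> n.
  rewrite /f patchE ifT// inE /I /= in_itv/= -ler_norml.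
  near: n; exists (Num.bound `|x|) => // n /= bn.
  by apply: (le_trans (ltW (archi_boundP (normr_ge0 x)))); rewrite ler_nat leqW.
have fg : {ae mu, forall x n, setT x -> (`|f n x| <= (abse \o (EFin \o h)) x)%E}.
  apply: aeW => x n _; rewrite /f patchE; case: ifP => // _.
  by rewrite abse0 abse_ge0.
have [_ _ dc] := @dominated_convergence _ (measurableTypeR R) R mu setT measurableT
  f (EFin \o h) _ mf mh ff (integrable_abse ih) fg.
exact: (cvg_unique _ dc fcvg).
Unshelve. all: by end_near. Qed.

Lemma integrable_abs_gauss : mu.-integrable setT (fun t => (`|t| * gauss_fun t)%:E).
Proof.
apply/integrableP; split.
  by apply/measurable_EFinP; exact: measurable_symmetrized_rayleigh_pdf.
under eq_integral => t _ do rewrite gee0_abs ?lee_fin ?symmetrized_rayleigh_pdf_ge0//.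
by rewrite integral_symmetrized_rayleigh_pdf ltry.
Qed.

Let is_derive_gauss (t : R) : is_derive t 1 (gauss_fun : R -> R) (gauss_fun t * - (2 * t)).
Proof.
have d1 : is_derive t 1 (fun y : R => - y ^+ 2) (- (2 * t)).
  apply: is_derive_eq; congr (- _).
  by rewrite /GRing.scale/= mulr1 mulr_natl.
exact: is_derive1_comp.
Qed.

Let integrable_trig_gauss (s : R -> R) y : continuous s -> (forall t, `|s t| <= 1) ->
  mu.-integrable setT (fun t => (s (y * t) * gauss_fun t)%:E).
Proof.
move=> cs s1.
have mt : measurable_fun setT (fun t : R => s (y * t)).
  apply: (measurableT_comp (f := s)); first exact: continuous_measurable_fun.
  exact: measurable_funM.
apply: (le_integrable measurableT _ _ integrableT_gauss).
  apply/measurable_EFinP/measurable_funM => //; exact: measurable_gauss_fun.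
move=> t _ /=; rewrite lee_fin normrM [leRHS]ger0_norm ?gauss_fun_ge0//.
by rewrite (ger0_norm (gauss_fun_ge0 _)) ler_piMl// gauss_fun_ge0.
Qed.

Let integrable_id_sin_gauss y : mu.-integrable setT (fun t => (t * sin (y * t) * gauss_fun t)%:E).
Proof.
apply: (le_integrable measurableT _ _ integrable_abs_gauss).
  apply/measurable_EFinP/measurable_funM; last exact: measurable_gauss_fun.
  apply: measurable_funM => //.
  apply: (measurableT_comp (f := @sin R)); last exact: measurable_funM.
  apply: continuous_measurable_fun; exact: continuous_sin.
move=> t _ /=; rewrite lee_fin !normrM normr_id ler_wpM2r// ler_piMr//.
exact: sin_max.
Qed.

Let Phi y := \int[mu]_t (cos (y * t) * gauss_fun t).

(** The difference of the integrands is the derivative of sin (y t) exp (- t^2) / 2, which vanishes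
    at both ends. *)
Let by_parts y : \int[mu]_t (t * sin (y * t) * gauss_fun t) = y / 2 * Phi y.
Proof.
pose H t := 2^-1 * (sin (y * t) * gauss_fun t).
pose h t := y / 2 * (cos (y * t) * gauss_fun t) - t * sin (y * t) * gauss_fun t.
have icos := integrable_trig_gauss y (@continuous_cos R) (@cos_max R).
have icos' : mu.-integrable setT (fun t => (y / 2 * (cos (y * t) * gauss_fun t))%:E).
  by have := integrableZl measurableT (y / 2) icos.
have ih : mu.-integrable setT (EFin \o h).
  have := integrableB measurableT icos' (integrable_id_sin_gauss y).
  by apply: eq_integrable.
have cM : continuous (fun t : R => y * t).
  by move=> t; apply: cvgM; [exact: cvg_cst|exact: cvg_id].
have ccos : continuous (fun t : R => cos (y * t)).
  by move=> t; apply: (continuous_cvg _ (@continuous_cos R _)); exact: cM.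
have csin : continuous (fun t : R => sin (y * t)).
  by move=> t; apply: (continuous_cvg _ (@continuous_sin R _)); exact: cM.
have ch : continuous h.
  move=> t; apply: cvgB.
    apply: cvgM; first exact: cvg_cst.
    by apply: cvgM; [exact: ccos|exact: continuous_gauss_fun].
  apply: cvgM; last exact: continuous_gauss_fun.
  by apply: cvgM; [exact: cvg_id|exact: csin].
have dH (t : R) : is_derive t 1 H (h t).
  have d1 : is_derive t 1 (fun u : R => y * u) y.
    by apply: is_derive_eq; rewrite /GRing.scale/= mulr1.
  have d2 : is_derive t 1 (fun u : R => sin (y * u)) (cos (y * t) * y) by exact: is_derive1_comp.
  have d3 := is_deriveM d2 (is_derive_gauss t).
  by apply: is_derive_eq; rewrite /h /GRing.scale/=; field.
have H0 (u : nat -> R) : gauss_fun (u n) @[n --> \oo] --> (0 : R) -> H (u n) @[n --> \oo] --> (0 : R).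
  move=> gu; apply: (@squeeze_cvgr _ _ _ _ (fun n => - gauss_fun (u n)) (fun n => gauss_fun (u n))) => //.
    apply: nearW => n; rewrite -ler_norml /H !normrM (ger0_norm (gauss_fun_ge0 _)) mulrA.
    rewrite ler_piMl ?gauss_fun_ge0// (@ger0_norm _ 2^-1)//.
    by have := sin_max (y * u n); lra.
  by rewrite -oppr0; exact: cvgN.
have g0 : gauss_fun (n%:R : R) @[n --> \oo] --> (0 : R).
  by apply: (cvg_comp (fun n : nat => n%:R) gauss_fun); [exact: cvgr_idn|exact: cvg_gauss_fun].
have := integral_derivative_eq0 ih ch dH (H0 _ g0).
have g0' : gauss_fun (- n%:R : R) @[n --> \oo] --> (0 : R).
  by under eq_fun do rewrite /gauss_fun sqrrN; exact: g0.
move=> /(_ (H0 _ g0')) /(congr1 fine) /= /eqP.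
rewrite [X in X == _](_ : _ = y / 2 * Phi y - \int[mu]_t (t * sin (y * t) * gauss_fun t)).
  by rewrite subr_eq0 => /eqP ->.
transitivity (\int[mu]_t h t); first by [].
rewrite /h (@RintegralB _ _ _ mu setT _ _ measurableT icos' (integrable_id_sin_gauss y)).
congr (_ - _).
by rewrite -[RHS](@RintegralZl _ _ _ mu setT (fun t => cos (y * t) * gauss_fun t)).
Qed.

(** Differentiation under the integral is dominated by |t| exp (- t^2), the Rayleigh density itself;
    integration by parts closes the differential equation. *)
Let derive_Phi (y : R) : is_derive y 1 Phi (- (y / 2) * Phi y).
Proof.
pose f (z t : R) := cos (z * t) * gauss_fun t.
have df (z t : R) : is_derive z 1 (f ^~ t) (- (t * sin (z * t) * gauss_fun t)).
  have d1 : is_derive z 1 (fun u : R => u * t) t.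
    by apply: is_derive_eq; rewrite /GRing.scale/= mulr0 add0r mulr1.
  have d2 : is_derive z 1 (fun u : R => cos (u * t)) (- sin (z * t) * t) by exact: is_derive1_comp.
  have d3 : is_derive z 1 (fun u : R => gauss_fun t * cos (u * t)) (gauss_fun t * (- sin (z * t) * t)).
    exact: is_deriveZ.
  rewrite /f (_ : (fun u => _) = (fun u : R => gauss_fun t * cos (u * t))); last first.
    by apply/funext => u; rewrite mulrC.
  by apply: is_derive_eq; ring.
have Iy : `]y - 1, y + 1[%classic y by rewrite /= in_itv/= ltrDl gtrBl ltr01.
have intf z : `]y - 1, y + 1[%classic z -> mu.-integrable setT (EFin \o f z).
  by move=> _; exact: (integrable_trig_gauss z (@continuous_cos R) (@cos_max R)).
have derf z t : `]y - 1, y + 1[%classic z -> setT t -> derivable (f ^~ t) z 1.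
  by move=> _ _; exact: ex_derive.
have d1E z t : partial1of2 f z t = - (t * sin (z * t) * gauss_fun t).
  by rewrite partial1of2E derive_val.
have G0 (t : R) : 0 <= `|t| * gauss_fun t by exact: symmetrized_rayleigh_pdf_ge0.
have Gub z t : `]y - 1, y + 1[%classic z -> setT t -> `|partial1of2 f z t| <= `|t| * gauss_fun t.
  move=> _ _; rewrite d1E normrN !normrM (ger0_norm (gauss_fun_ge0 _)).
  by rewrite ler_wpM2r ?gauss_fun_ge0// ler_piMr// sin_max.
have dP : derivable Phi y 1 by exact: (derivable_under_integral measurableT Iy intf derf G0 integrable_abs_gauss Gub).
apply: (DeriveDef dP); rewrite -derive1E.
have -> := differentiation_under_integral measurableT Iy intf derf G0 integrable_abs_gauss Gub.
transitivity (\int[mu]_t (-1 * (t * sin (y * t) * gauss_fun t))).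
  by apply: eq_Rintegral => t _; rewrite d1E mulN1r.
rewrite [LHS](@RintegralZl _ _ _ mu setT _ (-1) measurableT (integrable_id_sin_gauss y)).
by rewrite by_parts; ring.
Qed.

(** The equation Phi' = - (y / 2) Phi makes Phi (y) exp (y^2 / 4) constant, and its value at 0 is
    the Gaussian integral. *)
Lemma integral_cos_gauss y : \int[mu]_t (cos (y * t) * gauss_fun t) = Num.sqrt pi * expR (- (y ^+ 2 / 4)).
Proof.
pose K (z : R) := Phi z * expR (z ^+ 2 / 4).
have dK (z : R) : is_derive z 1 K 0.
  have d1 : is_derive z 1 (fun u : R => u ^+ 2 / 4) (z / 2).
    rewrite (_ : (fun u : R => _) = (fun u : R => 4^-1 * u ^+ 2)); last first.
      by apply/funext => u; rewrite mulrC.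
    by apply: is_derive_eq; rewrite /GRing.scale/= mulr1; field.
  have d2 : is_derive z 1 (fun u : R => expR (u ^+ 2 / 4)) (expR (z ^+ 2 / 4) * (z / 2)).
    exact: is_derive1_comp.
  have := is_deriveM (derive_Phi z) d2.
  move=> d3; apply: is_derive_eq; rewrite /GRing.scale/=; ring.
have := is_derive_0_is_cst y 0 dK.
rewrite /K expr0n/= mul0r expR0 mulr1.
have -> : Phi 0 = Num.sqrt pi.
  rewrite /Phi; transitivity (\int[mu]_t (gauss_fun t)); last by rewrite /Rintegral integralT_gauss.
  by apply: eq_Rintegral => t _; rewrite mul0r cos0 mul1r.
move=> <-; rewrite -/(Phi y) -mulrA -expRD addrN expR0 mulr1.
by [].
Qed.

End gaussian_characteristic_function.

Section gaussian_averaging.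
Context {R : realType}.
Local Notation mu := (@lebesgue_measure R).

Lemma integral_expR_sqr (s : R) : 0 <= s ->
  \int[mu]_t (expR (- ((1 + s) * t ^+ 2))) = Num.sqrt pi / Num.sqrt (1 + s).
Proof.
move=> s0; have p : 0 < 1 + s by rewrite ltr_pwDl.
(* The standard deviation for which the centred normal density is proportional to the integrand. *)
pose sg := Num.sqrt (2 * (1 + s))^-1.
have sg2 : sg ^+ 2 = (2 * (1 + s))^-1 by rewrite sqr_sqrtr// invr_ge0 mulr_ge0// ltW.
have sg0 : sg != 0 by rewrite gt_eqF// sqrtr_gt0 invr_gt0 mulr_gt0.
have pk : (normal_peak sg)^-1 = Num.sqrt pi / Num.sqrt (1 + s).
  rewrite /normal_peak invrK sg2 -sqrtrV ?ltW// -sqrtrM ?pi_ge0//; congr Num.sqrt.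
  by rewrite -mulr_natr; field; rewrite gt_eqF.
have pk0 := normal_peak_gt0 sg0.
transitivity (\int[mu]_t ((normal_peak sg)^-1 * normal_pdf 0 sg t)).
  apply: eq_Rintegral => t _; rewrite normal_pdfE// /normal_fun mulKf ?gt_eqF//.
  by congr expR; rewrite subr0 sg2 -mulr_natr; field; rewrite gt_eqF.
rewrite [LHS](@RintegralZl _ _ _ mu setT _ _ measurableT (integrable_normal_pdf 0 sg)).
by rewrite /Rintegral integral_normal_pdf mulr1.
Qed.

Lemma integrable_expR_sqr (s : R) : 0 <= s ->
  mu.-integrable setT (EFin \o (fun t : R => expR (- ((1 + s) * t ^+ 2)))).
Proof.
move=> s0; apply: (le_integrable measurableT _ _ integrableT_gauss).
  apply/measurable_EFinP; apply: (measurableT_comp (f := @expR R)) => //.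
  by apply: measurableT_comp => //; exact: measurable_funM.
move=> t _ /=; rewrite lee_fin !ger0_norm ?expR_ge0 ?gauss_fun_ge0// ler_expR lerN2.
by rewrite ler_peMl ?sqr_ge0// lerDl.
Qed.

(** With a = 2 sqrt s, exp (- s y^2) is the mean of cos (a t y) under the normalized weight exp (-
    t^2). As the weights [w] are bounded by 1, dominated convergence exchanges limit and integral.
    The weights let the lemma be applied to one coordinate while the other is carried along. *)
Lemma gaussian_average (w y : nat -> nat -> R) (c s : R) : 0 <= s ->
  (forall N k, `|w N k| <= 1) ->
  (forall t, N%:R^-1 * \sum_(k < N) w N k * cos (t * y N k) @[N --> \oo] -->
     c * expR (- (t ^+ 2 / 4))) ->
  N%:R^-1 * \sum_(k < N) w N k * expR (- (s * y N k ^+ 2)) @[N --> \oo] --> c / Num.sqrt (1 + s).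
Proof.
move=> s0 w1 cvgw; pose a := 2 * Num.sqrt s.
have a2 : a ^+ 2 = 4 * s by rewrite /a exprMn sqr_sqrtr//; ring.
have spi : Num.sqrt pi != 0 :> R by rewrite gt_eqF// sqrtr_gt0 pi_gt0.
have icos (z : R) : mu.-integrable setT (EFin \o (fun t : R => cos (z * t) * gauss_fun t)).
  apply: (le_integrable measurableT _ _ integrableT_gauss).
    apply/measurable_EFinP/measurable_funM; last exact: measurable_gauss_fun.
    apply: (measurableT_comp (f := @cos R)); last exact: measurable_funM.
    by apply: continuous_measurable_fun; exact: continuous_cos.
  move=> t _ /=; rewrite lee_fin normrM ler_piMl//; exact: cos_max.
pose F N (t : R) := N%:R^-1 * \sum_(k < N) w N k * (cos (a * y N k * t) * gauss_fun t).
have FE N t : F N t = N%:R^-1 * (\sum_(k < N) w N k * cos (a * t * y N k)) * gauss_fun t.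
  rewrite /F -mulrA mulr_suml; congr (_ * _); apply: eq_bigr => k _.
  by rewrite mulrA; congr (_ * cos _ * _); ring.
have iwk N k : mu.-integrable setT (EFin \o (fun t : R => w N k * (cos (a * y N k * t) * gauss_fun t))).
  by have := integrableZl measurableT (w N k) (icos (a * y N k)); apply: eq_integrable.
have isum N : mu.-integrable setT (EFin \o (fun t : R => \sum_(k < N) w N k * (cos (a * y N k * t) * gauss_fun t))).
  by apply: integrable_sum_seq => k; exact: iwk.
have iF N : mu.-integrable setT (EFin \o F N).
  by have := integrableZl measurableT (N%:R^-1) (isum N); apply: eq_integrable.
have intF N : \int[mu]_t F N t =
    Num.sqrt pi * (N%:R^-1 * \sum_(k < N) w N k * expR (- (s * y N k ^+ 2))).
  rewrite [LHS](@RintegralZl _ _ _ mu setT _ _ measurableT (isum N)) mulrCA; congr (_ * _).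
  rewrite Rintegral_sum_seq; last by move=> k; exact: iwk.
  rewrite mulr_sumr; apply: eq_bigr => k _.
  rewrite [LHS](@RintegralZl _ _ _ mu setT _ _ measurableT (icos (a * y N k))).
  rewrite integral_cos_gauss mulrCA; congr (_ * (_ * expR _)).
  by rewrite exprMn a2; field.
pose G (t : R) := c * expR (- ((1 + s) * t ^+ 2)).
have cvgF t : F N t @[N --> \oo] --> G t.
  under eq_fun do rewrite FE.
  have -> : G t = c * expR (- ((a * t) ^+ 2 / 4)) * gauss_fun t.
    rewrite /G /gauss_fun -mulrA -expRD; congr (_ * expR _).
    by rewrite exprMn a2; field.
  by apply: cvgM; [exact: cvgw|exact: cvg_cst].
have F_le N t : `|F N t| <= gauss_fun t.
  rewrite FE normrM (ger0_norm (gauss_fun_ge0 t)) ler_piMl ?gauss_fun_ge0//.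
  case: N => [|N]; first by rewrite big_ord0 mulr0 normr0.
  rewrite normrM ger0_norm ?invr_ge0// ler_pdivrMl ?ltr0n// mulr1.
  apply: le_trans (ler_norm_sum _ _ _) _.
  apply: (@le_trans _ _ (\sum_(k < N.+1) 1)); last by rewrite sumr_const card_ord.
  apply: ler_sum => k _; rewrite normrM -[leRHS]mulr1 ler_pM// cos_max.
  by [].
have cvgFE t : (EFin \o F N) t @[N --> \oo] --> (EFin \o G) t.
  by apply: cvg_EFin; [exact: nearW|exact: cvgF].
have mF N : measurable_fun setT (EFin \o F N) by exact: (measurable_int mu (iF N)).
have mG : measurable_fun setT (EFin \o G).
  by apply: (emeasurable_fun_cvg (fun N => EFin \o F N)) => // t _; exact: cvgFE.
have F_leE : {ae mu, forall t N, setT t -> (`|(EFin \o F N) t| <= (EFin \o gauss_fun) t)%E}.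
  by apply: aeW => t N _; rewrite lee_fin.
have ffE : {ae mu, forall t, setT t -> (EFin \o F N) t @[N --> \oo] --> (EFin \o G) t}.
  by apply: aeW => t _; exact: cvgFE.
have [iG _ dc] := @dominated_convergence _ (measurableTypeR R) R mu setT measurableT
  (fun N => EFin \o F N) (EFin \o G) (EFin \o gauss_fun) mF mG ffE integrableT_gauss F_leE.
have intG : \int[mu]_t G t = c * (Num.sqrt pi / Num.sqrt (1 + s)).
  rewrite -integral_expR_sqr// -[RHS](@RintegralZl _ _ _ mu setT)//.
  exact: integrable_expR_sqr.
have dc' : (\int[mu]_t F N t) @[N --> \oo] --> \int[mu]_t G t.
  by apply: fine_cvg; rewrite fineK//; exact: integrable_fin_num.
rewrite (_ : c / Num.sqrt (1 + s) = (Num.sqrt pi)^-1 * \int[mu]_t G t); last first.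
  have sp1 : Num.sqrt (1 + s) != 0 by rewrite gt_eqF// sqrtr_gt0 ltr_pwDl.
  by rewrite intG; field; rewrite ?spi ?sp1.
rewrite [X in X @ _ --> _](_ : _ = fun N => (Num.sqrt pi)^-1 * \int[mu]_t F N t); last first.
  by apply/funext => N; rewrite intF mulKf.
by apply: cvgM => //; exact: cvg_cst.
Qed.

(** The frequencies (a, c) and (a, - c) combine into products of cosines, which can be averaged over
    c and then over a. Each averaging contributes a factor 1 / sqrt (1 + s). *)
Lemma mean_expR_sqr_cvg (x y : nat -> nat -> R) :
  (forall a c : R, N%:R^-1 * \sum_(k < N) cos (a * x N k + c * y N k) @[N --> \oo] -->
     expR (- ((a ^+ 2 + c ^+ 2) / 4))) ->
  forall s : R, 0 <= s ->
  N%:R^-1 * \sum_(k < N) expR (- (s * (x N k ^+ 2 + y N k ^+ 2))) @[N --> \oo] -->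
    (1 + s)^-1.
Proof.
move=> H s s0.
have cos_cos a c : N%:R^-1 * \sum_(k < N) cos (a * x N k) * cos (c * y N k) @[N --> \oo] -->
    expR (- (a ^+ 2 / 4)) * expR (- (c ^+ 2 / 4)).
  have -> : expR (- (a ^+ 2 / 4)) * expR (- (c ^+ 2 / 4)) =
      2^-1 * (expR (- ((a ^+ 2 + c ^+ 2) / 4)) + expR (- ((a ^+ 2 + (- c) ^+ 2) / 4))).
    have -> : - ((a ^+ 2 + (- c) ^+ 2) / 4) = - (a ^+ 2 / 4) - (c ^+ 2 / 4) by field.
    have -> : - ((a ^+ 2 + c ^+ 2) / 4) = - (a ^+ 2 / 4) - (c ^+ 2 / 4) by field.
    by rewrite expRD; field.
  rewrite [X in X @ _ --> _](_ : _ = fun N => 2^-1 *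
     (N%:R^-1 * (\sum_(k < N) cos (a * x N k + c * y N k)) +
      N%:R^-1 * (\sum_(k < N) cos (a * x N k + - c * y N k)))); last first.
    apply/funext => N; rewrite -mulrDr -big_split mulrCA; congr (_ * _).
    rewrite mulr_sumr; apply: eq_bigr => k _ /=.
    by rewrite mulNr cosD cosB; field.
  apply: cvgM; first exact: cvg_cst.
  by apply: cvgD; exact: H.
have step1 a : N%:R^-1 * \sum_(k < N) expR (- (s * y N k ^+ 2)) * cos (a * x N k) @[N --> \oo] -->
    (Num.sqrt (1 + s))^-1 * expR (- (a ^+ 2 / 4)).
  rewrite mulrC.
  under eq_fun do under eq_bigr do rewrite mulrC.
  apply: (gaussian_average (w := fun N k => cos (a * x N k))) => //.
  by move=> N k; exact: cos_max.
have := gaussian_average (w := fun N k => expR (- (s * y N k ^+ 2))) s0 _ step1.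
have -> : (Num.sqrt (1 + s))^-1 / Num.sqrt (1 + s) = (1 + s)^-1.
  by rewrite -invfM -expr2 sqr_sqrtr// addr_ge0.
have w1 (N k : nat) : `|expR (- (s * y N k ^+ 2))| <= 1.
  by rewrite ger0_norm ?expR_ge0// -[leRHS]expR0 ler_expR oppr_le0 mulr_ge0// sqr_ge0.
move=> /(_ w1).
under eq_fun do under eq_bigr do rewrite -expRD -opprD -mulrDr addrC.
exact.
Qed.

End gaussian_averaging.

(** * Polynomial approximation *)

Section bernstein.
Context {R : realType}.

(* With [k] binomial of parameters [m] and [u], [(bernstein m g).[u]] is the
   mean of [g k]; conditioning on one trial gives the recursion. *)
Fixpoint bernstein (m : nat) (g : nat -> R) : {poly R} :=
  if m is m'.+1 then 'X * bernstein m' (g \o S) + (1 - 'X) * bernstein m' g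
  else (g 0%N)%:P.

Lemma bernsteinS m g u : (bernstein m.+1 g).[u] =
  u * (bernstein m (g \o S)).[u] + (1 - u) * (bernstein m g).[u].
Proof. by rewrite /= !hornerE. Qed.

Lemma bernstein_le m (g h : nat -> R) u : 0 <= u <= 1 ->
  (forall i, (i <= m)%N -> g i <= h i) -> (bernstein m g).[u] <= (bernstein m h).[u].
Proof.
move=> /andP[u0 u1]; elim: m g h => [|m IH] g h gh; first by rewrite !hornerC gh.
rewrite !bernsteinS lerD// ler_wpM2l ?subr_ge0//; apply: IH => i im; apply: gh => //.
exact: leqW.
Qed.

Lemma bernstein_affine m (g : nat -> R) a c u :
  (bernstein m (fun i => a + c * g i)).[u] = a + c * (bernstein m g).[u].
Proof.
elim: m g => [|m IH] g; first by rewrite !hornerC.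
by rewrite !bernsteinS (IH g) [X in u * X](IH (g \o S)); ring.
Qed.

(** Variance plus squared bias; the centre [t] is arbitrary because conditioning on one trial shifts
    it by one. *)
Lemma bernstein_sqr m t u :
  (bernstein m (fun i => (i%:R - t) ^+ 2)).[u] = m%:R * u * (1 - u) + (m%:R * u - t) ^+ 2.
Proof.
elim: m t => [|m IH] t; first by rewrite hornerC; ring.
rewrite bernsteinS IH (_ : _ \o S = fun i => (i%:R - (t - 1)) ^+ 2); last first.
  by apply/funext => i /=; rewrite -natr1; congr (_ ^+ 2); ring.
by rewrite IH -natr1; ring.
Qed.

Lemma compact_unif_continuous (A : set R) (f : R -> R) (e : R) : compact A ->
  continuous f -> 0 < e ->
  exists2 r : R, 0 < r & forall x y, A x -> `|x - y| < r -> `|f x - f y| < e.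
Proof.
move=> /compact_near_coveringP cA cf e0.
pose P (r x : R) := forall y, `|x - y| < r -> `|f x - f y| < e.
have : \forall r \near (0 : R)^'+, A `<=` P r.
  apply: cA => x Ax; have e2 : 0 < e / 2 by rewrite divr_gt0.
  have /cvgr_dist_lt/(_ _ e2)/nbhs_ballP[s /= s0 xs] := cf x.
  exists (ball x (s / 2), [set r | r < s / 2]) => /=.
    split; first by apply/nbhs_ballP; exists (s / 2) => //=; rewrite divr_gt0.
    by apply: nbhs_right_lt; rewrite divr_gt0.
  move=> [z r] /= [xz rs] y zy.
  have xz' : `|f x - f z| < e / 2 by apply: xs; apply: lt_le_trans xz _; lra.
  have xy' : `|f x - f y| < e / 2.
    by apply: xs; rewrite /ball/=; have := ler_distD z x y; rewrite /ball/= in xz; lra.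
  by have := ler_distD (f x) (f z) (f y); rewrite (distrC (f z) (f x)); lra.
move=> cP.
have [r [r0 Ar]] : exists r : R, 0 < r /\ A `<=` P r.
  near (0 : R)^'+ => r; exists r; split; last by near: r.
  by near: r; exact: nbhs_right_gt.
by exists r => // x y Ax; exact: Ar.
Unshelve. all: by end_near. Qed.

(** Chebyshev's argument: |f u - f v| is at most e / 2 + K (v - u)^2, by uniform continuity when v
    is near u and by the size of K otherwise. The positivity of the Bernstein mean transfers this
    bound, leaving only a variance to estimate. *)
Lemma weierstrass_unit_interval (f : R -> R) (e : R) : continuous f -> 0 < e ->
  exists p : {poly R}, forall u, 0 <= u <= 1 -> `|f u - p.[u]| <= e.
Proof.
move=> cf e0; have e2 : 0 < e / 2 by rewrite divr_gt0.
have [r r0 fr] := compact_unif_continuous (@segment_compact R 0 1) cf e2.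
have cnf : {within `[0, 1], continuous (fun u => `|f u|)}.
  by apply: continuous_subspaceT => x; apply: cvg_norm; exact: cf.
have [x _ fx] := EVT_max ler01 cnf.
pose M := `|f x|; have M0 : 0 <= M by exact: normr_ge0.
pose K := 2 * M / r ^+ 2; have K0 : 0 <= K by rewrite divr_ge0 ?sqr_ge0 ?mulr_ge0.
(* The variance of k / m is u (1 - u) / m <= 1 / (4 m), so K / m <= 2 e makes its contribution at
   most e / 2. *)
pose m := (Num.bound (K / (2 * e))).+1.
have m0 : 0 < m%:R :> R by rewrite ltr0n.
have Km : K / m%:R <= 2 * e.
  rewrite ler_pdivrMr// mulrC -ler_pdivrMr ?mulr_gt0//.
  apply: le_trans (ltW (archi_boundP _)) _; first by rewrite divr_ge0// mulr_ge0// ltW.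
  by rewrite ler_nat.
exists (bernstein m (fun i => f (i%:R / m%:R))) => u u01.
have fuv v : 0 <= v <= 1 -> `|f u - f v| <= e / 2 + K * (v - u) ^+ 2.
  move=> v01; have [uv|uv] := ltP `|u - v| r.
    apply: (le_trans (ltW (fr u v _ uv))); first by rewrite /= in_itv.
    by rewrite lerDl mulr_ge0 ?sqr_ge0.
  apply: (@le_trans _ _ (2 * M)).
    have fu : `|f u| <= M by apply: fx; rewrite in_itv.
    have fv : `|f v| <= M by apply: fx; rewrite in_itv.
    by have := ler_normB (f u) (f v); lra.
  rewrite -[leLHS]add0r lerD ?(ltW e2)// /K -mulrA ler_peMr ?mulr_ge0//.
  rewrite mulrC ler_pdivlMr ?exprn_gt0// mul1r -[leRHS]real_normK ?num_real//.
  by rewrite distrC lerXn2r ?nnegrE// ltW.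
have fi i : (i <= m)%N -> `|f u - f (i%:R / m%:R)| <= e / 2 + K / m%:R ^+ 2 * (i%:R - m%:R * u) ^+ 2.
  move=> im; apply: le_trans (fuv _ _) _.
    by rewrite divr_ge0//= ler_pdivrMr// mul1r ler_nat.
  rewrite lerD2l le_eqVlt; apply/orP; left; apply/eqP.
  by field; rewrite gt_eqF.
have var_le : K / m%:R ^+ 2 * (m%:R * u * (1 - u) + (m%:R * u - m%:R * u) ^+ 2) <= e / 2.
  rewrite subrr expr0n addr0 (_ : _ * _ = K / m%:R * (u * (1 - u))); last first.
    by field; rewrite gt_eqF.
  have u4 : u * (1 - u) <= 4^-1 by have := sqr_ge0 (u - 2^-1); lra.
  apply: le_trans (ler_wpM2l _ u4) _; first by rewrite divr_ge0// ltW.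
  by lra.
have := bernstein_sqr m (m%:R * u) u => sqrE.
rewrite ler_distlC; apply/andP; split.
  apply: (@le_trans _ _ (bernstein m (fun i => (f u - e / 2) + - (K / m%:R ^+ 2) *
      (i%:R - m%:R * u) ^+ 2)).[u]).
    by rewrite bernstein_affine sqrE mulNr; move: var_le; lra.
  apply: bernstein_le => // i /fi.
  by rewrite mulNr ler_distl => /andP[]; move: (K / _ * _) => k; lra.
apply: (@le_trans _ _ (bernstein m (fun i => (f u + e / 2) + K / m%:R ^+ 2 *
    (i%:R - m%:R * u) ^+ 2)).[u]).
  apply: bernstein_le => // i /fi.
  by rewrite ler_distl => /andP[]; move: (K / _ * _) => k; lra.
by rewrite bernstein_affine sqrE; move: var_le; lra.
Qed.

End bernstein.

(** * The symmetrized Rayleigh law and weak convergence *)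

Section symmetrized_rayleigh_integral.
Context {R : realType}.
Local Notation mu := (@lebesgue_measure R).
Local Notation pdf := (@symmetrized_rayleigh_pdf R).

Lemma symmetrized_rayleigh_dominates : (@symmetrized_rayleigh R) `<< mu.
Proof.
apply/null_content_dominatesP => A mA muA0; rewrite /symmetrized_rayleigh.
apply/eqP; rewrite eq_le; apply/andP; split; last first.
  by apply: integral_ge0 => x _; rewrite lee_fin symmetrized_rayleigh_pdf_ge0.
rewrite null_set_integral//.
apply/measurable_funTS/measurable_EFinP; exact: measurable_symmetrized_rayleigh_pdf.
Qed.

Lemma integrable_symmetrized_rayleigh_pdf : mu.-integrable setT (EFin \o pdf).
Proof. exact: integrable_abs_gauss. Qed.

(** A change of variables through the Radon-Nikodym derivative, which agrees with [pdf] almost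
    everywhere since both have the same integral over every measurable set. *)
Lemma integral_symmetrized_rayleigh f : measurable_fun setT f ->
  (\int[symmetrized_rayleigh]_x `|f x| < +oo)%E ->
  (\int[symmetrized_rayleigh]_x f x = \int[mu]_x (f x * (pdf x)%:E))%E.
Proof.
move=> mf finf; have dom := symmetrized_rayleigh_dominates.
rewrite -(Radon_Nikodym_change_of_variables dom)//=; last by apply/integrableP; split.
apply: ae_eq_integral => //.
- exact: emeasurable_funM.
- by apply: emeasurable_funM => //; exact: (measurable_int mu integrable_symmetrized_rayleigh_pdf).
- apply: ae_eqe_mul2l => /=.
  apply: integral_ae_eq => //=.
  + exact: Radon_Nikodym_integrable.
  + exact: (measurable_int mu integrable_symmetrized_rayleigh_pdf).
  + by move=> E _ mE; rewrite -Radon_Nikodym_integral.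
Qed.

Local Notation nu := (@symmetrized_rayleigh R).

Lemma integrable_bounded_rayleigh (f : R -> R) (M : R) : measurable_fun setT f ->
  (forall x, `|f x| <= M) -> nu.-integrable setT (EFin \o f).
Proof.
move=> mf fM; apply: (@measurable_bounded_integrable _ _ R nu f setT measurableT _ mf).
  by rewrite [X in (X < _)%E](_ : _ = 1%E) ?ltry//; exact: probability_setT.
by exists M; split; [exact: num_real|move=> y My x _; apply: le_trans (fM x) (ltW My)].
Qed.

Lemma integral_expR_sqr_rayleigh (s : R) : 0 <= s ->
  (\int[nu]_x (expR (- (s * x ^+ 2)))%:E = ((1 + s)^-1)%:E)%E.
Proof.
move=> s0; have p : 0 < 1 + s by rewrite ltr_pwDl.
pose g (x : R) := expR (- (s * x ^+ 2)).
have cg c : continuous (fun x : R => expR (- (c * x ^+ 2))).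
  move=> x; apply: (continuous_cvg _ (@continuous_expR R _)).
  by apply: cvgN; apply: cvgM; [exact: cvg_cst|exact: exprn_continuous].
have mg : measurable_fun setT g by exact: continuous_measurable_fun (cg s).
have g1 x : `|g x| <= 1.
  by rewrite ger0_norm ?expR_ge0// -[leRHS]expR0 ler_expR oppr_le0 mulr_ge0// sqr_ge0.
have gE x : g x * pdf x = `|x| * expR (- ((1 + s) * x ^+ 2)).
  by rewrite mulrCA -expRD; congr (_ * expR _); ring.
pose h (x : R) := `|x| * expR (- ((1 + s) * x ^+ 2)).
have ch : continuous h.
  by move=> x; apply: cvgM; [exact: norm_continuous|exact: cg].
rewrite integral_symmetrized_rayleigh; last 2 first.
- exact/measurable_EFinP.
- have := integrable_bounded_rayleigh mg g1 => /integrableP[_].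
  exact.
under eq_integral do rewrite -EFinM gE.
pose F (x : R) := - ((2 * (1 + s))^-1 * expR (- ((1 + s) * x ^+ 2))).
have dF (x : R) : is_derive x 1 F (x * expR (- ((1 + s) * x ^+ 2))).
  have d1 : is_derive x 1 (fun y : R => - ((1 + s) * y ^+ 2)) (- (2 * (1 + s) * x)).
    by apply: is_derive_eq; rewrite /GRing.scale/=; ring.
  have d2 : is_derive x 1 (fun y : R => expR (- ((1 + s) * y ^+ 2)))
     (expR (- ((1 + s) * x ^+ 2)) * - (2 * (1 + s) * x)) by exact: is_derive1_comp.
  apply: is_derive_eq.
  by rewrite /GRing.scale/=; field; rewrite gt_eqF.
rewrite ge0_symfun_integralT//.
- rewrite (_ : [set x : R | _] = `[0, +oo[%classic); last first.
    by apply/seteqP; split => x /=; rewrite in_itv/= andbT.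
  rewrite (@ge0_continuous_FTC2y _ h F 0 0).
  + rewrite /F expr0n/= mulr0 oppr0 expR0 mulr1 -EFinB sub0r.
    by rewrite opprK -EFinM; congr EFin; field; rewrite gt_eqF.
  + by move=> x _; rewrite mulr_ge0 ?expR_ge0.
  + exact: continuous_subspaceT.
  + rewrite -oppr0; apply: cvgN; rewrite -(mulr0 (2 * (1 + s))^-1).
    apply: cvgM; first exact: cvg_cst.
    apply: (@squeeze_cvgr _ _ _ _ (cst 0) gauss_fun) => //.
    * apply: nearW => x /=; rewrite expR_ge0 ler_expR lerN2.
      by rewrite ler_peMl ?sqr_ge0// lerDl.
    * exact: cvg_cst.
    * exact: cvg_gauss_fun.
  + by move=> x _; exact: ex_derive.
  + apply: cvg_at_right_filter; apply: differentiable_continuous.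
    by apply/derivable1_diffP; exact: ex_derive.
  + move=> x; rewrite in_itv/= andbT => x0.
    by rewrite derive1E (@derive_val _ _ _ _ _ _ _ (dF x)) /h gtr0_norm.
by move=> x /=; rewrite normrN sqrrN.
Qed.

Let ge0_integral_oppr_halfline (f : R -> R) : (forall x, 0 <= f x) -> continuous f ->
  (\int[mu]_x (f x)%:E = \int[mu]_(x in `[0%R, +oo[) (f x)%:E +
    \int[mu]_(x in `[0%R, +oo[) (f (- x))%:E)%E.
Proof.
move=> f0 cf.
have mf : measurable_fun setT f by exact: continuous_measurable_fun.
rewrite -(setUv (`[0%R, +oo[%classic : set R)) ge0_integral_setU//= ; last 4 first.
  exact: measurableC.
  by apply/measurable_EFinP; rewrite setUv.
  by move=> x _; rewrite lee_fin.
  exact/disj_setPCl.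
congr (_ + _)%E.
rewrite setCitvr integral_itv_bndo_bndc; last exact/measurable_EFinP/measurable_funTS.
rewrite -{1}oppr0 ge0_integration_by_substitutionNy//.
exact: continuous_subspaceT.
Qed.

Lemma ge0_integral_comp_oppr (f : R -> R) : (forall x, 0 <= f x) -> continuous f ->
  (\int[mu]_x (f (- x))%:E = \int[mu]_x (f x)%:E)%E.
Proof.
move=> f0 cf.
rewrite [RHS]ge0_integral_oppr_halfline// [LHS]ge0_integral_oppr_halfline//; last first.
  by move=> x; apply: (continuous_cvg _ (cf _)); exact: cvgN.
rewrite addeC; congr (_ + _)%E.
by apply: eq_integral => x _; rewrite opprK.
Qed.

Lemma integral_symmetrized_rayleigh_comp_oppr (f : R -> R) (M : R) : continuous f ->
  (forall x, `|f x| <= M) -> \int[nu]_x f (- x) = \int[nu]_x f x.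
Proof.
move=> cf fM.
have mf : measurable_fun setT f by exact: continuous_measurable_fun.
have cfN : continuous (fun x => f (- x)).
  by move=> x; apply: (continuous_cvg _ (cf _)); exact: cvgN.
have mfN : measurable_fun setT (fun x : R => f (- x)) by exact: continuous_measurable_fun.
(* Adding the bound [M] makes the integrand nonnegative, so that the reflection formula for
   nonnegative continuous functions applies. *)
pose k (g : R -> R) x := (g x + M) * pdf x.
have shift (g : R -> R) : measurable_fun setT g -> (forall x, `|g x| <= M) ->
    ((\int[nu]_x g x) + M)%:E = (\int[mu]_x (k g x)%:E)%E.
  move=> mg gM; have ig := integrable_bounded_rayleigh mg gM.
  have icst : nu.-integrable setT (EFin \o (fun=> M)).
    by apply: (@integrable_bounded_rayleigh _ `|M|).
  have igM : nu.-integrable setT (EFin \o (fun x : R => g x + M)).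
    by have := integrableD measurableT ig icst.
  pose gM' (x : R) := g x + M.
  transitivity (\int[nu]_x (gM' x)%:E)%E.
    rewrite -[RHS]fineK; last exact: integrable_fin_num.
    congr EFin; rewrite -[RHS]/(\int[nu]_x gM' x).
    rewrite [RHS](@RintegralD _ _ _ nu setT _ _ measurableT ig icst).
    by rewrite Rintegral_cst// (congr1 fine (@probability_setT _ _ _ nu)) mulr1.
  rewrite integral_symmetrized_rayleigh//; first exact: (measurable_int nu igM).
  by have /integrableP[] := igM.
have ge0 (g : R -> R) : (forall x, `|g x| <= M) -> forall x, 0 <= k g x.
  move=> gM x; rewrite mulr_ge0 ?symmetrized_rayleigh_pdf_ge0//.
  by have := gM x; rewrite ler_norml => /andP[]; lra.
apply: (addIr M); apply: EFin_inj; rewrite !shift//.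
rewrite -[RHS]ge0_integral_comp_oppr; last 2 first.
- exact: ge0.
- move=> x; apply: cvgM; last exact: continuous_symmetrized_rayleigh_pdf.
  by apply: cvgD; [exact: cf|exact: cvg_cst].
by apply: eq_integral => x _; rewrite /k /symmetrized_rayleigh_pdf normrN sqrrN.
Qed.

End symmetrized_rayleigh_integral.

Section moment_method.
Context {R : realType}.
Local Notation nu := (@symmetrized_rayleigh R).

Definition expN_sqr (x : R) : R := expR (- x ^+ 2).
Local Notation q := expN_sqr.

Lemma expN_sqr_in01 x : 0 <= q x <= 1.
Proof. by rewrite expR_ge0 -[leRHS]expR0 ler_expR oppr_le0 sqr_ge0. Qed.

Lemma expN_sqrX x i : q x ^+ i = expR (- (i%:R * x ^+ 2)).
Proof. by rewrite -expRM_natl mulrN. Qed.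

Lemma continuous_expN_sqr : continuous q.
Proof. exact: continuous_gauss_fun. Qed.

Lemma continuous_horner_expN_sqr (p : {poly R}) : continuous (fun x => p.[q x]).
Proof.
move=> x; apply: (continuous_cvg _ (@continuous_horner _ p _)).
exact: continuous_expN_sqr.
Qed.

Lemma integrable_horner_expN_sqr (p : {poly R}) :
  nu.-integrable setT (EFin \o (fun x => p.[q x])).
Proof.
apply: (@integrable_bounded_rayleigh _ _ (\sum_(i < size p) `|p`_i|)).
  by apply: continuous_measurable_fun; exact: continuous_horner_expN_sqr.
move=> x; rewrite horner_coef; apply: le_trans (ler_norm_sum _ _ _) _.
apply: ler_sum => i _; rewrite normrM ler_piMr// normrX exprn_ile1//.
by have /andP[? ?] := expN_sqr_in01 x; rewrite ger0_norm.
Qed.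

(** The powers of [q] are exp (- i x^2), the test functions of the hypothesis at integer [s];
    linearity does the rest. *)
Lemma mean_horner_cvg (r : nat -> nat -> R) :
  (forall s : R, 0 <= s -> N%:R^-1 * \sum_(k < N) expR (- (s * r N k ^+ 2)) @[N --> \oo] -->
    (1 + s)^-1) ->
  forall p : {poly R}, N%:R^-1 * \sum_(k < N) p.[q (r N k)] @[N --> \oo] --> \int[nu]_x p.[q x].
Proof.
move=> H p.
have iq i : nu.-integrable setT (EFin \o (fun x => q x ^+ i)).
  have := integrable_horner_expN_sqr 'X^i.
  by apply: eq_integrable => // x _; rewrite /= hornerXn.
have -> : \int[nu]_x p.[q x] = \sum_(i < size p) p`_i * (1 + i%:R)^-1.
  transitivity (\int[nu]_x (\sum_(i < size p) p`_i * q x ^+ i)).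
    by apply: eq_Rintegral => x _; rewrite horner_coef.
  rewrite Rintegral_sum_seq; last first.
    by move=> i; have := integrableZl measurableT (p`_i) (iq i); apply: eq_integrable.
  apply: eq_bigr => i _.
  rewrite [LHS](@RintegralZl _ _ _ nu setT _ _ measurableT (iq i)); congr (_ * _).
  rewrite /Rintegral; under eq_integral do rewrite expN_sqrX.
  by rewrite integral_expR_sqr_rayleigh.
rewrite [X in X @ _ --> _](_ : _ = fun N => \sum_(i < size p) p`_i *
    (N%:R^-1 * \sum_(k < N) expR (- (i%:R * r N k ^+ 2)))); last first.
  apply/funext => N.
  under [in LHS]eq_bigr do rewrite horner_coef.
  rewrite exchange_big mulr_sumr; apply: eq_bigr => i _ /=.
  rewrite mulrCA -mulr_sumr; congr (_ * (_ * _)).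
  by apply: eq_bigr => k _; rewrite expN_sqrX.
apply: cvg_big => [|i _]; first exact: add_continuous.
apply: cvgM; first exact: cvg_cst.
exact: H.
Qed.

(** Shows that the cost of the cutoff vanishes: 1 - q x < 1 at every x, and the integrands are
    bounded by 1. *)
Lemma integral_onem_expN_sqr_cvg0 :
  \int[nu]_x ((1 - 'X) ^+ n).[q x] @[n --> \oo] --> (0 : R).
Proof.
have x1 x n : ((1 - 'X) ^+ n).[q x] = (1 - q x) ^+ n.
  by rewrite horner_exp !hornerE.
have q01 x : 0 <= 1 - q x <= 1 by have /andP[? ?] := expN_sqr_in01 x; lra.
pose f (n : nat) := EFin \o (fun x : R => ((1 - 'X) ^+ n).[q x]).
have if_ n : nu.-integrable setT (f n) by exact: integrable_horner_expN_sqr.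
have mf n : measurable_fun setT (f n) by exact: (measurable_int nu (if_ n)).
have i1 : nu.-integrable setT (EFin \o (fun=> 1%R)).
  by apply: (@integrable_bounded_rayleigh _ _ 1) => // x; rewrite normr1.
have f0 : {ae nu, forall x, setT x -> f n x @[n --> \oo] --> (EFin \o (fun=> 0%R)) x}.
  apply: aeW => x _; apply: cvg_EFin; first exact: nearW.
  rewrite [X in X @ _ --> _](_ : _ = fun n => (1 - q x) ^+ n); last first.
    by apply/funext => n /=; rewrite x1.
  apply: cvg_expr; rewrite ger0_norm; last by case/andP: (q01 x).
  by rewrite ltrBlDr ltrDl expR_gt0.
have f1 : {ae nu, forall x n, setT x -> (`|f n x| <= (EFin \o (fun=> 1%R)) x)%E}.
  apply: aeW => x n _; rewrite lee_fin x1 normrX exprn_ile1// ger0_norm//; case/andP: (q01 x) => //.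
have [_ _ dc] := @dominated_convergence _ (measurableTypeR R) R nu setT measurableT
  f (EFin \o (fun=> 0%R)) (EFin \o (fun=> 1%R)) mf (measurable_cst _) f0 i1 f1.
have -> : 0 = fine (\int[nu]_x (EFin \o (fun=> 0%R)) x)%E by rewrite integral0.
apply: fine_cvg; rewrite fineK//.
by apply: integrable_fin_num => //; apply: (@integrable_bounded_rayleigh _ _ 0) => // x; rewrite normr0.
Qed.

(** With u = exp (- x^2), an even h becomes h (sqrt (- ln u)), which in general has no limit as u
    decreases to 0. The second factor vanishes at 0 and, h being bounded, restores continuity
    there. *)
Lemma continuous_cutoff (h : R -> R) (M : R) n : continuous h -> (forall x, `|h x| <= M) ->
  continuous (fun u => h (Num.sqrt (- ln u)) * (1 - (1 - u) ^+ n)).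
Proof.
move=> ch hM u.
have cv : {for u, continuous (fun u : R => 1 - (1 - u) ^+ n)}.
  apply: cvgB; first exact: cvg_cst.
  apply: (continuous_cvg _ (@exprn_continuous _ n _)).
  by apply: cvgB; [exact: cvg_cst|exact: cvg_id].
have [u0|u0|u0] := ltgtP u 0.
(* For negative arguments [ln] takes its default value 0, so the first factor is locally
   constant. *)
- have E : h (Num.sqrt (- ln u)) = h 0 by rewrite ln0 ?ltW// oppr0 sqrtr0.
  have : h 0 * (1 - (1 - v) ^+ n) @[v --> u] --> h 0 * (1 - (1 - u) ^+ n).
    by apply: cvgM; [exact: cvg_cst|exact: cv].
  rewrite -E; apply: cvg_trans; apply: near_eq_cvg.
  near=> v; rewrite E ln0 ?oppr0 ?sqrtr0//.
  by apply: ltW; near: v; exact: lt_nbhsl.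
- apply: cvgM; last exact: cv.
  apply: (continuous_cvg _ (ch _)); apply: (continuous_cvg _ (@sqrt_continuous R _)).
  by apply: cvgN; exact: continuous_ln.
- have z0 : 1 - (1 - 0 : R) ^+ n = 0 by rewrite subr0 expr1n subrr.
  have cv0 : 1 - (1 - v) ^+ n @[v --> (0 : R)] --> (0 : R).
    by rewrite -[X in _ --> X]z0; move: cv; rewrite u0.
  rewrite u0 /continuous_at z0 mulr0.
  have c0 : M * `|1 - (1 - v) ^+ n| @[v --> (0 : R)] --> (0 : R).
    rewrite -[X in _ --> X](mulr0 M); apply: cvgM; first exact: cvg_cst.
    by rewrite -[X in _ --> X](normr0 R); exact: cvg_norm.
  apply: (@squeeze_cvgr _ _ _ _ (fun v => - (M * `|1 - (1 - v) ^+ n|)) (fun v => M * `|1 - (1 - v) ^+ n|)) => //.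
    by apply: nearW => v; rewrite -ler_norml normrM ler_wpM2r.
  by rewrite -[X in _ --> X]oppr0; exact: cvgN.
Unshelve. all: by end_near. Qed.

(** The error is the removed part, at most M (1 - q)^n, plus the Weierstrass error. It is stated as
    a polynomial in [q] so that its empirical means converge too. *)
Lemma even_approx (h : R -> R) (M e : R) n : continuous h -> (forall x, `|h x| <= M) ->
  (forall x, h (- x) = h x) -> 0 < e ->
  exists p : {poly R}, forall x, `|h x - p.[q x]| <= (M *: (1 - 'X) ^+ n + e%:P).[q x].
Proof.
move=> ch hM hN e0.
have [p pP] := weierstrass_unit_interval (continuous_cutoff (n := n) ch hM) e0.
exists p => x; have := pP _ (expN_sqr_in01 x).
have hq : h (Num.sqrt (- ln (q x))) = h x.
  by rewrite expRK opprK sqrtr_sqr; have [_|_] := ger0P x; rewrite ?hN.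
rewrite hq hornerD hornerZ horner_exp !hornerE => hp.
have /andP[q0 q1] := expN_sqr_in01 x.
have Q0 : 0 <= (1 - q x) ^+ n by rewrite exprn_ge0// subr_ge0.
have hQ : `|h x * (1 - q x) ^+ n| <= M * (1 - q x) ^+ n.
  by rewrite normrM (ger0_norm Q0) ler_wpM2r.
rewrite (_ : h x - _ = h x * (1 - q x) ^+ n + (h x * (1 - (1 - q x) ^+ n) - p.[q x])); last by ring.
by apply: le_trans (ler_normD _ _) _; exact: lerD.
Qed.

Lemma mean_even_cvg (r : nat -> nat -> R) (h : R -> R) (M : R) :
  (forall s : R, 0 <= s -> N%:R^-1 * \sum_(k < N) expR (- (s * r N k ^+ 2)) @[N --> \oo] -->
    (1 + s)^-1) ->
  continuous h -> (forall x, `|h x| <= M) -> (forall x, h (- x) = h x) ->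
  N%:R^-1 * \sum_(k < N) h (r N k) @[N --> \oo] --> \int[nu]_x h x.
Proof.
move=> H ch hM hN.
have M0 : 0 <= M by exact: le_trans (hM 0).
have mh : measurable_fun setT h by exact: continuous_measurable_fun.
have ih := integrable_bounded_rayleigh mh hM.
apply/cvgrPdist_le => e e0.
(* The three errors will be at most 2, 1 and 3 eighths of e: limit approximation, polynomial
   convergence and empirical approximation. *)
pose e8 := e / 8; have e80 : 0 < e8 by rewrite divr_gt0.
have [n nP] : exists n : nat, M * \int[nu]_x ((1 - 'X) ^+ n).[q x] <= e8.
  have : M * \int[nu]_x ((1 - 'X) ^+ n).[q x] @[n --> \oo] --> (M * 0 : R).
    by apply: cvgM; [exact: cvg_cst|exact: integral_onem_expN_sqr_cvg0].
  rewrite mulr0 => /cvgr_le/(_ _ e80)[n _ nP]; exists n; exact: (nP n (leqnn n)).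
have [p hp] := even_approx n ch hM hN e80.
pose S := M *: (1 - 'X) ^+ n + e8%:P.
have iS := integrable_horner_expN_sqr S.
have ip := integrable_horner_expN_sqr p.
have ES : \int[nu]_x S.[q x] <= 2 * e8.
  have iX := integrable_horner_expN_sqr ((1 - 'X) ^+ n).
  have iMX : nu.-integrable setT (EFin \o (fun x => M * ((1 - 'X) ^+ n).[q x])).
    by have := integrableZl measurableT M iX; apply: eq_integrable.
  have ie8 : nu.-integrable setT (EFin \o (fun=> e8)).
    by apply: (@integrable_bounded_rayleigh _ _ e8) => // x; rewrite ger0_norm// ltW.
  have -> : \int[nu]_x S.[q x] = \int[nu]_x (M * ((1 - 'X) ^+ n).[q x] + e8).
    by apply: eq_Rintegral => x _; rewrite hornerD hornerZ hornerC.
  rewrite (@RintegralD _ _ _ nu setT _ _ measurableT iMX ie8).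
  rewrite (@RintegralZl _ _ _ nu setT _ _ measurableT iX).
  rewrite Rintegral_cst// (congr1 fine (@probability_setT _ _ _ nu)) mulr1.
  by lra.
have Ehp : `|\int[nu]_x h x - \int[nu]_x p.[q x]| <= \int[nu]_x S.[q x].
  rewrite -(@RintegralB _ _ _ nu setT _ _ measurableT ih ip).
  have ihp := integrableB measurableT ih ip.
  apply: le_trans (le_normr_Rintegral measurableT ihp) _.
  apply: le_Rintegral => //; first exact: integrable_norm.
have mean_hp N : `|N%:R^-1 * (\sum_(k < N) h (r N k)) - N%:R^-1 * \sum_(k < N) p.[q (r N k)]|
    <= N%:R^-1 * \sum_(k < N) S.[q (r N k)].
  rewrite -mulrBr -sumrB normrM ger0_norm ?invr_ge0// ler_wpM2l ?invr_ge0//.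
  by apply: le_trans (ler_norm_sum _ _ _) _; apply: ler_sum => k _; exact: hp.
have tri (a b c d s t : R) : `|c - d| <= s -> `|d - b| <= e8 -> `|a - b| <= t ->
    s <= 2 * e8 -> t <= 3 * e8 -> `|c - a| <= e.
  have -> : e = 8 * e8 by rewrite /e8; field.
  have := ler_distD d c a; have := ler_distD b d a; rewrite (distrC b a).
  clear -e80; lra.
near=> N.
have pN : `|\int[nu]_x p.[q x] - N%:R^-1 * \sum_(k < N) p.[q (r N k)]| <= e8.
  near: N; move: (@mean_horner_cvg r H p) => /cvgrPdist_le; exact.
have SN : N%:R^-1 * \sum_(k < N) S.[q (r N k)] <= 3 * e8.
  near: N; move: (@mean_horner_cvg r H S) => /cvgr_le; apply.
  by apply: le_lt_trans ES _; rewrite ltr_pM2r// ltr_nat.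
exact: tri Ehp pN (mean_hp N) ES SN.
Unshelve. all: by end_near. Qed.

End moment_method.

Section weak_convergence.
Context {R : realType}.
Local Notation nu := (@symmetrized_rayleigh R).

(** Up to an error 4 M / N the spectrum sees only the even part of f, and so does the limit law,
    which is symmetric. The convergence for even functions therefore suffices. *)
Lemma weakly_converges_rayleigh (b : nat -> R) :
  N%:R^-1 * \sum_(j < N) b j ^+ 2 @[N --> \oo] --> (1 : R) ->
  N%:R ^- 2 * \sum_(j < N) b j ^+ 4 @[N --> \oo] --> (0 : R) ->
  (forall p q : rat, N%:R^-1 * \sum_(k < N)
    ((oneDi_prod (fun j => trig_coef N (ratr p) (ratr q) k j / Num.sqrt N%:R * b j) N).1 - 1)
    @[N --> \oo] --> (0 : R)) ->
  weakly_converges (fun N => empirical_spectral_measure N b) symmetrized_rayleigh.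
Proof.
move=> m2 m4 trig f cf [M fM].
have mf : measurable_fun setT f by exact: continuous_measurable_fun.
have M0 : 0 <= M by exact: le_trans (fM 0).
have cos_cvg := mean_cos_cvg_real m2 (fun p q => mean_cos_cvg m2 m4 (trig p q)).
have exp_cvg := @mean_expR_sqr_cvg _ (fun N k => fourier_cos N b k / Num.sqrt N%:R)
  (fun N k => fourier_sin N b k / Num.sqrt N%:R) cos_cvg.
pose r N k := fourier_modulus N b k / Num.sqrt N%:R.
have rE N k : (fourier_cos N b k / Num.sqrt N%:R) ^+ 2 + (fourier_sin N b k / Num.sqrt N%:R) ^+ 2 =
    r N k ^+ 2.
  by rewrite /r !exprMn -mulrDl sqr_sqrtr// addr_ge0// sqr_ge0.
have r_cvg (s : R) : 0 <= s -> N%:R^-1 * \sum_(k < N) expR (- (s * r N k ^+ 2)) @[N --> \oo] -->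
    (1 + s)^-1.
  move=> s0; have := exp_cvg s s0.
  by under eq_fun do under eq_bigr do rewrite rE.
pose h x := (f x + f (- x)) / 2.
have cfN : continuous (fun x => f (- x)).
  by move=> x; apply: (continuous_cvg _ (cf _)); exact: cvgN.
have ch : continuous h.
  by move=> x; apply: cvgM; [apply: cvgD; [exact: cf|exact: cfN]|exact: cvg_cst].
have hM x : `|h x| <= M.
  rewrite normrM (@ger0_norm _ 2^-1)// ler_pdivrMr// mulr_natr mulr2n.
  by apply: le_trans (ler_normD _ _) _; exact: lerD.
have hN x : h (- x) = h x by rewrite /h opprK addrC.
have h_cvg := mean_even_cvg r_cvg ch hM hN.
have Eh : \int[nu]_x h x = \int[nu]_x f x.
  have if_ := integrable_bounded_rayleigh mf fM.
  have ifN : nu.-integrable setT (EFin \o (fun x : R => f (- x))).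
    by apply: (integrable_bounded_rayleigh (M := M)) => //; exact: continuous_measurable_fun cfN.
  have iD : nu.-integrable setT (EFin \o (fun x : R => f x + f (- x))).
    by have := integrableD measurableT if_ ifN.
  transitivity (\int[nu]_x (2^-1 * (f x + f (- x)))).
    by apply: eq_Rintegral => x _; rewrite mulrC.
  rewrite (@RintegralZl _ _ _ nu setT _ _ measurableT iD).
  rewrite (@RintegralD _ _ _ nu setT _ _ measurableT if_ ifN).
  by rewrite (integral_symmetrized_rayleigh_comp_oppr cf fM); lra.
(* The nontrivial eigenvalues of the swirl are twice the Hankel ones, which cancels the 2 in the
   normalization. *)
pose g N x := f (2 * x / (2 * Num.sqrt N%:R)).
have gE N x : g N x = f (x / Num.sqrt N%:R).
  by rewrite /g invfM mulrACA divff// mul1r.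
have spec_near N : (0 < N)%N ->
    `|N%:R^-1 * (\sum_(i < N) f (nontrivial_eigenvalue N b i / (2 * Num.sqrt N%:R))) -
      N%:R^-1 * \sum_(k < N) h (r N k)| <= 4 * M * N%:R^-1.
  move=> N0; rewrite -mulrBr normrM ger0_norm ?invr_ge0// mulrC ler_wpM2r ?invr_ge0//.
  rewrite (sum_nontrivial_eigenvalue b N0 (fun x => f (x / (2 * Num.sqrt N%:R)))).
  have := sum_eigenvalue_symmetrize b N0 (f := g N) (fun x => fM _).
  have -> // : \sum_(k < N) (g N (fourier_modulus N b k) + g N (- fourier_modulus N b k)) / 2 =
    \sum_(k < N) h (r N k).
  by apply: eq_bigr => k _; rewrite !gE mulNr.
have spec_cvg : N%:R^-1 * (\sum_(i < N) f (nontrivial_eigenvalue N b i / (2 * Num.sqrt N%:R)))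
    @[N --> \oo] --> \int[nu]_x f x.
  rewrite -Eh.
  have d0 : 4 * M * N%:R^-1 @[N --> \oo] --> (0 : R).
    rewrite -[X in _ --> X](mulr0 (4 * M)); apply: cvgM; first exact: cvg_cst.
    by rewrite -(cvg_shiftS (fun n : nat => (n%:R : R)^-1)); exact: cvg_harmonic.
  apply: (@squeeze_cvgr _ _ _ _
    (fun N => N%:R^-1 * (\sum_(k < N) h (r N k)) - 4 * M * N%:R^-1)
    (fun N => N%:R^-1 * (\sum_(k < N) h (r N k)) + 4 * M * N%:R^-1)).
  - near=> N; rewrite -ler_distl; apply: spec_near; near: N; exact: nbhs_infty_gt.
  - by rewrite -[X in _ --> X]subr0; exact: cvgB.
  - by rewrite -[X in _ --> X]addr0; exact: cvgD.
have -> : (\int[nu]_x (f x)%:E = (\int[nu]_x f x)%:E)%E.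
  by rewrite fineK//; apply: integrable_fin_num => //; exact: integrable_bounded_rayleigh fM.
under eq_fun do rewrite integral_empirical_spectral_measure//.
by apply: cvg_EFin => //; exact: nearW.
Unshelve. all: by end_near. Qed.

End weak_convergence.

Theorem corollary4p13 (R : realType) (d : measure_display)
    (T : measurableType d) (P : probability T R) (b : nat -> {RV P >-> R})
    (b_independent : mutually_independent b)
    (b_identically_distributed : identically_distributed b)
    (b_moments : forall i k : nat,
      P.-integrable [set: T] (fun w => (b i w ^+ k)%:E))
    (b_mean : forall i : nat, ('E_P[b i] = 0)%E)
    (b_variance : forall i : nat, ('V_P[b i] = 1)%E) :
  {ae P, forall w : T,
    weakly_converges
      (fun N => empirical_spectral_measure N (fun i => b i w))
      symmetrized_rayleigh}.
Proof.
have b_mean' i : \int[P]_w b i w = 0.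
  by rewrite /Rintegral -expectation_def b_mean.
have b_sqr i : \int[P]_w (b i w ^+ 2) = 1.
  apply: EFin_inj.
  rewrite -(b_variance i) /variance covariance.unlock b_mean /=.
  rewrite fineK; last by apply: integrable_fin_num => //; exact: b_moments.
  rewrite expectation_def; apply: eq_integral => w _.
  by rewrite expr2 /= !subr0.
have trig : {ae P, forall w, forall p q : rat, N%:R^-1 * \sum_(k < N)
    ((oneDi_prod (fun j => trig_coef N (ratr p) (ratr q) k j / Num.sqrt N%:R * b j w) N).1 - 1)
    @[N --> \oo] --> (0 : R)}.
  (* The exceptional null set depends on the frequencies. Enumerating pairs of rationals by [pickle]
     gives a single null set for all of them. *)
  have := @ae_foralln _ _ _ P (fun n w => forall pq : rat * rat, pickle_inv n = Some pq ->
    N%:R^-1 * \sum_(k < N) ((oneDi_prod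
      (fun j => trig_coef N (ratr pq.1) (ratr pq.2) k j / Num.sqrt N%:R * b j w) N).1 - 1)
    @[N --> \oo] --> (0 : R)).
  case.
    move=> n; case: (pickle_inv n) => [[p q]|]; last by apply: aeW.
    apply: filterS (ae_trig_products b_independent b_identically_distributed
      b_moments b_mean' (ratr p) (ratr q)).
    by move=> w wpq _ [<-].
  move=> A [mA A0 subA]; exists A; split => //; apply: subset_trans subA.
  by apply: subsetC => w H p q; exact: (H (pickle (p, q)) (p, q) (pickleK_inv _)).
have m2 := ae_mean_sqr b_independent b_identically_distributed b_moments b_sqr.
have m4 := ae_mean_fourth b_independent b_identically_distributed b_moments.
apply: filterS3 m2 m4 trig => w; exact: weakly_converges_rayleigh.
Qed.
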